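(* Let $n\ge2$ and $Q=n+2$ with $Q\geq 5$, and let $u\in C_c^\infty(\mathbb{R}^{n+1} \setminus \{o\})$. Then: (a) (Hardy-Rellich inequality) $$\int_{\mathbb{R}^{n+1}}\frac{(\mathcal{L}_G u)^{2}}{|\nabla_G \varrho|^{2}}\,dx\,dt \geq \frac{Q^2}{4} \int_{\mathbb{R}^{n+1}} \frac{|\nabla_G u|^{2}}{\varrho^2}\,dx\,dt +\int_{\mathbb{R}^{n+1}}\varrho^{2-Q} \left|\nabla_{G}\left(u_\varrho\, \varrho^{\frac{Q-2}{2}}\right)\right|^{2}\,dx\,dt.$$ (b) (Rellich inequality) $$\int_{\mathbb{R}^{n+1}}\frac{(\mathcal{L}_G u)^2}{|\nabla_G \varrho|^2}\,dx\,dt\geq\frac{Q^2(Q-4)^2}{16}\int_{\mathbb{R}^{n+1}} \frac{|u|^2|\nabla_G \varrho|^2}{\varrho^4}\,dx\,dt + \frac{Q^2}{4}\int_{\mathbb{R}^{n+1}}\varrho^{2-Q}\left|\nabla_G\left(u\,\varrho^{\frac{Q-4}{2}}\right)\right|^2\,dx\,dt +\int_{\mathbb{R}^{n+1}} \varrho^{2-Q}\left|\nabla_{G}\left(u_\varrho\, \varrho^{\frac{Q-2}{2}}\right)\right|^{2} \,dx\,dt.$$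
   Context: Grushin space: $n\ge 2$ is an integer and $Q=n+2$ (homogeneous dimension). Points of $\mathbb{R}^{n+1}$ are written $(x,t)$ with $x\in\mathbb{R}^n$, $t\in\mathbb{R}$; $o$ is the origin; all functions are real-valued. The Grushin gradient is $\nabla_G u=(\nabla_x u,\ |x|\partial_t u)$, so $|\nabla_G u|^2=|\nabla_x u|^2+|x|^2(\partial_t u)^2$. The Grushin operator is $\mathcal{L}_G=\Delta_x+|x|^2\partial_t^2$. The homogeneous norm is $\varrho(x,t)=(|x|^4+4t^2)^{1/4}$; it satisfies $|\nabla_G\varrho|^2=|x|^2/\varrho^2$ away from $o$. The suffix $\varrho$ denotes the radial derivative: $u_\varrho=\partial_\varrho u=\frac1\varrho\left(\sum_{j=1}^n x_j\partial_{x_j}u+2t\,\partial_t u\right)$. *)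

(* Defs.v *)
From HB Require Import structures.
From mathcomp Require Import all_boot all_order all_algebra.
From mathcomp Require Import all_classical all_reals all_analysis.

Set Implicit Arguments.
Unset Strict Implicit.
Unset Printing Implicit Defensive.

Import Order.TTheory GRing.Theory Num.Theory.
Import numFieldNormedType.Exports.

Local Open Scope classical_set_scope.
Local Open Scope ring_scope.

(* Lebesgue measure on R^n, realized on n-tuples (whose sigma-algebra in the
   library is the one generated by the coordinates, i.e. the Borel one):
   the n-fold product of the one-dimensional Lebesgue measure. *)
Section lebesgue_tuple.
Context {R : realType}.
Local Notation mR := (measurableTypeR R).

Definition tuple_cons {n : nat} (p : mR * n.-tuple mR) : n.+1.-tuple mR :=
  [tuple of p.1 :: p.2].

Lemma measurable_tuple_cons (n : nat) :
  measurable_fun setT (@tuple_cons n).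
Proof. exact: measurable_cons. Qed.

Section step.
Variables (n : nat) (m : {sigma_finite_measure set (n.-tuple mR) -> \bar R}).

Definition lebesgue_cons : set (n.+1.-tuple mR) -> \bar R :=
  pushforward (@lebesgue_measure R \x m)%E (@tuple_cons n).

Let lebesgue_cons0 : lebesgue_cons set0 = 0%E.
Proof. by rewrite /lebesgue_cons /pushforward preimage_set0 measure0. Qed.

Let lebesgue_cons_ge0 A : (0 <= lebesgue_cons A)%E.
Proof. by rewrite /lebesgue_cons /pushforward; exact: measure_ge0. Qed.

Let lebesgue_cons_sigma_additive : semi_sigma_additive lebesgue_cons.
Proof.
move=> F mF tF mUF.
have mpre B : measurable B -> measurable (@tuple_cons n @^-1` B).
  by move=> mB; rewrite -[X in measurable X]setTI;
    exact: measurable_tuple_cons.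
rewrite /lebesgue_cons /pushforward preimage_bigcup.
apply: measure_semi_sigma_additive.
- by move=> i; exact: mpre.
- apply/trivIsetP => /= i j _ _ ij; rewrite -preimage_setI.
  by move/trivIsetP : tF => /(_ _ _ _ _ ij) ->//; rewrite preimage_set0.
- by rewrite -preimage_bigcup; exact: mpre.
Qed.

HB.instance Definition _ := isMeasure.Build _ _ _ lebesgue_cons
  lebesgue_cons0 lebesgue_cons_ge0 lebesgue_cons_sigma_additive.

Let uncons (v : n.+1.-tuple mR) : mR * n.-tuple mR :=
  (thead v, [tuple of behead v]).

Let unconsK : cancel uncons (@tuple_cons n).
Proof. by move=> v; rewrite [RHS]tuple_eta; apply/val_inj. Qed.

Let tuple_consK : cancel (@tuple_cons n) uncons.
Proof. by move=> [x v]; congr pair; apply/val_inj. Qed.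

Let measurable_uncons : measurable_fun setT uncons.
Proof.
apply/measurable_fun_pairP; split; first exact: measurable_tnth.
exact: measurable_behead.
Qed.

Let lebesgue_cons_sigma_finite : sigma_finite setT lebesgue_cons.
Proof.
have /sigma_finiteP[F [TF ndF Foo]] := sigma_finiteT (@lebesgue_measure R).
have /sigma_finiteP[G [TG ndG Goo]] := sigma_finiteT m.
exists (fun k => uncons @^-1` (F k `*` G k)).
  rewrite -preimage_bigcup (_ : \bigcup_k _ = setT) ?preimage_setT//.
  apply/seteqP; split=> // -[x v] _.
  have [i _ Fx] : (\bigcup_i F i) x by rewrite -TF.
  have [j _ Gv] : (\bigcup_j G j) v by rewrite -TG.
  exists (maxn i j) => //; split.
    by move: x Fx; exact/subsetPset/ndF/leq_maxl.
  by move: v Gv; exact/subsetPset/ndG/leq_maxr.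
move=> k; have [mF Fk] := Foo k; have [mG Gk] := Goo k; split.
  rewrite -[X in measurable X]setTI; apply: measurable_uncons => //.
  exact: measurableX.
rewrite /lebesgue_cons /pushforward -comp_preimage.
rewrite (_ : uncons \o _ = id); last by apply/funext => p; exact: tuple_consK.
by rewrite product_measure1E// lte_mul_pinfty// ge0_fin_numE.
Qed.

HB.instance Definition _ := Measure_isSigmaFinite.Build _ _ _ lebesgue_cons
  lebesgue_cons_sigma_finite.

End step.

Fixpoint lebesgue_tuple (n : nat) :
    {sigma_finite_measure set (n.-tuple mR) -> \bar R} :=
  match n with
  | 0 => \d_([tuple] : 0.-tuple mR)
  | k.+1 => lebesgue_cons (lebesgue_tuple k)
  end.

Lemma lebesgue_tuple_box (n : nat) (A : 'I_n -> set mR) :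
  (forall i, measurable (A i)) ->
  lebesgue_tuple n [set v | forall i, A i (tnth v i)] =
  (\prod_(i < n) @lebesgue_measure R (A i))%E.
Proof.
elim: n A => [|n IH] A mA /=.
  by rewrite big_ord0 /dirac indicE mem_set// => -[].
rewrite big_ord_recl -IH//= /lebesgue_cons /pushforward.
rewrite -product_measure1E//.
  congr product_measure1; apply/seteqP; split => -[x v] /=.
    move=> H; split; first exact: (H ord0).
    by move=> i; have := H (lift ord0 i); rewrite tnthS.
  move=> [Hx Hv] i; case: (unliftP ord0 i) => [j ->|->] //.
  by rewrite tnthS; exact: Hv.
have -> : [set v : n.-tuple mR | forall i, A (lift ord0 i) (tnth v i)] =
    \bigcap_(i in [set: 'I_n]) ((@tnth n mR)^~ i @^-1` A (lift ord0 i)).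
  by apply/seteqP; split => v /= H i; [move=> _|]; exact: H.
apply: fin_bigcap_measurable; first exact: finite_finset.
move=> i _; rewrite -[X in measurable X]setTI.
exact: measurable_tnth.
Qed.

End lebesgue_tuple.

Section grushin.
Context {R : realType} {n : nat}.

(* The point (x, t) of R^n x R. *)
Local Notation pt := ('rV[R]_n * R)%type.
Implicit Types (u f : pt -> R) (p : pt).

Definition integralG f : \bar R :=
  (\int[lebesgue_tuple n \x @lebesgue_measure R]_z
     (f (\row_i tnth z.1 i, z.2))%:E)%E.

Definition dx (i : 'I_n) f : pt -> R := 'D_((delta_mx 0 i, 0) : pt) f.
Definition dt f : pt -> R := 'D_((0, 1) : pt) f.

(* C^k: all partial derivatives of order at most k exist and are continuous. *)
Fixpoint Ck (k : nat) f : Prop :=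
  match k with
  | 0 => continuous f
  | k'.+1 =>
      [/\ continuous f,
          forall i p, derivable f p (delta_mx 0 i, 0),
          forall p, derivable f p (0, 1),
          forall i, Ck k' (dx i f)
        & Ck k' (dt f)]
  end.

Definition smooth f : Prop := forall k, Ck k f.

Definition supp f : set pt := closure [set p | f p != 0].

(* C_c^oo(R^(n+1) \ {o}): a function on the punctured space with compact support
   there is identified with its extension by zero. *)
Definition test_function f : Prop :=
  [/\ smooth f, compact (supp f) & ~ supp f (0, 0)].

(* Euclidean norms; the library norm on 'rV[R]_n and on products is the
   sup norm. *)
Definition enorm (x : 'rV[R]_n) : R := Num.sqrt (\sum_i x 0 i ^+ 2).
Definition enormG (v : pt) : R := Num.sqrt (\sum_i v.1 0 i ^+ 2 + v.2 ^+ 2).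

Definition gradG f p : pt := (\row_i dx i f p, enorm p.1 * dt f p).

Definition LG f p : R :=
  \sum_i dx i (dx i f) p + enorm p.1 ^+ 2 * dt (dt f) p.

Definition rho p : R := (enorm p.1 ^+ 4 + 4 * p.2 ^+ 2) `^ 4^-1.

Definition drho f p : R :=
  (rho p)^-1 * (\sum_j p.1 0 j * dx j f p + 2 * p.2 * dt f p).

End grushin.

(* Main.v *)
(* Let D = rho d/drho be the generator of the dilations. Off the axis x = 0 one has
   rho^2 / |grad rho|^2 L = D^2 + n D - A, where A is a nonnegative operator on the
   gauge spheres that commutes with D; let Gamma be its carre du champ. All the
   terms of the theorem are integrals of quadratic expressions in D u, D D u, A u
   and Gamma against |x|^2 rho^-6 dx dt, for which the adjoint of D is
   - D - (Q - 4). Integrating by parts in D and using Green's formula for A, (a)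
   becomes the inequality
     int (A u)^2 - 4 Gamma(u, u) + Gamma(D u + b u, D u + b u) >= 0, b = (Q - 4) / 2,
   and this follows from int (A u)^2 >= (n + 1) int Gamma(u, u), since n >= 3.
   The latter is obtained by writing the integrand as a sum of squares plus
   divergences tangent to the gauge spheres, Bochner's formula on the sphere of
   directions x / |x| being one of them. Finally (b) follows from (a) by one more
   integration by parts in D. *)

(* The constant n + 1 is the eigenvalue of A on x_j / rho, because L annihilates x_j, which has
   degree 1 under D. Equality holds there, so each square of the pointwise identity has to vanish on
   x_j / rho. This dictates the multiplier [hh] = 1 / (rho^4 + |x|^4), with which the first square
   vanishes; the other terms vanish because [rot] multiplies x_j / rho by 2t / |x|^2 and the
   spherical Laplacian multiplies it by n - 1. The obstacle is the axis x = 0: u need not vanish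
   there, while x / |x| and the coefficients of [rot] are singular. The algebra takes place in a
   commutative ring of functions smooth off the axis, where [ring] proves identities between
   derivatives. A bounded partial derivative of a compactly supported function has integral zero,
   because almost every coordinate line misses the axis; the work lies in checking that the powers
   of 1 / |x| cancel in each field. The left-hand integrand may still grow like |x|^-2, so
   inequalities are kept pointwise, modulo functions of integral zero, and integrated only at the
   end. *)
From HB Require Import structures.
Require Import Defs.
From mathcomp Require Import all_boot all_order all_algebra.
From mathcomp Require Import all_classical all_reals all_analysis.
From mathcomp Require Import measurable_realfun ring lra.

Set Implicit Arguments.
Unset Strict Implicit.
Unset Printing Implicit Defensive.

Import Order.TTheory GRing.Theory Num.Theory.
Import numFieldNormedType.Exports.

Local Open Scope classical_set_scope.
Local Open Scope ring_scope.

(** * Functions smooth off the axis *)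

Section smooth_on.
Context {R : realType} {V : normedModType R} {I : Type}.
Variables (dir : I -> V) (U : set V).
Hypothesis oU : open U.
Implicit Types f g : V -> R.

(** [f] is total, but only its germs at the points of the open set [U] matter (see [eq_Ck_on]), and
    derivatives are taken only along the family [dir]. *)
Fixpoint Ck_on k f : Prop :=
  (forall p, U p -> {for p, continuous f}) /\
  match k with
  | 0 => True
  | k'.+1 => (forall d p, U p -> derivable f p (dir d)) /\
             forall d, Ck_on k' ('D_(dir d) f)
  end.

Definition smooth_on f := forall k, Ck_on k f.

Lemma near_eq_on f g p : {in U, f =1 g} -> U p -> \near p, f p = g p.
Proof.
move=> fg Up; apply: (filterS _ (open_nbhs_nbhs (conj oU Up))) => q Uq.
exact/fg/mem_set.
Qed.

Lemma eq_derive_on f g v : {in U, f =1 g} -> {in U, 'D_v f =1 'D_v g}.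
Proof. by move=> fg p /set_mem Up; apply/near_eq_derive/near_eq_on. Qed.

Lemma eq_continuous_on f g p : {in U, f =1 g} -> U p ->
  {for p, continuous f} -> {for p, continuous g}.
Proof.
move=> fg Up cf; suff : g x @[x --> p] --> g p by [].
rewrite -(fg p (mem_set Up)); apply: (cvg_trans _ cf).
by apply: near_eq_cvg; exact: near_eq_on.
Qed.

Lemma eq_Ck_on k f g : {in U, f =1 g} -> Ck_on k f -> Ck_on k g.
Proof.
elim: k f g => [|k IH] f g fg [cf df]; split.
- by move=> p Up; exact: eq_continuous_on (cf p Up).
- by [].
- by move=> p Up; exact: eq_continuous_on (cf p Up).
- case: df => [df Df]; split=> [d p Up|d].
    exact: (near_eq_derivable (near_eq_on fg Up) (df d p Up)).
  exact: (IH _ _ (eq_derive_on _ fg) (Df d)).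
Qed.

Lemma eq_smooth_on f g : {in U, f =1 g} -> smooth_on f -> smooth_on g.
Proof. by move=> fg sf k; exact: eq_Ck_on fg (sf k). Qed.

Lemma Ck_onW k f : Ck_on k.+1 f -> Ck_on k f.
Proof.
elim: k f => [|k IH] f [cf [df Df]]; first by split.
by split=> //; split=> // d; exact: IH.
Qed.

Lemma Ck_on_cst k (c : R) : Ck_on k (cst c).
Proof.
elim: k c => [|k IH] c; split=> //; try by move=> p _; exact: cst_continuous.
split=> [d p _|d]; first exact: derivable_cst.
by apply: eq_Ck_on (IH 0) => p _; rewrite derive_cst.
Qed.

Lemma Ck_onD k f g : Ck_on k f -> Ck_on k g -> Ck_on k (f \+ g).
Proof.
elim: k f g => [|k IH] f g [cf df] [cg dg]; split=> //.
- by move=> p Up; apply: continuousD; [exact: cf|exact: cg].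
- by move=> p Up; apply: continuousD; [exact: cf|exact: cg].
- case: df dg => [df Df] [dg Dg]; split=> [d p Up|d].
    by apply: derivableD; [exact: df|exact: dg].
  apply: (eq_Ck_on _ (IH _ _ (Df d) (Dg d))) => p /set_mem Up.
  by rewrite [RHS]deriveD//; [exact: df|exact: dg].
Qed.

Lemma Ck_onN k f : Ck_on k f -> Ck_on k (\- f).
Proof.
elim: k f => [|k IH] f [cf df]; split=> //.
- by move=> p Up; apply: continuousN; exact: cf.
- by move=> p Up; apply: continuousN; exact: cf.
- case: df => [df Df]; split=> [d p Up|d]; first by apply: derivableN; exact: df.
  apply: (eq_Ck_on _ (IH _ (Df d))) => p /set_mem Up.
  by rewrite [RHS]deriveN//; exact: df.
Qed.

Lemma Ck_onM k f g : Ck_on k f -> Ck_on k g -> Ck_on k (f \* g).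
Proof.
elim: k f g => [|k IH] f g F G; move: (F) (G) => [cf df] [cg dg]; split=> //.
- by move=> p Up; apply: continuousM; [exact: cf|exact: cg].
- by move=> p Up; apply: continuousM; [exact: cf|exact: cg].
- case: df dg => [df Df] [dg Dg]; split=> [d p Up|d].
    by apply: derivableM; [exact: df|exact: dg].
  apply: (@eq_Ck_on _ ((f \* 'D_(dir d) g) \+ (g \* 'D_(dir d) f))).
    by move=> p /set_mem Up; rewrite [RHS]deriveM//; [exact: df|exact: dg].
  apply: Ck_onD; first exact: IH (Ck_onW F) (Dg d).
  exact: IH (Ck_onW G) (Df d).
Qed.

(* g is a power of f: both 1/f (c = -1, m = 2) and 1/sqrt f (c = -1/2, m = 3)
   satisfy such an equation. *)
Lemma smooth_on_pow (c : R) m f g :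
  (forall p, U p -> {for p, continuous g}) ->
  (forall d p, U p -> is_derive p (dir d) g (c * 'D_(dir d) f p * g p ^+ m)) ->
  smooth_on f -> smooth_on g.
Proof.
move=> cg dg sf; elim=> [|k IH]; first by split.
split=> //; split=> [d p Up|d]; first by have [] := dg d p Up.
(* The equation expresses the derivative of [g] through [f] and [g] itself, so each round gains one
   order of smoothness. *)
apply: (@eq_Ck_on _ ((cst c \* 'D_(dir d) f) \* (fun p => g p ^+ m))).
  by move=> p /set_mem Up /=; have [_ ->] := dg d p Up.
apply: Ck_onM.
  by apply: Ck_onM; [exact: Ck_on_cst|exact: (sf k.+1).2.2].
elim: m {dg} => [|m IHm]; first by apply: eq_Ck_on (Ck_on_cst _ 1).
apply: eq_Ck_on (Ck_onM IH IHm) => p _ /=; by rewrite exprS.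
Qed.

End smooth_on.

(** * Symmetry of mixed derivatives and the chain rule along lines *)

Section symmetry_of_derivatives.
Context {R : realType} {V : normedModType R}.
Implicit Types (f : V -> R) (v w p : V).

Lemma is_derive_line f p v (s : R) : derivable f (p + s *: v) v ->
  is_derive s 1 (fun x : R => f (p + x *: v)) ('D_v f (p + s *: v)).
Proof.
have E : (fun h : R => h^-1 *: (((fun x : R => f (p + x *: v)) \o shift s)
      (h *: 1) - f (p + s *: v))) =
    (fun h : R => h^-1 *: ((f \o shift (p + s *: v)) (h *: v)
      - f (p + s *: v))).
  apply/funext => h /=; congr (_ *: (f _ - _)).
  by rewrite [_ *: 1]mulr1 scalerDl addrCA.
by move=> df; apply: DeriveDef; rewrite /derivable /derive E.
Qed.

Lemma MVT_line f p v (h : R) : 0 < h ->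
  (forall s, s \in `[0, h] -> derivable f (p + s *: v) v) ->
  exists2 s, s \in `[0, h] & f (p + h *: v) - f p = 'D_v f (p + s *: v) * h.
Proof.
move=> h0 df.
have dl s : s \in `[0, h] ->
    is_derive s 1 (fun x : R => f (p + x *: v)) ('D_v f (p + s *: v)).
  by move=> /df /is_derive_line.
have cl : {within `[0, h], continuous (fun x : R => f (p + x *: v))}.
  by apply: derivable_within_continuous => x /dl[].
have dl' (x : R) : x \in `]0, h[ ->
    is_derive x 1 (fun x : R => f (p + x *: v)) ('D_v f (p + x *: v)).
  by move=> xh; apply: dl; exact: subset_itv_oo_cc.
have [s sh] := @MVT_segment R (fun x : R => f (p + x *: v))
    (fun x : R => 'D_v f (p + x *: v)) 0 h (ltW h0) dl' cl.
by rewrite subr0 scale0r addr0 => E; exists s.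
Qed.

(** The mean value theorem is used twice: along [v] for the increment of [f] by [h *: w], then along
    [w] for ['D_v f]. *)
Lemma MVT_square f p v w (h : R) : 0 < h ->
  (forall s t, s \in `[0, h] -> t \in `[0, h] ->
    derivable f (p + s *: v + t *: w) v /\
    derivable ('D_v f) (p + s *: v + t *: w) w) ->
  exists s t, [/\ s \in `[0, h], t \in `[0, h] &
    f (p + h *: v + h *: w) - f (p + h *: v) - (f (p + h *: w) - f p)
    = 'D_w ('D_v f) (p + s *: v + t *: w) * h * h].
Proof.
move=> h0 df.
have i0 : (0 : R) \in `[0, h] by rewrite in_itv/= lexx ltW.
have ih : h \in `[0, h] by rewrite in_itv/= lexx ltW.
pose g q := f (q + h *: w) - f q.
have dgs s : s \in `[0, h] ->
    is_derive (p + s *: v) v g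
      ('D_v f (p + s *: v + h *: w) - 'D_v f (p + s *: v)).
  move=> sh; have [d1 _] := df s h sh ih; have [d0 _] := df s 0 sh i0.
  rewrite scale0r addr0 in d0.
  have E : is_derive (p + s *: v) v (f \o shift (h *: w))
      ('D_v f (p + s *: v + h *: w)).
    have H : (fun k : R => k^-1 *: (((f \o shift (h *: w)) \o
        shift (p + s *: v)) (k *: v) - (f \o shift (h *: w)) (p + s *: v))) =
      (fun k : R => k^-1 *: ((f \o shift (p + s *: v + h *: w)) (k *: v)
        - f (p + s *: v + h *: w))).
      by apply/funext => k /=; rewrite -!addrA.
    by apply: DeriveDef; [rewrite /derivable H; exact: d1|rewrite /derive H].
  by apply: is_deriveB E _; exact: derivableP.
have [s sh|s sh] := @MVT_line g p v h h0; first by have [] := dgs s sh.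
rewrite /g; have [_ ->] := dgs s sh => E.
have [t th|t th F] := @MVT_line ('D_v f) (p + s *: v) w h h0.
  by have [] := df s t sh th.
by exists s, t; split=> //; rewrite E F.
Qed.

(** Schwarz's theorem: [MVT_square] in the two orders writes one and the same second difference as a
    value of either mixed derivative in a small parallelogram, and both are continuous at [p]. *)
Lemma derive_swap f v w p :
  (\near p, [/\ derivable f p v, derivable f p w,
     derivable ('D_v f) p w & derivable ('D_w f) p v]) ->
  {for p, continuous ('D_w ('D_v f))} ->
  {for p, continuous ('D_v ('D_w f))} ->
  'D_w ('D_v f) p = 'D_v ('D_w f) p.
Proof.
move=> df cA cB; apply/eqP; rewrite -subr_eq0 -normr_le0.
apply/ler_addgt0Pr => e e0; rewrite add0r.
have e2 : 0 < e / 2 by rewrite divr_gt0.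
have /cvgrPdist_lt/(_ _ e2) nA := cA; have /cvgrPdist_lt/(_ _ e2) nB := cB.
have [d /= d0 H0] := (nbhs_ballP _ _).1 (filterI (filterI nA nB) df).
have H1 q : ball p d q -> `|'D_w ('D_v f) p - 'D_w ('D_v f) q| < e / 2.
  by case/H0 => -[h1 _] _; exact: h1.
have H2 q : ball p d q -> `|'D_v ('D_w f) p - 'D_v ('D_w f) q| < e / 2.
  by case/H0 => -[_ h2] _; exact: h2.
have H q : ball p d q -> [/\ derivable f q v, derivable f q w,
    derivable ('D_v f) q w & derivable ('D_w f) q v].
  by case/H0 => _ h3; exact: h3.
clear H0 df cA cB nA nB.
pose h := d / 2 / (`|v| + `|w| + 1).
have vw0 : 0 < `|v| + `|w| + 1 by rewrite ltr_wpDl// addr_ge0.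
have h0 : 0 < h by rewrite !divr_gt0.
have hb s t : s \in `[0, h] -> t \in `[0, h] ->
    ball p d (p + s *: v + t *: w).
  rewrite !in_itv/= => /andP[s0 sh] /andP[t0 th]; rewrite -ball_normE /ball_/=.
  rewrite -addrA opprD addrA subrr sub0r normrN (le_lt_trans (ler_normD _ _))//.
  rewrite !normrZ !ger0_norm// (@le_lt_trans _ _ (h * (`|v| + `|w| + 1)))//.
    by rewrite !mulrDr ler_wpDr ?mulr1 ?(ltW h0)// lerD// ler_wpM2r.
  by rewrite /h divfK ?gt_eqF// ltr_pdivrMr// ltr_pMr// ltr1n.
have [|s [t [sh th Est]]] := @MVT_square f p v w h h0.
  by move=> s t sh th; have [dv _ dvw _] := H _ (hb s t sh th); exact: conj dv dvw.
have [|s' [t' [sh' th' Est']]] := @MVT_square f p w v h h0.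
  move=> s' t' sh' th'; rewrite addrAC.
  by have [_ dw _ dwv] := H _ (hb t' s' th' sh'); exact: conj dw dwv.
have {}Est' : f (p + h *: v + h *: w) - f (p + h *: w) - (f (p + h *: v) - f p) =
    'D_v ('D_w f) (p + t' *: v + s' *: w) * h * h.
  by rewrite (addrAC p (h *: v)) (addrAC p (t' *: v)).
have EE : 'D_w ('D_v f) (p + s *: v + t *: w) =
          'D_v ('D_w f) (p + t' *: v + s' *: w).
  have hn0 := lt0r_neq0 h0; apply: (mulIf hn0); apply: (mulIf hn0).
  have E4 (x y z r : R) : x - y - (z - r) = x - z - (y - r) by ring.
  exact: etrans (esym Est) (etrans (E4 _ _ _ _) Est').
have A1 := H1 _ (hb s t sh th); have B1 := H2 _ (hb t' s' th' sh').
move: A1 B1; rewrite EE.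
move: ('D_w _ p) ('D_v _ p) ('D_v _ _) => x y z xz yz.
clear -xz yz; rewrite (_ : x - y = (x - z) - (y - z)); last by ring.
by rewrite (le_trans (ler_normB _ _))// [leRHS]splitr lerD// ltW.
Qed.

End symmetry_of_derivatives.

Section directional.
Context {R : realType} {V : normedModType R}.
Implicit Types (f : V -> R) (v p : V).

(** Only a directional derivative of [f] is given, so the one-variable chain rule is applied to the
    restriction of [f] to the line through [p]. *)
Lemma is_derive_comp1 f (h : R -> R) p v df dh :
  is_derive p v f df -> is_derive (f p) 1 h dh ->
  is_derive p v (h \o f) (dh * df).
Proof.
move=> [Df <-] Dh.
have p0 : p + 0 *: v = p by rewrite scale0r addr0.
have := @is_derive_line R V f p v 0; rewrite p0 => /(_ Df) Dl.
have Dl' : is_derive (f (p + 0 *: v)) 1 h dh by rewrite p0.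
have [H1 H2] := is_derive1_comp Dl' Dl.
have E : (fun k : R => k^-1 *: (((h \o f) \o shift p) (k *: v) - (h \o f) p)) =
    (fun k : R => k^-1 *: (((h \o (fun x : R => f (p + x *: v))) \o shift 0)
      (k *: 1) - (h \o (fun x : R => f (p + x *: v))) 0)).
  apply/funext => k /=; rewrite p0 addr0 [_ *: 1]mulr1; congr (_ *: (h (f _) - _)).
  exact: addrC.
apply: DeriveDef; rewrite ?/derivable ?/derive E; first exact: H1.
exact: H2.
Qed.

Lemma is_derive_linear_along f p v (l : R) :
  (forall h : R, f (h *: v + p) = h * l + f p) -> is_derive p v f l.
Proof.
move=> fl.
have H : (fun h : R => h^-1 *: ((f \o shift p) (h *: v) - f p)) @ 0^' --> l.
  apply: (@cvg_trans _ ((fun=> l) @ (0:R)^')); last exact: cvg_cst.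
  apply: near_eq_cvg; near=> h => /=; rewrite fl addrK.
  rewrite [RHS]mulrA mulVf ?mul1r//; near: h; exact: nbhs_dnbhs_neq.
by apply: DeriveDef; [apply/cvg_ex; exists l|exact/cvg_lim].
Unshelve. all: by end_near. Qed.

End directional.

(** * The commutative ring of functions smooth off the axis *)

Section off_axis.
Context {R : realType} {n : nat}.
Local Notation pt := ('rV[R]_n * R)%type.
Implicit Types (p : pt) (f : pt -> R).

Definition dir (d : option 'I_n) : pt :=
  if d is Some i then (delta_mx 0 i, 0) else (0, 1).

Definition off_axis : set pt := [set p | p.1 != 0].

Lemma continuous_xcoord i : continuous (fun p : pt => p.1 0 i).
Proof.
move=> p; apply: (@continuous_comp _ _ _ fst (fun M : 'rV[R]_n => M 0 i)).
  exact: cvg_fst.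
exact: coord_continuous.
Qed.

Lemma open_off_axis : open off_axis.
Proof.
rewrite (_ : off_axis = \bigcup_(i in [set: 'I_n]) [set p : pt | p.1 0 i != 0]).
  apply: bigcup_open => i _.
  apply: (@open_comp _ _ (fun p : pt => p.1 0 i) [set x | x != 0]) => //.
  by move=> p _; exact: continuous_xcoord.
apply/seteqP; split => p /=.
  by move/rV0Pn => [i pi]; exists i.
by move=> [i _ pi]; apply/rV0Pn; exists i.
Qed.

Definition cut f p : R := if p.1 == 0 then 0 else f p.

Lemma cutE f : {in off_axis, cut f =1 f}.
Proof. by move=> p /set_mem pU; rewrite /cut ifN. Qed.

Lemma cut_axis f p : p.1 = 0 -> cut f p = 0.
Proof. by rewrite /cut => ->; rewrite eqxx. Qed.

Local Notation smooth_off := (smooth_on dir off_axis).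

(* Functions that are smooth off the axis [x = 0], normalized to vanish on it
   so that identities holding off the axis become equalities. *)
Record offun := MkOffun {
  offun_fun :> pt -> R;
  offun_smooth : smooth_off offun_fun;
  offun_axis : forall p, p.1 = 0 -> offun_fun p = 0 }.

Lemma offun_ext (f g : offun) : (forall p, p.1 != 0 -> f p = g p) -> f = g.
Proof.
move=> fg; have {fg} : f = g :> (pt -> R).
  apply/funext => p; have [p0|/fg//] := eqVneq p.1 0.
  by rewrite !offun_axis.
case: f g => [f sf f0] [g sg g0] /= E; subst g.
by congr MkOffun; exact: Prop_irrelevance.
Qed.

HB.instance Definition _ := gen_eqMixin offun.
HB.instance Definition _ := gen_choiceMixin offun.

Lemma smooth_cut f : smooth_off f -> smooth_off (cut f).
Proof.
by apply: eq_smooth_on; [exact: open_off_axis|move=> p pU; rewrite cutE].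
Qed.

Definition restr f (sf : smooth_off f) : offun :=
  MkOffun (smooth_cut sf) (@cut_axis f).

Arguments restr : simpl never.

Lemma restrE f (sf : smooth_off f) p : p.1 != 0 -> restr sf p = f p.
Proof. by move=> p0; rewrite /= /cut ifN. Qed.

Lemma smooth_off_cst c : smooth_off (cst c).
Proof. by move=> k; apply: Ck_on_cst; exact: open_off_axis. Qed.

Definition kst c := restr (smooth_off_cst c).

Lemma offun_add_smooth (f g : offun) : smooth_off (f \+ g).
Proof.
move=> k; apply: Ck_onD; [exact: open_off_axis|exact: offun_smooth|].
exact: offun_smooth.
Qed.
Lemma offun_opp_smooth (f : offun) : smooth_off (\- f).
Proof. by move=> k; apply: Ck_onN; [exact: open_off_axis|exact: offun_smooth]. Qed.
Lemma offun_mul_smooth (f g : offun) : smooth_off (f \* g).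
Proof.
move=> k; apply: Ck_onM; [exact: open_off_axis|exact: offun_smooth|].
exact: offun_smooth.
Qed.

(* The operations below are hidden behind opaque constants: unification would
   otherwise unfold nested expressions down to derivatives. *)
Fact offun_add_key : { add : offun -> offun -> offun |
  forall f g : offun, add f g = restr (@offun_add_smooth f g) }.
Proof. by eexists. Qed.
Fact offun_opp_key : { opp : offun -> offun |
  forall f : offun, opp f = restr (@offun_opp_smooth f) }.
Proof. by eexists. Qed.
Fact offun_mul_key : { mul : offun -> offun -> offun |
  forall f g : offun, mul f g = restr (@offun_mul_smooth f g) }.
Proof. by eexists. Qed.

Definition offun_add := sval offun_add_key.
Definition offun_opp := sval offun_opp_key.
Definition offun_mul := sval offun_mul_key.

Let addE (f g : offun) p : p.1 != 0 -> offun_add f g p = f p + g p.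
Proof. by rewrite [offun_add f g](svalP offun_add_key); exact: restrE. Qed.
Let oppE (f : offun) p : p.1 != 0 -> offun_opp f p = - f p.
Proof. by rewrite [offun_opp f](svalP offun_opp_key); exact: restrE. Qed.
Let mulE (f g : offun) p : p.1 != 0 -> offun_mul f g p = f p * g p.
Proof. by rewrite [offun_mul f g](svalP offun_mul_key); exact: restrE. Qed.
Let kE c p : p.1 != 0 -> kst c p = c.
Proof. exact: restrE. Qed.

Fact offun_addA : associative offun_add.
Proof. by move=> f g h; apply: offun_ext => p ?; rewrite !addE// addrA. Qed.
Fact offun_addC : commutative offun_add.
Proof. by move=> f g; apply: offun_ext => p ?; rewrite !addE// addrC. Qed.
Fact offun_add0 : left_id (kst 0) offun_add.
Proof. by move=> f; apply: offun_ext => p ?; rewrite addE// kE// add0r. Qed.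
Fact offun_addN : left_inverse (kst 0) offun_opp offun_add.
Proof. by move=> f; apply: offun_ext => p ?; rewrite addE// oppE// kE// addNr. Qed.

HB.instance Definition _ := GRing.isZmodule.Build offun
  offun_addA offun_addC offun_add0 offun_addN.

Fact offun_mulA : associative offun_mul.
Proof. by move=> f g h; apply: offun_ext => p ?; rewrite !mulE// mulrA. Qed.
Fact offun_mulC : commutative offun_mul.
Proof. by move=> f g; apply: offun_ext => p ?; rewrite !mulE// mulrC. Qed.
Fact offun_mul1 : left_id (kst 1) offun_mul.
Proof. by move=> f; apply: offun_ext => p ?; rewrite mulE// kE// mul1r. Qed.
Fact offun_mulD : left_distributive offun_mul +%R.
Proof.
by move=> f g h; apply: offun_ext => p ?; rewrite addE// !mulE// addE// mulrDl.
Qed.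

HB.instance Definition _ := GRing.Zmodule_isComPzRing.Build offun
  offun_mulA offun_mulC offun_mul1 offun_mulD.

Lemma offunD (f g : offun) p : (f + g) p = f p + g p.
Proof.
have [p0|p0] := eqVneq p.1 0; last exact: addE.
by rewrite !offun_axis// addr0.
Qed.
Lemma offunN (f : offun) p : (- f) p = - f p.
Proof.
have [p0|p0] := eqVneq p.1 0; last exact: oppE.
by rewrite !offun_axis// oppr0.
Qed.
Lemma offunM (f g : offun) p : (f * g) p = f p * g p.
Proof.
have [p0|p0] := eqVneq p.1 0; last exact: mulE.
by rewrite !offun_axis// mulr0.
Qed.
Lemma offun0 p : (0 : offun) p = 0.
Proof. by have [p0|p0] := eqVneq p.1 0; [rewrite offun_axis|rewrite restrE]. Qed.
Lemma kstE c p : p.1 != 0 -> kst c p = c.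
Proof. by move=> p0; rewrite restrE. Qed.
Lemma offun1 p : p.1 != 0 -> (1 : offun) p = 1.
Proof. exact: kstE. Qed.
Lemma offunX (f : offun) k p : p.1 != 0 -> (f ^+ k) p = f p ^+ k.
Proof.
by move=> p0; elim: k => [|k IH]; rewrite ?offun1// !exprS offunM IH.
Qed.
Lemma offun_sum I r (P : pred I) (F : I -> offun) p :
  (\sum_(i <- r | P i) F i) p = \sum_(i <- r | P i) F i p.
Proof. by apply: (big_morph (fun f : offun => f p)) => [f g|]; rewrite ?offunD ?offun0. Qed.

Lemma kstD a b : kst (a + b) = kst a + kst b.
Proof. by apply: offun_ext => p p0; rewrite offunD !kstE. Qed.
Lemma kstM a b : kst (a * b) = kst a * kst b.
Proof. by apply: offun_ext => p p0; rewrite offunM !kstE. Qed.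
Lemma kstN a : kst (- a) = - kst a.
Proof. by apply: offun_ext => p p0; rewrite offunN !kstE. Qed.
Lemma kst1 : kst 1 = 1. Proof. by []. Qed.
Lemma kst0 : kst 0 = 0. Proof. by []. Qed.
Lemma kst_nat k : kst k%:R = k%:R.
Proof. by elim: k => [|k IH]//; rewrite -addn1 !natrD kstD IH. Qed.

Lemma offun_nat k p : p.1 != 0 -> (k%:R : offun) p = k%:R.
Proof. by move=> p0; rewrite -kst_nat kstE. Qed.

Implicit Types (u v w : offun) (d e : option 'I_n).

Lemma partial_smooth d u : smooth_off ('D_(dir d) u).
Proof. by move=> k; exact: (offun_smooth u k.+1).2.2. Qed.

Fact partial_key : { P : option 'I_n -> offun -> offun |
  forall d u, P d u = restr (@partial_smooth d u) }.
Proof. by eexists. Qed.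

Definition partial := sval partial_key.

Lemma partialE d u p : p.1 != 0 -> partial d u p = 'D_(dir d) u p.
Proof. by rewrite [partial d u](svalP partial_key); exact: restrE. Qed.

Lemma offun_derivable u d p : p.1 != 0 -> derivable u p (dir d).
Proof. exact: (offun_smooth u 1).2.1. Qed.

Lemma offun_is_derive u d p : p.1 != 0 -> is_derive p (dir d) u (partial d u p).
Proof. by move=> p0; rewrite partialE//; exact/derivableP/offun_derivable. Qed.

Lemma offun_continuous u p : p.1 != 0 -> {for p, continuous u}.
Proof. exact: (offun_smooth u 0).1. Qed.

Lemma partial_eq d u f p : (forall q, q.1 != 0 -> u q = f q) -> p.1 != 0 ->
  partial d u p = 'D_(dir d) f p.
Proof.
move=> uf p0; rewrite partialE//.
apply: (eq_derive_on open_off_axis); last exact/mem_set.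
by move=> q /set_mem/uf.
Qed.

Lemma partial_restr d f (sf : smooth_off f) p : p.1 != 0 ->
  partial d (restr sf) p = 'D_(dir d) f p.
Proof. by apply: partial_eq => q; exact: restrE. Qed.

Lemma partial_kst d c : partial d (kst c) = 0.
Proof. by apply: offun_ext => p p0; rewrite partial_restr// derive_cst offun0. Qed.

Lemma partialD d u v : partial d (u + v) = partial d u + partial d v.
Proof.
apply: offun_ext => p p0; rewrite offunD (@partial_eq _ _ (u \+ v))//.
  by rewrite !partialE//; apply: deriveD; exact: offun_derivable.
by move=> q q0; rewrite offunD.
Qed.

Lemma partialM d u v : partial d (u * v) = partial d u * v + u * partial d v.
Proof.
apply: offun_ext => p p0; rewrite offunD !offunM (@partial_eq _ _ (u \* v))//.
  rewrite !partialE// addrC [X in _ = _ + X]mulrC.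
  by apply: deriveM; exact: offun_derivable.
by move=> q q0; rewrite offunM.
Qed.

Lemma partialC d e u : partial d (partial e u) = partial e (partial d u).
Proof.
apply: offun_ext => p p0.
rewrite (partial_eq d (f := 'D_(dir e) u) _ p0); last first.
  by move=> q; exact: partialE.
rewrite (partial_eq e (f := 'D_(dir d) u) _ p0); last first.
  by move=> q; exact: partialE.
have sm k := offun_smooth u k.
have s1 q := (sm 1%N).2.1 ^~ q.
have s2 d' q := ((sm 2).2.2 d').2.1 ^~ q.
apply: derive_swap.
- apply: filterS (open_nbhs_nbhs (conj open_off_axis p0)) => q qU.
  by split; [exact: s1|exact: s1|exact: s2|exact: s2].
- exact: (((sm 2).2.2 e).2.2 d).1.
- exact: (((sm 2).2.2 d).2.2 e).1.
Qed.

End off_axis.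

(** * Derivations of this ring, coordinates and inverse square roots *)

Section derivation.
Context {R : realType} {n : nat}.
Local Notation offun := (@offun R n).
Implicit Types (u v f : offun) (D E : offun -> offun).

Definition derivation D := [/\ forall u v, D (u + v) = D u + D v,
  forall u v, D (u * v) = D u * v + u * D v & forall c, D (kst c) = 0].

Section theory.
Variables (D : offun -> offun) (dD : derivation D).

Lemma derD u v : D (u + v) = D u + D v. Proof. by case: dD. Qed.
Lemma derM u v : D (u * v) = D u * v + u * D v. Proof. by case: dD. Qed.
Lemma der_kst c : D (kst c) = 0. Proof. by case: dD. Qed.
Lemma der0 : D 0 = 0. Proof. by rewrite -kst0 der_kst. Qed.
Lemma der1 : D 1 = 0. Proof. by rewrite -kst1 der_kst. Qed.
Lemma der_nat k : D k%:R = 0. Proof. by rewrite -kst_nat der_kst. Qed.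
Lemma derN u : D (- u) = - D u.
Proof. by apply/eqP; rewrite -addr_eq0 -derD addNr der0. Qed.
Lemma der_sum I r (P : pred I) (F : I -> offun) :
  D (\sum_(i <- r | P i) F i) = \sum_(i <- r | P i) D (F i).
Proof. by apply: (big_morph D); [exact: derD|exact: der0]. Qed.
Lemma derX2 u : D (u ^+ 2) = 2 * u * D u.
Proof. by rewrite expr2 derM; ring. Qed.
Lemma derX3 u : D (u ^+ 3) = 3 * u ^+ 2 * D u.
Proof. by rewrite exprS derM derX2; ring. Qed.
End theory.

Lemma eq_derivation D E : (forall u, E u = D u) -> derivation D -> derivation E.
Proof. by move=> /funext ->. Qed.

Lemma derivation_partial d : derivation (@partial R n d).
Proof. by split; [exact: partialD|exact: partialM|exact: partial_kst]. Qed.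

Lemma derivation_add D E : derivation D -> derivation E ->
  derivation (fun u => D u + E u).
Proof.
move=> [dD dM dk] [eD eM ek]; split=> [u v|u v|c].
- by rewrite dD eD; ring.
- by rewrite dM eM; ring.
- by rewrite dk ek addr0.
Qed.

Lemma derivation_scale f D : derivation D -> derivation (fun u => f * D u).
Proof.
move=> [dD dM dk]; split=> [u v|u v|c].
- by rewrite dD; ring.
- by rewrite dM; ring.
- by rewrite dk mulr0.
Qed.

Lemma derivation_sum (I : finType) (D : I -> offun -> offun) :
  (forall i, derivation (D i)) -> derivation (fun u => \sum_i D i u).
Proof.
move=> dD; split=> [u v|u v|c].
- by rewrite -big_split; apply: eq_bigr => i _; rewrite derD.
- rewrite mulr_suml mulr_sumr -big_split; apply: eq_bigr => i _.
  by rewrite derM.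
- by rewrite big1// => i _; rewrite der_kst.
Qed.

End derivation.

Section coordinates.
Context {R : realType} {n : nat}.
Local Notation pt := ('rV[R]_n * R)%type.
Local Notation offun := (@offun R n).
Local Notation dir := (@dir R n).
Local Notation off_axis := (@off_axis R n).
Implicit Types (u v f : offun) (p : pt).

Lemma smooth_on_linear (f : pt -> R) (l : option 'I_n -> R) : continuous f ->
  (forall d p (h : R), f (h *: dir d + p) = h * l d + f p) ->
  smooth_on dir off_axis f.
Proof.
move=> cf fl [|k]; first by split=> // p _; exact: cf.
have D d p := is_derive_linear_along (fl d p).
split; [by move=> p _; exact: cf|split=> [d p _|d]; first by case: (D d p)].
apply: (@eq_Ck_on _ _ _ _ _ open_off_axis _ (cst (l d))).
  by move=> p _; case: (D d p) => _ ->.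
by apply: Ck_on_cst; exact: open_off_axis.
Qed.

Lemma xcoord_linear (i : 'I_n) d p (h : R) :
  (h *: dir d + p).1 0 i = h * (d == Some i)%:R + p.1 0 i.
Proof.
rewrite !mxE; case: d => [j|] /=; last by rewrite mxE.
rewrite mxE eqxx /=; congr (_ * _%:R + _).
by rewrite eq_sym.
Qed.

Lemma tcoord_linear d p (h : R) :
  (h *: dir d + p).2 = h * (d == None)%:R + p.2.
Proof. by case: d. Qed.

Lemma continuous_tcoord : continuous (fun p : pt => p.2).
Proof. by move=> p; exact: cvg_snd. Qed.

Definition xi i : offun :=
  restr (smooth_on_linear (@continuous_xcoord R n i) (xcoord_linear i)).

Definition tau : offun :=
  restr (smooth_on_linear continuous_tcoord tcoord_linear).

Lemma xiE i p : p.1 != 0 -> xi i p = p.1 0 i.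
Proof. exact: restrE. Qed.

Lemma tauE p : p.1 != 0 -> tau p = p.2.
Proof. exact: restrE. Qed.

Lemma partial_xi d i : partial d (xi i) = (d == Some i)%:R.
Proof.
apply: offun_ext => p p0; rewrite -kst_nat kstE// partial_restr//.
by have [_ ->] := @is_derive_linear_along R pt (fun p => p.1 0 i) p (dir d) _
  (xcoord_linear i d p).
Qed.

Lemma partial_tau d : partial d tau = (d == None)%:R.
Proof.
apply: offun_ext => p p0; rewrite -kst_nat kstE// partial_restr//.
by have [_ ->] := @is_derive_linear_along R pt (fun p => p.2) p (dir d) _ (tcoord_linear d p).
Qed.

Definition positive_off u := forall p, p.1 != 0 -> 0 < u p.

Lemma is_derive_invsqrt (x : R) : 0 < x ->
  is_derive x 1 (fun y => (Num.sqrt y)^-1) (- 2^-1 * (Num.sqrt x)^-1 ^+ 3).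
Proof.
move=> x0; have s0 : Num.sqrt x != 0 by rewrite gt_eqF// sqrtr_gt0.
apply: (is_derive_eq (is_deriveV s0 (is_derive1_sqrt x0))).
by rewrite [_ *: _]mulrC; field.
Qed.

Lemma smooth_invsqrt u : positive_off u ->
  smooth_on dir off_axis (fun p => (Num.sqrt (u p))^-1).
Proof.
move=> u0.
have D d p : off_axis p -> is_derive p (dir d)
    (fun p => (Num.sqrt (u p))^-1)
    (- 2^-1 * 'D_(dir d) u p * (Num.sqrt (u p))^-1 ^+ 3).
  move=> pU; have := is_derive_comp1 (offun_is_derive u d pU)
    (is_derive_invsqrt (u0 p pU)).
  by move/is_derive_eq; apply; rewrite partialE//; ring.
apply: (smooth_on_pow open_off_axis _ D (offun_smooth u)) => p pU.
apply: (@continuousV _ _ (fun p => Num.sqrt (u p))).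
  by rewrite gt_eqF// sqrtr_gt0 u0.
apply: continuous_comp; first exact: offun_continuous.
exact: sqrt_continuous.
Qed.

Definition invsqrt u (u0 : positive_off u) : offun := restr (smooth_invsqrt u0).

Lemma invsqrtE u (u0 : positive_off u) p : p.1 != 0 ->
  invsqrt u0 p = (Num.sqrt (u p))^-1.
Proof. exact: restrE. Qed.

Lemma invsqrt_gt0 u (u0 : positive_off u) : positive_off (invsqrt u0).
Proof. by move=> p p0; rewrite invsqrtE// invr_gt0 sqrtr_gt0 u0. Qed.

Lemma invsqrt_sq u (u0 : positive_off u) : invsqrt u0 ^+ 2 * u = 1.
Proof.
apply: offun_ext => p p0; rewrite offunM offunX// offun1// invsqrtE//.
by rewrite exprVn sqr_sqrtr ?ltW ?u0// mulVf// gt_eqF ?u0.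
Qed.

(** An abstract derivation is known only through its algebraic rules, so the formula comes from
    differentiating [invsqrt_sq]; division by 2 and by [u] is replaced by inserting factors equal to
    1. *)
Lemma invsqrt_der D u (u0 : positive_off u) : derivation D ->
  D (invsqrt u0) = - kst 2^-1 * D u * invsqrt u0 ^+ 3.
Proof.
move=> dD; have := congr1 D (invsqrt_sq u0).
rewrite derM// derX2// der1// => E.
have i0 := invsqrt_sq u0; have k2 : kst (2^-1) * 2 = 1 :> offun.
  by rewrite -(kst_nat 2) -kstM mulVf.
set i := invsqrt u0 in E i0 *.
have -> : D i = (kst 2^-1 * 2) * (i ^+ 2 * u) * D i by rewrite k2 i0; ring.
have -> : kst 2^-1 * 2 * (i ^+ 2 * u) * D i = kst 2^-1 * i * (2 * i * D i * u).
  by ring.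
have -> : 2 * i * D i * u = - (i ^+ 2 * D u).
  by apply/eqP; rewrite -addr_eq0 E.
by ring.
Qed.

End coordinates.

(** * Vector fields adapted to the gauge *)

Section operators.
Context {R : realType} {n : nat}.
Local Notation pt := ('rV[R]_n * R)%type.
Local Notation offun := (@offun R n).
Implicit Types (u v f : offun) (p : pt) (i j k : 'I_n).

Local Notation x := (@xi R n).
Local Notation t := (@tau R n).
Local Notation pd i := (@partial R n (Some i)).
Local Notation T := (@partial R n None).

Let dP d : derivation (@partial R n d). Proof. exact: derivation_partial. Qed.

Fact asq_key : { f : offun | f = \sum_i x i ^+ 2 }.
Proof. by eexists. Qed.
Definition asq := sval asq_key.
Lemma asq_def : asq = \sum_i x i ^+ 2. Proof. exact: (svalP asq_key). Qed.

Lemma asqE p : p.1 != 0 -> asq p = \sum_i p.1 0 i ^+ 2.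
Proof.
move=> p0; rewrite asq_def offun_sum; apply: eq_bigr => i _.
by rewrite offunX// xiE.
Qed.

Lemma asq_gt0 : positive_off asq.
Proof.
move=> p p0; rewrite asqE//; have /rV0Pn[i pi] := p0.
rewrite (bigD1 i)//= ltr_pwDl//; first by rewrite exprn_even_gt0.
by apply: sumr_ge0 => j _; exact: sqr_ge0.
Qed.

Fact quart_key : { f : offun | f = asq ^+ 2 + 4 * t ^+ 2 }.
Proof. by eexists. Qed.
Definition quart := sval quart_key.
Lemma quart_def : quart = asq ^+ 2 + 4 * t ^+ 2. Proof. exact: (svalP quart_key). Qed.

Lemma quartE p : p.1 != 0 -> quart p = asq p ^+ 2 + 4 * p.2 ^+ 2.
Proof.
move=> p0; rewrite quart_def offunD offunM !offunX// tauE//.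
by rewrite -(kst_nat 4) kstE.
Qed.

Lemma quart_gt0 : positive_off quart.
Proof.
move=> p p0; rewrite quartE// ltr_pwDl//; first by rewrite exprn_gt0// asq_gt0.
by rewrite mulr_ge0// sqr_ge0.
Qed.

Lemma quart_asq_gt0 : positive_off (quart + asq ^+ 2).
Proof.
by move=> p p0; rewrite offunD offunX// addr_gt0 ?quart_gt0// exprn_gt0// asq_gt0.
Qed.

(* [r = |x|], [rinv = 1 / |x|], [sginv = rho^-2] and [hh = 1 / (rho^4 + |x|^4)]. *)
Fact rinv_key : { f : offun | f = invsqrt asq_gt0 }.
Proof. by eexists. Qed.
Definition rinv := sval rinv_key.
Lemma rinv_def : rinv = invsqrt asq_gt0. Proof. exact: (svalP rinv_key). Qed.
Fact sginv_key : { f : offun | f = invsqrt quart_gt0 }.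
Proof. by eexists. Qed.
Definition sginv := sval sginv_key.
Lemma sginv_def : sginv = invsqrt quart_gt0. Proof. exact: (svalP sginv_key). Qed.
Fact r_key : { f : offun | f = asq * rinv }.
Proof. by eexists. Qed.
Definition r := sval r_key.
Lemma r_def : r = asq * rinv. Proof. exact: (svalP r_key). Qed.
Fact hh_key : { f : offun | f = invsqrt quart_asq_gt0 ^+ 2 }.
Proof. by eexists. Qed.
Definition hh := sval hh_key.
Lemma hh_def : hh = invsqrt quart_asq_gt0 ^+ 2. Proof. exact: (svalP hh_key). Qed.
Fact om_key : { f : 'I_n -> offun | forall i, f i = x i * rinv }.
Proof. by eexists. Qed.
Definition om := sval om_key.
Lemma om_def i : om i = x i * rinv. Proof. exact: (svalP om_key). Qed.

Lemma rinv_asq : rinv ^+ 2 * asq = 1.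
Proof. by rewrite rinv_def invsqrt_sq. Qed.
Lemma sginv_quart : sginv ^+ 2 * quart = 1.
Proof. by rewrite sginv_def invsqrt_sq. Qed.
Lemma r_rinv : r * rinv = 1.
Proof. by rewrite -rinv_asq r_def; ring. Qed.
Lemma r2 : r ^+ 2 = asq.
Proof. by rewrite -[RHS]mul1r -rinv_asq r_def; ring. Qed.
Lemma hhE : hh * (quart + asq ^+ 2) = 1.
Proof. by rewrite hh_def invsqrt_sq. Qed.

(* [dil] is rho times the radial derivative, [del i] the i-th component of the
   gradient along the sphere of directions x / |x|, and [rot] the derivative
   along the rotations of the plane of the pairs (|x|^2, 2t), so that [del i] and
   [rot] are tangent to the gauge spheres. *)
Fact rad_key : { f : offun -> offun | forall u, f u = \sum_i x i * pd i u }.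
Proof. by eexists. Qed.
Definition rad := sval rad_key.
Lemma rad_def u : rad u = \sum_i x i * pd i u. Proof. exact: (svalP rad_key). Qed.
Fact del_key : { f : 'I_n -> offun -> offun | forall i u, f i u = r * pd i u - om i * rad u }.
Proof. by eexists. Qed.
Definition del := sval del_key.
Lemma del_def i u : del i u = r * pd i u - om i * rad u. Proof. exact: (svalP del_key). Qed.
Fact dil_key : { f : offun -> offun | forall u, f u = rad u + 2 * t * T u }.
Proof. by eexists. Qed.
Definition dil := sval dil_key.
Lemma dil_def u : dil u = rad u + 2 * t * T u. Proof. exact: (svalP dil_key). Qed.
Fact rot_key : { f : offun -> offun | forall u, f u = 2 * t * rinv ^+ 2 * rad u - asq * T u }.
Proof. by eexists. Qed.
Definition rot := sval rot_key.
Lemma rot_def u : rot u = 2 * t * rinv ^+ 2 * rad u - asq * T u.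
Proof. exact: (svalP rot_key). Qed.

Lemma derivation_rad : derivation rad.
Proof.
apply: eq_derivation rad_def _.
by apply: derivation_sum => i; exact: derivation_scale (dP _).
Qed.

Lemma derivation_del i : derivation (del i).
Proof.
apply: (@eq_derivation _ _ (fun u => r * pd i u + - om i * rad u)) => [u|].
  by rewrite del_def mulNr.
apply: derivation_add; first exact: derivation_scale (dP _).
exact: derivation_scale derivation_rad.
Qed.

Lemma derivation_dil : derivation dil.
Proof.
apply: eq_derivation dil_def _.
exact: derivation_add derivation_rad (derivation_scale _ (dP _)).
Qed.

Lemma derivation_rot : derivation rot.
Proof.
apply: (@eq_derivation _ _ (fun u => 2 * t * rinv ^+ 2 * rad u + - asq * T u)).
  by move=> u; rewrite rot_def mulNr.
apply: derivation_add; first exact: derivation_scale derivation_rad.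
exact: derivation_scale (dP _).
Qed.

Let dR := derivation_rad.
Let ddel := derivation_del.
Let dD := derivation_dil.
Let dB := derivation_rot.

Lemma sum_delta (F : 'I_n -> offun) i : \sum_j (i == j)%:R * F j = F i.
Proof.
rewrite (bigD1 i)//= eqxx mul1r big1 ?addr0// => j ji.
by rewrite eq_sym (negbTE ji) mul0r.
Qed.

Lemma sum_om2 : \sum_i om i ^+ 2 = 1.
Proof.
rewrite -rinv_asq asq_def mulr_sumr; apply: eq_bigr => i _.
by rewrite !om_def; ring.
Qed.

Lemma sum_om_pd u : \sum_i om i * pd i u = rinv * rad u.
Proof.
by rewrite !rad_def mulr_sumr; apply: eq_bigr => i _; rewrite !om_def; ring.
Qed.

Lemma sum_om_del u : \sum_i om i * del i u = 0.
Proof.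
rewrite (eq_bigr (fun i => r * (om i * pd i u) - rad u * om i ^+ 2)); last first.
  by move=> i _; rewrite !del_def; ring.
rewrite sumrB -!mulr_sumr sum_om_pd sum_om2 mulrA r_rinv; ring.
Qed.

Lemma pd_xi i j : pd i (x j) = (i == j)%:R.
Proof. exact: partial_xi. Qed.
Lemma pd_tau i : pd i t = 0. Proof. exact: partial_tau. Qed.
Lemma T_xi i : T (x i) = 0. Proof. exact: partial_xi. Qed.
Lemma T_tau : T t = 1. Proof. exact: partial_tau. Qed.

Lemma pd_asq i : pd i asq = 2 * x i.
Proof.
rewrite asq_def (der_sum (dP _)) -[RHS](sum_delta (fun j => 2 * x j)).
by apply: eq_bigr => j _; rewrite (derX2 (dP _)) pd_xi; ring.
Qed.
Lemma T_asq : T asq = 0.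
Proof.
rewrite asq_def (der_sum (dP _)) big1// => j _.
by rewrite (derX2 (dP _)) T_xi mulr0.
Qed.
Lemma rad_xi i : rad (x i) = x i.
Proof.
rewrite !rad_def -[RHS](sum_delta x); apply: eq_bigr => j _.
by rewrite pd_xi eq_sym mulrC.
Qed.
Lemma rad_tau : rad t = 0.
Proof. by rewrite !rad_def big1// => i _; rewrite pd_tau mulr0. Qed.
Lemma rad_asq : rad asq = 2 * asq.
Proof.
rewrite !rad_def [in RHS]asq_def mulr_sumr; apply: eq_bigr => i _.
by rewrite pd_asq; ring.
Qed.

Lemma half2 : kst 2^-1 * 2 = 1 :> offun.
Proof. by rewrite -(kst_nat 2) -kstM mulVf. Qed.

Lemma der_rinv D : derivation D -> D rinv = - kst 2^-1 * D asq * rinv ^+ 3.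
Proof. by rewrite rinv_def; exact: invsqrt_der. Qed.
Lemma der_sginv D : derivation D -> D sginv = - kst 2^-1 * D quart * sginv ^+ 3.
Proof. by rewrite sginv_def; exact: invsqrt_der. Qed.
Lemma der_hh D : derivation D -> D hh = - hh ^+ 2 * D (quart + asq ^+ 2).
Proof.
move=> dD'; have E := congr1 D hhE.
rewrite (derM dD') (der1 dD') in E.
have -> : D hh = hh * (D hh * (quart + asq ^+ 2)).
  by rewrite -[LHS]mul1r -hhE; ring.
by move/eqP: E; rewrite addr_eq0 => /eqP ->; ring.
Qed.

Lemma rad_rinv : rad rinv = - rinv.
Proof.
rewrite der_rinv// rad_asq.
rewrite (_ : _ * _ = - ((kst 2^-1 * 2) * (rinv ^+ 2 * asq) * rinv)); last by ring.
by rewrite half2 rinv_asq; ring.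
Qed.
Lemma T_rinv : T rinv = 0.
Proof. by rewrite der_rinv// T_asq; ring. Qed.
Lemma pd_rinv i : pd i rinv = - x i * rinv ^+ 3.
Proof.
rewrite der_rinv// pd_asq (_ : _ * _ = - ((kst 2^-1 * 2) * x i * rinv ^+ 3)).
  by rewrite half2; ring.
by ring.
Qed.

Lemma rad_r : rad r = r.
Proof. by rewrite r_def (derM dR) rad_asq rad_rinv; ring. Qed.
Lemma T_r : T r = 0.
Proof. by rewrite r_def (derM (dP _)) T_asq T_rinv; ring. Qed.
Lemma pd_r i : pd i r = om i.
Proof.
rewrite r_def (derM (dP _)) pd_asq pd_rinv om_def.
by ring: rinv_asq.
Qed.

Lemma rad_om i : rad (om i) = 0.
Proof. by rewrite om_def (derM dR) rad_xi rad_rinv; ring. Qed.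
Lemma T_om i : T (om i) = 0.
Proof. by rewrite om_def (derM (dP _)) T_xi T_rinv; ring. Qed.

Lemma del_tau i : del i t = 0.
Proof. by rewrite !del_def pd_tau rad_tau; ring. Qed.
Lemma del_asq i : del i asq = 0.
Proof. by rewrite !del_def pd_asq rad_asq om_def r_def; ring. Qed.
Lemma del_rinv i : del i rinv = 0.
Proof. by rewrite der_rinv// del_asq; ring. Qed.
Lemma del_r i : del i r = 0.
Proof. by rewrite r_def (derM (ddel i)) del_asq del_rinv; ring. Qed.
Lemma del_xi i j : del i (x j) = r * ((i == j)%:R - om i * om j).
Proof. by rewrite !del_def pd_xi rad_xi !om_def; ring: r_rinv. Qed.
Lemma del_om i j : del i (om j) = (i == j)%:R - om i * om j.
Proof.
by rewrite {1}om_def (derM (ddel i)) del_xi del_rinv; ring: r_rinv.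
Qed.
Lemma del_quart i : del i quart = 0.
Proof.
rewrite quart_def (derD (ddel i)) (derM (ddel i)) !(derX2 (ddel i)) del_asq del_tau.
by rewrite (der_nat (ddel i)); ring.
Qed.
Lemma del_sginv i : del i sginv = 0.
Proof. by rewrite der_sginv// del_quart; ring. Qed.
Lemma del_hh i : del i hh = 0.
Proof.
rewrite (der_hh (ddel i)) (derD (ddel i)) (derX2 (ddel i)).
by rewrite del_quart del_asq; ring.
Qed.

Lemma dil_asq : dil asq = 2 * asq.
Proof. by rewrite !dil_def rad_asq T_asq; ring. Qed.
Lemma dil_tau : dil t = 2 * t.
Proof. by rewrite !dil_def rad_tau T_tau; ring. Qed.
Lemma dil_rinv : dil rinv = - rinv.
Proof. by rewrite !dil_def rad_rinv T_rinv; ring. Qed.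
Lemma dil_quart : dil quart = 4 * quart.
Proof.
rewrite quart_def (derD dD) (derM dD) !(derX2 dD) dil_asq dil_tau (der_nat dD).
by ring.
Qed.
Lemma dil_sginv : dil sginv = - 2 * sginv.
Proof.
rewrite der_sginv// dil_quart -/sginv.
rewrite (_ : _ * _ = - 2 * ((kst 2^-1 * 2) * (sginv ^+ 2 * quart) * sginv)).
  by rewrite half2 sginv_quart; ring.
by ring.
Qed.

Lemma rot_asq : rot asq = 4 * t.
Proof. by rewrite !rot_def rad_asq T_asq; ring: rinv_asq. Qed.
Lemma rot_tau : rot t = - asq.
Proof. by rewrite !rot_def rad_tau T_tau; ring. Qed.
Lemma rot_quart : rot quart = 0.
Proof.
rewrite quart_def (derD dB) (derM dB) !(derX2 dB) rot_asq rot_tau (der_nat dB).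
by ring.
Qed.
Lemma rot_sginv : rot sginv = 0.
Proof. by rewrite der_sginv// rot_quart; ring. Qed.

Lemma rad_T u : rad (T u) = T (rad u).
Proof.
rewrite (rad_def (T u)) (rad_def u) (der_sum (dP _)); apply: eq_bigr => i _.
by rewrite (derM (dP _)) T_xi partialC; ring.
Qed.
Lemma rad_pd i u : rad (pd i u) = pd i (rad u) - pd i u.
Proof.
rewrite (rad_def u) (der_sum (dP _)).
have -> : \sum_j pd i (x j * pd j u) =
    \sum_j ((i == j)%:R * pd j u + x j * pd j (pd i u)).
  by apply: eq_bigr => j _; rewrite (derM (dP _)) pd_xi partialC.
by rewrite big_split/= sum_delta -rad_def; ring.
Qed.
Lemma del_rad i u : del i (rad u) = rad (del i u).
Proof.
rewrite (del_def i u) (derD dR) (derN dR) !(derM dR) rad_r rad_om rad_pd.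
by rewrite del_def; ring.
Qed.
Lemma del_T i u : del i (T u) = T (del i u).
Proof.
rewrite (del_def i u) (derD (dP _)) (derN (dP _)) !(derM (dP _)) T_r T_om.
by rewrite del_def rad_T partialC; ring.
Qed.
Lemma del_dil i u : del i (dil u) = dil (del i u).
Proof.
rewrite (dil_def u) (derD (ddel i)) !(derM (ddel i)) (der_nat (ddel i)) del_tau.
by rewrite del_rad del_T dil_def; ring.
Qed.
Lemma del_rot i u : del i (rot u) = rot (del i u).
Proof.
rewrite (rot_def u) (derD (ddel i)) (derN (ddel i)) !(derM (ddel i)).
rewrite (der_nat (ddel i)) del_tau del_asq del_rinv del_rad del_T rot_def.
by ring.
Qed.
Lemma rad_dil u : rad (dil u) = rad (rad u) + 2 * t * T (rad u).
Proof.
by rewrite dil_def (derD dR) !(derM dR) rad_tau (der_nat dR) rad_T; ring.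
Qed.
Lemma T_dil u : T (dil u) = T (rad u) + 2 * T u + 2 * t * T (T u).
Proof.
by rewrite dil_def (derD (dP _)) !(derM (dP _)) T_tau (der_nat (dP _)); ring.
Qed.
Lemma dil_rot u : dil (rot u) = rot (dil u).
Proof.
rewrite (rot_def (dil u)) rad_dil T_dil (rot_def u) (derD dD) (derN dD) !(derM dD).
rewrite (der_nat dD) dil_tau dil_rinv dil_asq !dil_def !rad_T.
by ring.
Qed.

(** The [del i] are components of a tangential gradient and not coordinate fields: differentiating
    the coefficients [om] leaves first-order terms. They contribute to the curvature term of
    Bochner's formula in [null4P]. *)
Lemma del_comm i j u :
  del i (del j u) - del j (del i u) = om i * del j u - om j * del i u.
Proof.
have E k l : del k (del l u) = r * del k (pd l u) - om l * rad (del k u)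
    - ((k == l)%:R - om k * om l) * rad u.
  rewrite (del_def l u) (derD (ddel k)) (derN (ddel k)) !(derM (ddel k)).
  by rewrite del_r del_om del_rad; ring.
have F k l : del k (pd l u) = r * pd k (pd l u) - om k * (pd l (rad u) - pd l u).
  by rewrite del_def rad_pd.
rewrite !E !F (partialC (Some i)) (eq_sym j i).
by rewrite -!del_rad !del_def; ring.
Qed.

End operators.

(** * Integrals of divergences *)

Section integrable_bounded.
Context {R : realType} d (T : measurableType d) (m : {measure set T -> \bar R}).

Lemma integrable_bounded_support (f : T -> R) (A : set T) (C : R) :
  measurable A -> (m A < +oo)%E -> measurable_fun setT f ->
  (forall z, `|f z| <= C) -> (forall z, ~ A z -> f z = 0) ->
  m.-integrable setT (EFin \o f).
Proof.
move=> mA Afin mf fC f0.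
rewrite (_ : EFin \o f = (EFin \o f) \_ A); last first.
  apply/funext => z; rewrite patchE; case: ifPn => // /negP zA /=.
  by rewrite f0// => Az; apply: zA; exact/mem_set.
apply/(integrable_mkcond (EFin \o f) mA).
apply: measurable_bounded_integrable => //.
  exact: measurable_funTS.
exists C; split; first exact: num_real.
by move=> M CM z _ /=; exact: le_trans (fC z) (ltW CM).
Qed.

End integrable_bounded.

Section line_integral.
Context {R : realType}.
Local Notation mu := (@lebesgue_measure R).

Lemma integral_derive_compact_support (F f : R -> R) (N : R) :
  (forall x : R, is_derive x 1 F (f x)) -> continuous f ->
  (forall x, N < `|x| -> F x = 0) -> (\int[mu]_x (f x)%:E = 0)%E.
Proof.
(* [M] exceeds [N] strictly: [F] vanishes at both ends of the interval and near every point beyond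
   it, so that [f] is zero there. *)
move=> dF cf F0; pose M := Num.max N 0 + 1.
have NM : N < M by rewrite /M ltr_pwDr// le_max lexx.
have M0 : 0 < M by rewrite /M ltr_wpDl// le_max lexx orbT.
have f0 x : M < `|x| -> f x = 0.
  move=> Mx; have [_ <-] := dF x.
  rewrite -(derive_cst (0 : R) x 1); apply: near_eq_derive.
  near=> y; rewrite [RHS]/=; apply: F0; apply: (lt_trans NM).
  near: y; apply: (@cvgr_norm_gt _ _ _ _ _ id x _ M) => //.
transitivity (\int[mu]_(x in `[(- M)%R, M]) (f x)%:E)%E; last first.
  have cF : continuous F.
    move=> x; apply/differentiable_continuous/derivable1_diffP.
    by case: (dF x).
  rewrite (@continuous_FTC2 _ f F (- M) M).
  - by rewrite !F0 ?normrN ?gtr0_norm// subee.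
  - by rewrite gtrN.
  - exact: continuous_subspaceT.
  - split; first by move=> x _; case: (dF x).
    + exact/cvg_at_right_filter/cF.
    + exact/cvg_at_left_filter/cF.
  - by move=> x _; rewrite derive1E; case: (dF x).
rewrite [RHS]integral_mkcond; apply: eq_integral => x _.
rewrite patchE; case: ifPn => // /negP xM; congr _%:E.
apply: f0; rewrite ltNge ler_norml; apply/negP => xM'; apply: xM.
by rewrite inE/= in_itv.
Unshelve. all: by end_near. Qed.

End line_integral.

(** * Fubini's theorem for the product measure on tuples *)

Section tuple_integral.
Context {R : realType}.
Local Notation mR := (measurableTypeR R).
Local Notation mu := (@lebesgue_measure R).

Definition tuple_upd n (v : n.-tuple mR) (i : 'I_n) (x : R) : n.-tuple mR :=
  [tuple if j == i then x else tnth v j | j < n].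

Lemma tuple_upd_head n (v : n.-tuple mR) (x y : R) :
  tuple_upd (tuple_cons (y, v)) ord0 x = tuple_cons (x, v).
Proof.
apply: eq_from_tnth => j; rewrite tnth_mktuple.
by case: (unliftP ord0 j) => [k ->|->]//=; rewrite !tnthS.
Qed.

Lemma tuple_upd_tail n (v : n.-tuple mR) (i : 'I_n) (x y : R) :
  tuple_upd (tuple_cons (y, v)) (lift ord0 i) x = tuple_cons (y, tuple_upd v i x).
Proof.
apply: eq_from_tnth => j; rewrite tnth_mktuple.
case: (unliftP ord0 j) => [k ->|->]//=; rewrite !tnthS tnth_mktuple.
by rewrite (inj_eq lift_inj).
Qed.

Definition box n (N : R) : set (n.-tuple mR) :=
  [set v | forall i, `[- N, N]%classic (tnth v i)].

Arguments box : clear implicits.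

Lemma measurable_box n N : measurable (box n N).
Proof.
have -> : box n N =
    \bigcap_(i in [set: 'I_n]) ((@tnth n mR)^~ i @^-1` `[- N, N]%classic).
  by apply/seteqP; split => v /= H i; [move=> _|]; exact: H.
apply: fin_bigcap_measurable; first exact: finite_finset.
move=> i _; rewrite -[X in measurable X]setTI.
by apply: measurable_tnth => //; exact: measurable_itv.
Qed.

Lemma box_lty n N : (lebesgue_tuple n (box n N) < +oo)%E.
Proof.
rewrite (lebesgue_tuple_box (fun=> measurable_itv _)).
rewrite (eq_bigr (fun=> (fine (mu `[- N, N]%classic))%:E)).
  by rewrite prodEFin ltry.
move=> i _; rewrite fineK// lebesgue_measure_itv/=.
by case: ifP.
Qed.
Arguments measurable_box : clear implicits.
Arguments box_lty : clear implicits.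

Definition box_bounded n (f : n.-tuple mR -> R) := measurable_fun setT f /\
  exists C N, (forall v, `|f v| <= C) /\ (forall v, ~ box n N v -> f v = 0).

Lemma box_bounded_integrable n f : box_bounded f ->
  (lebesgue_tuple n).-integrable setT (EFin \o f).
Proof.
move=> [mf [C [N [fC f0]]]].
exact: (@integrable_bounded_support _ _ _ (lebesgue_tuple n) f (box n N) C
  (measurable_box n N) (box_lty n N) mf fC f0).
Qed.

(** [lebesgue_tuple] splits off only the first coordinate. If [i] is the first one, it is integrated
    first; otherwise the first coordinate is frozen and the induction hypothesis applies to the
    tail. *)
Lemma integral_tuple_lines n (i : 'I_n) (f : n.-tuple mR -> R) :
  box_bounded f -> (forall v, \int[mu]_x (f (tuple_upd v i x))%:E = 0)%E ->
  (\int[lebesgue_tuple n]_v (f v)%:E = 0)%E.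
Proof.
elim: n i f => [[]//|n IH] i f bf fl.
have If := box_bounded_integrable bf; rewrite /= in If *.
case: bf => mf [C [N [fC f0]]].
have mcons := @measurable_tuple_cons R n.
pose g := fun z : mR * n.-tuple mR => f (tuple_cons z).
have mg : measurable_fun setT g by exact: measurableT_comp.
have Ig : (@lebesgue_measure R \x lebesgue_tuple n)%E.-integrable setT (EFin \o g).
  have mB : measurable (`[- N, N]%classic `*` box n N : set (mR * n.-tuple mR)).
    by apply: measurableX; [exact: measurable_itv|exact: measurable_box].
  apply: (@integrable_bounded_support _ _ _ (@lebesgue_measure R \x lebesgue_tuple n)%E
    g _ C mB _ mg (fun z => fC _)).
  - have E0 := @product_measure1E _ _ _ _ R (@lebesgue_measure R)
      (lebesgue_tuple n) _ _ (measurable_itv `[- N, N]) (measurable_box n N).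
    suff : (@lebesgue_measure R `[(- N)%R, N]%classic *
        lebesgue_tuple n (box n N) < +oo)%E by rewrite -E0.
    apply: lte_mul_pinfty => //; last exact: box_lty.
    by rewrite ge0_fin_numE//= lebesgue_measure_itv/=; case: ifP => _; rewrite -?EFinB ltry.
  - move=> [x v] zB; apply: f0 => /= B; apply: zB; split=> /=.
      exact: (B ord0).
    by move=> k; have := B (lift ord0 k); rewrite tnthS.
have E : (\int[lebesgue_cons (lebesgue_tuple n)]_v (f v)%:E =
    \int[@lebesgue_measure R \x lebesgue_tuple n]_z (g z)%:E)%E.
  by rewrite integral_pushforward//; exact/measurable_EFinP.
rewrite E; case: (unliftP ord0 i) fl => [j ->|->] fl.
- rewrite -integral12_prod_meas1//= /fubini_F integral0_eq// => x _.
  apply: (IH j) => [|v]; last first.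
    by rewrite -[RHS](fl (tuple_cons (x, v))); apply: eq_integral => y _;
      rewrite tuple_upd_tail.
  split; first by apply: (measurableT_comp mg); exact: pair1_measurable.
  exists C, N; split=> [v|v vB]; first exact: fC.
  apply: f0 => /= B; apply: vB => k.
  by have := B (lift ord0 k); rewrite tnthS.
- rewrite -integral21_prod_meas1//= /fubini_G integral0_eq// => v _.
  rewrite -[RHS](fl (tuple_cons (0, v))); apply: eq_integral => y _.
  by rewrite tuple_upd_head.
Qed.

End tuple_integral.

Arguments box {R} n N.
Arguments measurable_box {R} n N.
Arguments box_lty {R} n N.

(** * Measurability off the axis and integrals of partial derivatives *)

Section measure_space.
Context {R : realType} {n : nat}.
Local Notation mR := (measurableTypeR R).
Local Notation pt := ('rV[R]_n * R)%type.
Local Notation zt := (n.-tuple mR * mR)%type.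
Local Notation mu := (@lebesgue_measure R).
Local Notation nu := (lebesgue_tuple n \x @lebesgue_measure R)%E.

Definition toPt (z : zt) : pt := (\row_i tnth z.1 i, z.2).

(** A countable base of the topology. The sigma-algebra on tuples is generated by the coordinates,
    so open sets are shown measurable as countable unions of these boxes. *)
Definition rat_box (b : 'rV[rat]_n * rat * nat) : set pt :=
  [set p : pt | (forall i, `|p.1 0 i - ratr (b.1.1 0 i)| < b.2.+1%:R^-1) /\
           `|p.2 - ratr b.1.2| < b.2.+1%:R^-1].

Lemma measurable_tnth_fst (i : 'I_n) :
  measurable_fun setT (fun z : zt => tnth z.1 i : R).
Proof.
apply: (measurableT_comp (f := fun v : n.-tuple mR => tnth v i)).
  exact: measurable_tnth.
exact: measurable_fst.
Qed.

Lemma measurable_dist_lt (g : zt -> R) (a e : R) : measurable_fun setT g ->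
  measurable [set z | `|g z - a| < e].
Proof.
move=> mg.
rewrite (_ : [set _ | _] = g @^-1` `]a - e, a + e[%classic).
  by rewrite -[X in measurable X]setTI; apply: mg => //; exact: measurable_itv.
apply/seteqP; split => z /=; rewrite in_itv/= ltr_norml.
  by move=> /andP[? ?]; apply/andP; split; lra.
by move=> /andP[? ?]; apply/andP; split; lra.
Qed.

Lemma measurable_rat_box b : measurable (toPt @^-1` rat_box b).
Proof.
have -> : toPt @^-1` rat_box b =
    (\bigcap_(i in [set: 'I_n])
      [set z : zt | `|tnth z.1 i - ratr (b.1.1 0 i)| < b.2.+1%:R^-1]) `&`
    [set z : zt | `|z.2 - ratr b.1.2| < b.2.+1%:R^-1].
  apply/seteqP; split => [z [H1 H2]|z [H1 H2]]; split=> //.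
    by move=> i _; have := H1 i; rewrite /= mxE.
  by move=> i; rewrite /= mxE; exact: H1.
apply: measurableI; last exact: measurable_dist_lt measurable_snd.
apply: fin_bigcap_measurable; first exact: finite_finset.
by move=> i _; exact: measurable_dist_lt (measurable_tnth_fst i).
Qed.

Lemma rat_approx (a e : R) : 0 < e -> exists q : rat, `|a - ratr q| < e.
Proof.
move=> e0; have [q] : exists q : rat, a - e < ratr q < a + e.
  have H : a - e < a + e by lra.
  by have [q qI] := rat_in_itvoo H; exists q; move: qI; rewrite in_itv.
by move=> /andP[? ?]; exists q; rewrite ltr_norml; apply/andP; split; lra.
Qed.

Lemma open_rat_box (O : set pt) : open O ->
  O = \bigcup_(b in [set b | rat_box b `<=` O]) rat_box b.
Proof.
move=> oO; apply/seteqP; split => [p Op|p [b bO]]; last exact: bO.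
have [e /= e0 He] := (nbhs_ballP _ _).1 (open_nbhs_nbhs (conj oO Op)).
pose k := Num.truncn (2 / e).
have ke : k.+1%:R^-1 < e / 2.
  by rewrite invf_plt ?posrE ?divr_gt0// invf_div; exact: truncnS_gt.
have k0 : 0 < k.+1%:R^-1 :> R by rewrite invr_gt0.
have [q1 H1] : exists q : 'rV[rat]_n,
    forall i, `|p.1 0 i - ratr (q 0 i)| < k.+1%:R^-1.
  have /choice[q Hq] : forall i, exists q : rat, `|p.1 0 i - ratr q| < k.+1%:R^-1.
    by move=> i; exact: rat_approx.
  by exists (\row_i q i) => i; rewrite mxE.
have [q2 H2] := rat_approx p.2 k0.
exists (q1, q2, k); last by split.
move=> q /= [Q1 Q2]; apply: He.
have close (a b c : R) : `|a - c| < k.+1%:R^-1 -> `|b - c| < k.+1%:R^-1 ->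
    `|a - b| < e.
  move: ke; move: (k.+1%:R^-1) => d ke ac bc.
  rewrite (_ : a - b = (a - c) - (b - c)); last by ring.
  by rewrite (le_lt_trans (ler_normB _ _))//; lra.
split=> /=.
  split=> // i j; rewrite ord1 -ball_normE /=; exact: close (H1 j) (Q1 j).
by rewrite -ball_normE /=; exact: close H2 Q2.
Qed.

Lemma measurable_toPt_open (O : set pt) : open O -> measurable (toPt @^-1` O).
Proof.
move=> /open_rat_box ->.
rewrite (_ : \bigcup_(b in _) _ = \bigcup_(b : 'rV[rat]_n * rat * nat)
    (if `[< rat_box b `<=` O >] then rat_box b else set0)); last first.
  apply/seteqP; split => p.
    by move=> [b bO pb]; exists b => //; case: asboolP.
  by move=> [b _]; case: asboolP => // bO pb; exists b.
rewrite preimage_bigcup; apply: countable_bigcupT_measurable => [|b].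
  exact: countableP.
by case: ifP => _; [exact: measurable_rat_box|rewrite preimage_set0].
Qed.

(** Continuity can fail only on the axis, where [f] is zero: the preimage of an open set [O] is an
    open set, joined with the whole axis when 0 lies in [O]. *)
Lemma measurable_off_axis (f : pt -> R) :
  (forall p, p.1 != 0 -> {for p, continuous f}) ->
  (forall p, p.1 = 0 -> f p = 0) -> measurable_fun setT (f \o toPt).
Proof.
move=> cf f0.
apply: (measurability _ (RGenOpens.measurableE R)).
move=> _ [_ [a [b ->] <-]]; rewrite setTI comp_preimage.
have oO : open `]a, b[%classic by exact: interval_open.
move: `]a, b[%classic oO => O oO.
have oU := @open_off_axis R n.
have oO' : open (off_axis `&` f @^-1` O).
  rewrite openE => p [pU fpO].
  have := cf p pU O (open_nbhs_nbhs (conj oO fpO)).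
  apply: filterS2 (open_nbhs_nbhs (conj oU pU)) => q qU qO.
  by split.
have -> : f @^-1` O = (off_axis `&` f @^-1` O) `|`
    (~` off_axis `&` (if 0 \in O then setT else set0)).
  apply/seteqP; split => p.
    have [p0|p0] := eqVneq p.1 0 => fpO; last by left.
    right; split; first by rewrite /= /off_axis /= p0 eqxx.
    by rewrite /= f0// in fpO; rewrite mem_set.
  case=> [[_ //]|[/negP/negPn/eqP p0]]; case: ifPn => // /set_mem O0 _.
  by rewrite /= f0.
rewrite preimage_setU; apply: measurableU; first exact: measurable_toPt_open.
rewrite preimage_setI; apply: measurableI; last first.
  by case: ifP; rewrite ?preimage_setT ?preimage_set0.
rewrite preimage_setC; apply: measurableC.
exact: measurable_toPt_open oU.
Qed.

Lemma null_hyperplane (i : 'I_n) : nu [set z : zt | tnth z.1 i = 0] = 0%E.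
Proof.
pose A (j : 'I_n) : set mR := if j == i then [set 0] else setT.
have mA j : measurable (A j) by rewrite /A; case: ifP.
pose B := [set v : n.-tuple mR | forall j, A j (tnth v j)].
have mB : measurable B.
  have -> : B = \bigcap_(i in [set: 'I_n]) ((@tnth n mR)^~ i @^-1` A i).
    by apply/seteqP; split => v /= H j; [move=> _|]; exact: H.
  apply: fin_bigcap_measurable; first exact: finite_finset.
  move=> j _; rewrite -[X in measurable X]setTI.
  exact: measurable_tnth.
have -> : [set z : zt | tnth z.1 i = 0] = B `*` setT.
  apply/seteqP; split => [z /= zi|z [/(_ i)]]; last by rewrite /A eqxx.
  by split=> // j; rewrite /A; case: eqP => // ->.
have B0 : lebesgue_tuple n B = 0%E.
  rewrite [LHS](lebesgue_tuple_box mA) (bigD1 i)//=.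
  by rewrite {1}/A eqxx lebesgue_measure_set1 mul0e.
have E := @product_measure1E _ _ _ _ R (lebesgue_tuple n) (@lebesgue_measure R)
  _ _ mB (measurableT).
(* The second factor has infinite measure; the convention 0 * +oo = 0 applies. *)
exact: etrans E (etrans (congr1 (fun y => y * mu setT)%E B0) (mul0e _)).
Qed.

Lemma measurable_hyperplane (i : 'I_n) : measurable [set z : zt | tnth z.1 i = 0].
Proof.
rewrite (_ : [set _ | _] = (fun z : zt => tnth z.1 i) @^-1` [set 0]) //.
by rewrite -[X in measurable X]setTI; exact: measurable_tnth_fst.
Qed.

Definition in_box (N : R) (p : pt) :=
  (forall i, `|p.1 0 i| <= N) /\ `|p.2| <= N.

Lemma box_lineP N (z : zt) :
  in_box N (toPt z) <-> (box n N `*` `[(- N)%R, N]%classic) z.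
Proof.
rewrite /in_box /box /=; split=> -[H1 H2]; split.
- by move=> i; have := H1 i; rewrite mxE in_itv/= ler_norml.
- by rewrite /= in_itv/= -ler_norml.
- by move=> i; have := H1 i; rewrite mxE /= in_itv/= -ler_norml.
- by move: H2; rewrite /= in_itv/= -ler_norml.
Qed.

Lemma integrable_box (f : pt -> R) (C N : R) : measurable_fun setT (f \o toPt) ->
  (forall p, `|f p| <= C) -> (forall p, ~ in_box N p -> f p = 0) ->
  nu.-integrable setT (fun z => (f (toPt z))%:E).
Proof.
move=> mf fC f0.
have mI : measurable (`[(- N)%R, N]%classic : set mR) by exact: measurable_itv.
have mB := measurableX (measurable_box n N) mI.
apply: (@integrable_bounded_support _ _ _ nu (f \o toPt) _ C mB _ mf).
- have E0 := @product_measure1E _ _ _ _ R (lebesgue_tuple n)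
    (@lebesgue_measure R) _ _ (measurable_box n N) mI.
  suff : (lebesgue_tuple n (box n N) *
      @lebesgue_measure R `[(- N)%R, N]%classic < +oo)%E by rewrite -E0.
  rewrite muleC; apply: lte_mul_pinfty => //; last exact: box_lty.
  by rewrite ge0_fin_numE//= lebesgue_measure_itv/=; case: ifP => _; rewrite -?EFinB ltry.
- by move=> z; exact: fC.
- by move=> z zB; apply: f0 => H; apply: zB; apply/box_lineP.
Qed.

Lemma integralG_t (f : pt -> R) : nu.-integrable setT (fun z => (f (toPt z))%:E) ->
  (forall x, \int[mu]_t (f (x, t))%:E = 0)%E -> integralG f = 0%E.
Proof.
move=> If fl; rewrite /integralG -(integral12_prod_meas1 If) /fubini_F.
by rewrite integral0_eq// => v _; exact: (fl (\row_i tnth v i)).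
Qed.

Definition pt_upd (p : pt) (i : 'I_n) (s : R) : pt :=
  (\row_j (if j == i then s else p.1 0 j), p.2).

Lemma integralG_x (f : pt -> R) (C N : R) i :
  measurable_fun setT (f \o toPt) ->
  (forall p, `|f p| <= C) -> (forall p, ~ in_box N p -> f p = 0) ->
  (forall p, \int[mu]_s (f (pt_upd p i s))%:E = 0)%E -> integralG f = 0%E.
Proof.
move=> mf fC f0 fl; have If := integrable_box mf fC f0.
rewrite /integralG -(integral21_prod_meas1 If) /fubini_G.
rewrite integral0_eq// => t _; apply: (@integral_tuple_lines _ _ i (fun v => f (toPt (v, t)))).
  split; first by apply: (measurableT_comp mf); exact: pair2_measurable.
  exists C, N; split=> [v|v vB]; first exact: fC.
  by apply: f0 => /box_lineP[].
move=> v; rewrite -[RHS](fl (toPt (v, t))); apply: eq_integral => s _.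
congr (f (_, _))%:E; apply/rowP => j.
by rewrite !mxE tnth_mktuple.
Qed.

Lemma line_off_axis (F : @offun R n) d (p : pt) N :
  (forall s : R, (p + s *: dir d).1 != 0) ->
  (forall s : R, N < `|s| -> F (p + s *: dir d) = 0) ->
  (\int[mu]_s (partial d F (p + s *: dir d))%:E = 0)%E.
Proof.
move=> pU F0.
apply: (@integral_derive_compact_support _ (fun s => F (p + s *: dir d)) _ N) => //.
  move=> s; have [dF FE] := offun_is_derive F d (pU s).
  by rewrite -FE; exact: is_derive_line.
move=> s; apply: (@continuous_comp _ _ _ (fun s : R => p + s *: dir d)).
  apply: continuousD; first exact: cst_continuous.
  exact: scalel_continuous.
exact: (@offun_continuous _ _ (partial d F) _ (pU s)).
Qed.

Definition supported (K : set pt) (F : pt -> R) := forall p, ~ K p -> F p = 0.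

Lemma supported_partial (K : set pt) (F : @offun R n) d :
  closed K -> supported K F -> supported K (partial d F).
Proof.
move=> cK KF p nKp; have [p0|p0] := eqVneq p.1 0; first exact: offun_axis.
rewrite partialE// -(derive_cst (0 : R) p (dir d)); apply: near_eq_derive.
have oK : open (~` K) by exact: closed_openC.
by apply: filterS (open_nbhs_nbhs (conj oK nKp)) => q /= /KF.
Qed.

Lemma measurable_offun (F : @offun R n) : measurable_fun setT (F \o toPt).
Proof.
by apply: measurable_off_axis => p; [exact: offun_continuous|exact: offun_axis].
Qed.

(** Changing [f] on this null set makes its integral vanish on every line instead of almost every
    line, as [integralG_x] demands: lines inside the hyperplane may meet the axis. *)
Lemma hyperplane_cut (i : 'I_n) (f : pt -> R) : measurable_fun setT (f \o toPt) ->
  let g (p : pt) := if p.1 0 i == 0 then 0 else f p in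
  measurable_fun setT (g \o toPt) /\ integralG f = integralG g.
Proof.
move=> mf g.
have mg : measurable_fun setT (g \o toPt).
  have -> : g \o toPt = (f \o toPt) \* \1_(~` [set z : zt | tnth z.1 i = 0]).
    apply/funext => z; rewrite /g /= indicE mxE.
    case: eqP => zi; last by rewrite mem_set ?mulr1.
    by rewrite memNset ?mulr0//; exact.
  apply: measurable_funM => //; apply: measurable_indic.
  by apply: measurableC; exact: measurable_hyperplane.
split=> //; apply: ae_eq_integral => //; try exact/measurable_EFinP.
exists [set z : zt | tnth z.1 i = 0]; split.
- exact: measurable_hyperplane.
- exact: null_hyperplane.
- move=> z /= /not_implyP[_]; rewrite /g mxE; case: eqP => // _.
Qed.

(** [F] may be discontinuous on the axis, yet no boundary term arises there: Fubini's theorem leads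
    to lines that avoid the axis, on which [F] is continuously differentiable with compact
    support. *)
Lemma integralG_partial (K : set pt) (F : @offun R n) d (C N : R) : (2 <= n)%N ->
  closed K -> K `<=` in_box N -> supported K F ->
  (forall p, `|partial d F p| <= C) -> integralG (partial d F) = 0%E.
Proof.
move=> n2 cK KN KF FC.
have KF' := supported_partial d cK KF.
have mF := measurable_offun (partial d F).
have F0 p : ~ in_box N p -> F p = 0 by move=> H; apply: KF => /KN.
have F0' p : ~ in_box N p -> partial d F p = 0 by move=> H; apply: KF' => /KN.
case: d => [i|] in FC KF' mF F0' *; last first.
  apply: integralG_t; first exact: integrable_box mF FC F0'.
  (* A line in the direction t lies in the axis, where the integrand is zero by normalization, or
     avoids it altogether. *)
  move=> x; have [->|x0] := eqVneq x 0.
    by rewrite integral0_eq// => t _; rewrite offun_axis.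
  have E (s : R) : ((x, s) : pt) = (x, 0) + s *: dir None.
    by congr pair => /=; rewrite ?scaler0 ?addr0 ?add0r// [_ *: 1]mulr1.
  rewrite -[RHS](@line_off_axis F None (x, 0) N).
  - by apply: eq_integral => s _; rewrite E.
  - by move=> s; rewrite -E.
  - move=> s Ns; rewrite -E; apply: F0 => -[_ /=].
    by rewrite leNgt Ns.
(* Almost every line in the direction [i] avoids the axis, because it avoids
   some hyperplane [x_j = 0] with [j != i]. *)
have [j ji] : exists j : 'I_n, j != i.
  case: (eqVneq i (Ordinal (ltnW n2))) => [->|i0].
    by exists (Ordinal n2).
  by exists (Ordinal (ltnW n2)); rewrite eq_sym.
have [mg ->] := hyperplane_cut j mF.
set g := fun p : pt => _ in mg *.
apply: (@integralG_x g C N i mg).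
- move=> p; rewrite /g; case: ifP => // _.
  by rewrite normr0 (le_trans _ (FC p)).
- by move=> p pN; rewrite /g; case: ifP => // _; exact: F0'.
move=> p; have [pj|pj] := eqVneq (p.1 0 j) 0.
  rewrite integral0_eq// => s _.
  by rewrite /g mxE (negbTE ji) pj eqxx.
have E (s : R) : pt_upd p i s = pt_upd p i 0 + s *: dir (Some i).
  congr pair; last by rewrite /= scaler0 addr0.
  apply/rowP => k; rewrite !mxE /=; case: eqP => _; rewrite ?mulr1 ?add0r//.
  by rewrite mulr0 addr0.
have nz (s : R) : (pt_upd p i s).1 != 0.
  by apply/rV0Pn; exists j; rewrite mxE (negbTE ji).
rewrite -[RHS](@line_off_axis F (Some i) (pt_upd p i 0) N).
- apply: eq_integral => s _; rewrite /g mxE (negbTE ji) (negbTE pj).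
  by rewrite E.
- by move=> s; rewrite -E.
- move=> s Ns; rewrite -E; apply: F0 => -[/(_ i)]; rewrite /= mxE eqxx.
  by rewrite leNgt Ns.
Qed.

End measure_space.

(** * Generated rings of bounded functions and functions of integral zero *)

Section generated.
Context {R : realType} {n : nat}.
Local Notation offun := (@offun R n).
Implicit Types (f g : offun) (A : offun -> Prop).

(** The algebra over the constants generated by [A]: boundedness on a set and stability under a
    derivation have to be checked on generators only. *)
Inductive gen A : offun -> Prop :=
| gen_atom f of A f : gen A f
| gen_kst c : gen A (kst c)
| gen_add f g of gen A f & gen A g : gen A (f + g)
| gen_mul f g of gen A f & gen A g : gen A (f * g).

Section gen_theory.
Variable A : offun -> Prop.

Lemma gen_opp f : gen A f -> gen A (- f).
Proof. by move=> Af; rewrite -mulN1r -kst1 -kstN; apply: gen_mul => //; exact: gen_kst. Qed.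
Lemma gen_nat k : gen A k%:R.
Proof. by rewrite -kst_nat; exact: gen_kst. Qed.
Lemma gen1 : gen A 1. Proof. exact: (gen_nat 1). Qed.
Lemma gen0 : gen A 0. Proof. exact: (gen_nat 0). Qed.
Lemma gen_exp f k : gen A f -> gen A (f ^+ k).
Proof.
by move=> Af; elim: k => [|k IH]; [exact: gen1|rewrite exprS; exact: gen_mul].
Qed.
Lemma gen_sum (I : Type) (r : seq I) (P : pred I) (F : I -> offun) :
  (forall i, gen A (F i)) -> gen A (\sum_(i <- r | P i) F i).
Proof. by move=> AF; apply: big_ind => //; [exact: gen0|exact: gen_add]. Qed.

Lemma gen_der D f : derivation D -> (forall g, A g -> gen A (D g)) ->
  gen A f -> gen A (D f).
Proof.
move=> dD AD; elim=> {f} [f /AD//|c|f g _ Df _ Dg|f g Af Df Ag Dg].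
- by rewrite der_kst//; exact: gen0.
- by rewrite derD//; exact: gen_add.
- by rewrite derM//; apply: gen_add; exact: gen_mul.
Qed.

Definition bounded_on_set (K : set ('rV[R]_n * R)) (f : 'rV[R]_n * R -> R) :=
  exists C, forall p, K p -> `|f p| <= C.

Lemma gen_bounded K f : (forall g, A g -> bounded_on_set K g) ->
  gen A f -> bounded_on_set K f.
Proof.
move=> AK; elim=> {f} [f /AK//|c|f g _ [C1 H1] _ [C2 H2]|f g _ [C1 H1] _ [C2 H2]].
- exists `|c| => p _; have [p0|p0] := eqVneq p.1 0; last by rewrite kstE.
  by rewrite offun_axis// normr0.
- exists (C1 + C2) => p Kp; rewrite offunD (le_trans (ler_normD _ _))//.
  by rewrite lerD ?H1 ?H2.
- exists (C1 * C2) => p Kp; rewrite offunM normrM ler_pM ?H1 ?H2//.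
Qed.
End gen_theory.
End generated.

Section supported_functions.
Context {R : realType} {n : nat}.
Local Notation offun := (@offun R n).
Local Notation pt := ('rV[R]_n * R)%type.
Variable K : set pt.
Implicit Types (f g : offun).

Lemma supp_inD f g : supported K f -> supported K g -> supported K (f + g).
Proof. by move=> Kf Kg p pK; rewrite offunD Kf// Kg// addr0. Qed.
Lemma supp_inN f : supported K f -> supported K (- f).
Proof. by move=> Kf p pK; rewrite offunN Kf// oppr0. Qed.
Lemma supp_inMr f g : supported K g -> supported K (f * g).
Proof. by move=> Kg p pK; rewrite offunM Kg// mulr0. Qed.
Lemma supp_in_sum (I : Type) (r : seq I) (P : pred I) (F : I -> offun) :
  (forall i, supported K (F i)) -> supported K (\sum_(i <- r | P i) F i).
Proof.
move=> KF; apply: (big_ind (fun f : offun => supported K f)) => //; last exact: supp_inD.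
by move=> p _; rewrite offun0.
Qed.
End supported_functions.

Section null_integral.
Context {R : realType} {n : nat}.
Local Notation offun := (@offun R n).
Local Notation pt := ('rV[R]_n * R)%type.
Local Notation nu := (lebesgue_tuple n \x @lebesgue_measure R)%E.
Implicit Types (f g : offun).

Definition integrableG f := nu.-integrable setT (fun z => (f (toPt z))%:E).

Lemma integralGD f g : integrableG f -> integrableG g ->
  integrableG (f + g) /\ integralG (f + g) = (integralG f + integralG g)%E.
Proof.
move=> If Ig.
have E : (fun z => ((f + g) (toPt z))%:E) =
    ((fun z => (f (toPt z))%:E) \+ (fun z => (g (toPt z))%:E))%E.
  by apply/funext => z; rewrite offunD EFinD.
split; first by rewrite /integrableG E; exact: integrableD.
by rewrite /integralG [X in integral _ _ X = _]E [LHS]integralD.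
Qed.

Lemma integralGZ c f : integrableG f ->
  integrableG (kst c * f) /\ integralG (kst c * f) = (c%:E * integralG f)%E.
Proof.
move=> If.
have E : (fun z => ((kst c * f) (toPt z))%:E) =
    (fun z => c%:E * (f (toPt z))%:E)%E.
  apply/funext => z; rewrite offunM -EFinM; congr (_%:E).
  have [p0|p0] := eqVneq (toPt z).1 0; last by rewrite kstE.
  by rewrite [f _]offun_axis// !mulr0.
split; first by rewrite /integrableG E; exact: integrableZl.
by rewrite /integralG [X in integral _ _ X = _]E [LHS]integralZl.
Qed.

(** Plays the role of a divergence: integrations by parts are recorded as additions of such
    functions to pointwise identities. *)
Definition nullG f := integrableG f /\ integralG f = 0%E.

Lemma nullGD f g : nullG f -> nullG g -> nullG (f + g).
Proof.
move=> [If f0] [Ig g0]; have [Ifg E] := integralGD If Ig.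
by rewrite /nullG E f0 g0 adde0.
Qed.

Lemma nullGZ c f : nullG f -> nullG (kst c * f).
Proof.
by move=> [If f0]; have [Icf E] := integralGZ c If; rewrite /nullG E f0 mule0.
Qed.

Lemma nullGN f : nullG f -> nullG (- f).
Proof. by move=> /(nullGZ (-1)); rewrite kstN kst1 mulN1r. Qed.

Lemma nullG0 : nullG 0.
Proof.
have E : (fun z => ((0 : offun) (toPt z))%:E) = cst 0%E.
  by apply/funext => z; rewrite offun0.
split; first by rewrite /integrableG E; exact: integrable0.
by rewrite /integralG [X in integral _ _ X]E integral0.
Qed.

Lemma nullG_sum (I : Type) (r : seq I) (P : pred I) (F : I -> offun) :
  (forall i, nullG (F i)) -> nullG (\sum_(i <- r | P i) F i).
Proof. by move=> NF; apply: big_ind => //; [exact: nullG0|exact: nullGD]. Qed.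

Lemma nullG_partial (K : set pt) (N : R) f d : (2 <= n)%N ->
  closed K -> K `<=` in_box N -> supported K f ->
  bounded_on_set K (partial d f) -> nullG (partial d f).
Proof.
move=> n2 cK KN Kf [C fC].
have fC' p : `|partial d f p| <= `|C|.
  have [Kp|nKp] := pselect (K p); first exact: le_trans (fC p Kp) (ler_norm _).
  by rewrite (supported_partial d cK Kf nKp) normr0.
split; last exact: integralG_partial n2 cK KN Kf fC'.
apply: (integrable_box (measurable_offun _) fC') => p pN.
have nKp : ~ K p := fun Kp => pN (KN _ Kp).
exact: (supported_partial d cK Kf nKp).
Qed.

End null_integral.

Section tame_functions.
Context {R : realType} {n : nat}.
Local Notation offun := (@offun R n).
Local Notation pt := ('rV[R]_n * R)%type.
Local Notation r := (@r R n).
Local Notation sginv := (@sginv R n).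
Local Notation hh := (@hh R n).
Implicit Types (f g : offun) (p : pt).

Definition extends_smoothly g :=
  exists2 f : pt -> R, smooth f & forall p, p.1 != 0 -> g p = f p.

(* The first class is stable under the vector fields [del i], [rad] and [T],
   the second one under all partial derivatives; both consist of functions that
   are bounded on the compact subsets of the complement of the origin. *)
Inductive tame_atom : offun -> Prop :=
| atom_om i : tame_atom (om i)
| atom_r : tame_atom r
| atom_tau : tame_atom tau
| atom_sginv : tame_atom sginv
| atom_hh : tame_atom hh
| atom_jet g of extends_smoothly g : tame_atom g.

Definition tame := gen tame_atom.

Inductive smooth_atom : offun -> Prop :=
| smooth_xi i : smooth_atom (xi i)
| smooth_tau : smooth_atom tau
| smooth_sginv : smooth_atom sginv
| smooth_jet g of extends_smoothly g : smooth_atom g.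

Definition smoothly := gen smooth_atom.

Lemma tame_om i : tame (om i). Proof. exact/gen_atom/atom_om. Qed.
Lemma tame_r : tame r. Proof. exact/gen_atom/atom_r. Qed.
Lemma tame_tau : tame tau. Proof. exact/gen_atom/atom_tau. Qed.
Lemma tame_sginv : tame sginv. Proof. exact/gen_atom/atom_sginv. Qed.
Lemma tame_hh : tame hh. Proof. exact/gen_atom/atom_hh. Qed.
Lemma tame_jet g : extends_smoothly g -> tame g.
Proof. by move=> ?; exact/gen_atom/atom_jet. Qed.
Lemma smoothly_xi i : smoothly (xi i). Proof. exact/gen_atom/smooth_xi. Qed.
Lemma smoothly_tau : smoothly tau. Proof. exact/gen_atom/smooth_tau. Qed.
Lemma smoothly_sginv : smoothly sginv. Proof. exact/gen_atom/smooth_sginv. Qed.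
Lemma smoothly_jet g : extends_smoothly g -> smoothly g.
Proof. by move=> ?; exact/gen_atom/smooth_jet. Qed.

End tame_functions.

(** Follows the syntax of an expression down to its generators; the last case unfolds local
    constants such as [z], and what remains is left as a goal. *)
Ltac gen_tac := rewrite /tame /smoothly; intros; repeat (
  first [ assumption
  | lazymatch goal with
    | |- gen _ (_ + _) => apply: gen_add
    | |- gen _ (- _) => apply: gen_opp
    | |- gen _ (_ * _) => apply: gen_mul
    | |- gen _ (_ ^+ _) => apply: gen_exp
    | |- gen _ (bigop _ _ _) => apply: gen_sum => ?
    | |- gen _ (kst _) => exact: gen_kst
    | |- gen _ 1 => exact: gen1
    | |- gen _ 0 => exact: gen0
    | |- gen _ (_%:R) => exact: gen_nat
    | |- gen _ (om _) => exact: tame_om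
    | |- gen _ r => exact: tame_r
    | |- gen _ hh => exact: tame_hh
    | |- gen _ sginv => first [exact: tame_sginv | exact: smoothly_sginv]
    | |- gen _ tau => first [exact: tame_tau | exact: smoothly_tau]
    | |- gen _ (xi _) => exact: smoothly_xi
    | |- gen _ ?f => is_var f; rewrite /f
    end ]).

Section tame.
Context {R : realType} {n : nat}.
Local Notation offun := (@offun R n).
Local Notation pt := ('rV[R]_n * R)%type.
Implicit Types (f g : offun) (p : pt).

Lemma smooth_off_smooth (f : pt -> R) : smooth f -> smooth_on dir (@off_axis R n) f.
Proof.
move=> sf k; move: {sf}(sf k); elim: k f => [|k IH] f.
  by move=> cf; split=> // p _; exact: cf.
move=> [cf dxf dtf Dx Dt]; split; first by move=> p _; exact: cf.
split=> [[i|] p _|[i|]]; [exact: dxf|exact: dtf| |].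
  by apply: IH; exact: Dx.
by apply: IH; exact: Dt.
Qed.

Lemma smooth_derive (f : pt -> R) d : smooth f -> smooth ('D_(dir d) f).
Proof.
move=> sf k; have [_ _ _ Dx Dt] := sf k.+1.
by case: d => [i|]; [exact: Dx|exact: Dt].
Qed.

Lemma extends_partial g d : extends_smoothly g -> extends_smoothly (partial d g).
Proof.
move=> [f sf gf]; exists ('D_(dir d) f); first exact: smooth_derive.
by move=> p; exact: partial_eq.
Qed.

Variables (K : set pt) (N : R).
Hypotheses (n2 : (2 <= n)%N) (cptK : compact K) (KN : K `<=` in_box N)
  (K0 : ~ K (0, 0)).

Lemma bounded_continuous_at (f : pt -> R) :
  (forall p, K p -> {for p, continuous f}) -> bounded_on_set K f.
Proof.
move=> cf.
have cfK : {within K, continuous f}.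
  by apply: continuous_in_subspaceT => p /set_mem; exact: cf.
have [M [_ HM]] := compact_bounded (continuous_compact cfK cptK).
exists (M + 1) => p Kp; apply: (HM (M + 1)); first by rewrite ltrDl.
by exists p.
Qed.

Lemma closedK : closed K.
Proof. by apply: compact_closed => //; exact: norm_hausdorff. Qed.

Lemma extends_bounded g : extends_smoothly g -> bounded_on_set K g.
Proof.
move=> [f sf gf].
have [C fC] : bounded_on_set K f.
  by apply: bounded_continuous_at => p _; exact: (sf 0).
exists C => p Kp; have [p0|p0] := eqVneq p.1 0; last by rewrite gf// fC.
by rewrite offun_axis// normr0 (le_trans _ (fC p Kp)).
Qed.

Lemma xi_bounded i : bounded_on_set K (xi i).
Proof.
exists N => p Kp; have [H1 H2] := KN Kp.
have [p0|p0] := eqVneq p.1 0; last by rewrite xiE.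
by rewrite offun_axis// normr0 (le_trans _ H2).
Qed.

Lemma tau_bounded : bounded_on_set K (@tau R n).
Proof.
exists N => p Kp; have [H1 H2] := KN Kp.
have [p0|p0] := eqVneq p.1 0; last by rewrite tauE.
by rewrite offun_axis// normr0 (le_trans _ H2).
Qed.

Let rho4 p := (\sum_i p.1 0 i ^+ 2) ^+ 2 + 4 * p.2 ^+ 2.

Lemma continuous_sum_fun (I : Type) (r : seq I) (F : I -> pt -> R) :
  (forall i, continuous (F i)) -> continuous (fun p => \sum_(i <- r) F i p).
Proof.
move=> cF; elim: r => [|i r IH].
  rewrite (_ : (fun p => _) = cst 0); last by apply/funext => p; rewrite big_nil.
  exact: cst_continuous.
rewrite (_ : (fun p => _) = F i + (fun p => \sum_(i <- r) F i p)).
  by move=> p; apply: continuousD; [exact: cF|exact: IH].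
by apply/funext => p; rewrite big_cons.
Qed.

Lemma continuous_sqr (F : pt -> R) : continuous F -> continuous (fun p => F p ^+ 2).
Proof. by move=> cF p; apply: (@continuousM _ _ F F p); exact: cF. Qed.

Lemma rho4_continuous : continuous rho4.
Proof.
have cs : continuous (fun p : pt => (\sum_i p.1 0 i ^+ 2) ^+ 2).
  apply: continuous_sqr; apply: continuous_sum_fun => i.
  by apply: continuous_sqr; exact: continuous_xcoord.
have ct : continuous (fun p : pt => 4 * p.2 ^+ 2).
  move=> p; apply: (@continuousM _ _ (cst 4) (fun p : pt => p.2 ^+ 2)).
    exact: cst_continuous.
  by apply: continuous_sqr; exact: continuous_tcoord.
by move=> p; apply: (@continuousD _ _ _ _ _ p (cs p) (ct p)).
Qed.

Lemma rho4_gt0 p : p != (0, 0) -> 0 < rho4 p.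
Proof.
case: p => [x s]; rewrite /rho4 /= => xs0.
have S0 : 0 <= \sum_i x 0 i ^+ 2 by apply: sumr_ge0 => i _; exact: sqr_ge0.
have [s0|s0] := eqVneq s 0; last first.
  by rewrite ltr_wpDl ?exprn_ge0// mulr_gt0// exprn_even_gt0.
have /rV0Pn[i xi0] : x != 0 by apply: contraNneq xs0 => ->; rewrite s0.
have {}S0 : 0 < \sum_i x 0 i ^+ 2.
  rewrite (bigD1 i)//= ltr_pwDl//; first by rewrite exprn_even_gt0.
  by apply: sumr_ge0 => j _; exact: sqr_ge0.
by apply: ltr_pwDl; rewrite ?exprn_gt0// mulr_ge0// sqr_ge0.
Qed.

Lemma quart_rho4 p : p.1 != 0 -> quart p = rho4 p.
Proof. by move=> p0; rewrite quartE// asqE. Qed.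

Lemma sginv_bounded : bounded_on_set K (@sginv R n).
Proof.
have [C HC] : bounded_on_set K (fun p => (Num.sqrt (rho4 p))^-1).
  apply: bounded_continuous_at => p Kp.
  have p0 : p != (0, 0) by apply/eqP => p0; apply: K0; rewrite -p0.
  apply: (@continuousV _ _ (fun p => Num.sqrt (rho4 p))).
    by rewrite gt_eqF// sqrtr_gt0 rho4_gt0.
  apply: continuous_comp; first exact: rho4_continuous.
  exact: sqrt_continuous.
exists C => p Kp; have [p0|p0] := eqVneq p.1 0.
  by rewrite offun_axis// normr0 (le_trans _ (HC p Kp)).
by rewrite sginv_def invsqrtE// quart_rho4// HC.
Qed.

(** [hh] is at most [sginv ^+ 2], because rho^4 + |x|^4 is at least rho^4. *)
Lemma hh_bounded : bounded_on_set K (@hh R n).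
Proof.
have [C HC] := sginv_bounded; exists (C ^+ 2) => p Kp.
have [p0|p0] := eqVneq p.1 0.
  by rewrite offun_axis// normr0 sqr_ge0.
have q0 := quart_gt0 p0; have qa0 := quart_asq_gt0 p0.
have := HC p Kp; rewrite hh_def sginv_def offunX// !invsqrtE// => sC.
have E (x : R) : 0 < x -> (Num.sqrt x)^-1 ^+ 2 = x^-1.
  by move=> x0; rewrite exprVn sqr_sqrtr// ltW.
rewrite normrX ger0_norm ?invr_ge0 ?sqrtr_ge0// E//.
apply: (@le_trans _ _ ((Num.sqrt (quart p))^-1 ^+ 2)).
  by rewrite E// lef_pV2 ?posrE// offunD lerDl offunX// sqr_ge0.
have C0 : 0 <= C by exact: le_trans sC.
by rewrite ler_sqr ?nnegrE ?invr_ge0 ?sqrtr_ge0// (le_trans (ler_norm _) sC).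
Qed.

Lemma om_bounded i : bounded_on_set K (@om R n i).
Proof.
exists 1 => p Kp; have [p0|p0] := eqVneq p.1 0.
  by rewrite offun_axis// normr0.
have E : \sum_j om j p ^+ 2 = 1.
  rewrite -(offun1 p0) -sum_om2 offun_sum; apply: eq_bigr => j _.
  by rewrite offunX.
rewrite -(@expr_le1 _ 2)// real_normK ?num_real// -E (bigD1 i)//= lerDl.
by apply: sumr_ge0 => j _; exact: sqr_ge0.
Qed.

Lemma r_bounded : bounded_on_set K (@r R n).
Proof.
have [C HC] : bounded_on_set K (fun p => Num.sqrt (\sum_i p.1 0 i ^+ 2)).
  apply: bounded_continuous_at => p _; apply: continuous_comp.
    by apply: continuous_sum_fun => i; apply: continuous_sqr; exact: continuous_xcoord.
  exact: sqrt_continuous.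
exists C => p Kp; have [p0|p0] := eqVneq p.1 0.
  by rewrite offun_axis// normr0 (le_trans _ (HC p Kp)).
have := HC p Kp; rewrite -asqE// -r2 offunX// sqrtr_sqr.
by rewrite normr_id.
Qed.

Local Notation x := (@xi R n).
Local Notation t := (@tau R n).
Local Notation r := (@r R n).
Local Notation om := (@om R n).
Local Notation sginv := (@sginv R n).
Local Notation asq := (@asq R n).
Local Notation quart := (@quart R n).
Local Notation pd i := (@partial R n (Some i)).
Local Notation T := (@partial R n None).
Local Notation rad := (@rad R n).
Local Notation del := (@del R n).

Let dP d : derivation (@partial R n d). Proof. exact: derivation_partial. Qed.
Let dR : derivation rad. Proof. exact: derivation_rad. Qed.

Lemma rad_quart : rad quart = 4 * asq ^+ 2.
Proof.
rewrite quart_def (derD dR) (derM dR) !(derX2 dR) rad_asq rad_tau (der_nat dR).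
by ring.
Qed.

Lemma T_quart : T quart = 8 * t.
Proof.
rewrite quart_def (derD (dP _)) (derM (dP _)) !(derX2 (dP _)) T_asq T_tau.
by rewrite (der_nat (dP _)); ring.
Qed.

Lemma rad_sginv : rad sginv = - 2 * asq ^+ 2 * sginv ^+ 3.
Proof.
rewrite (der_sginv dR) rad_quart.
rewrite (_ : _ * _ = - 2 * (kst 2^-1 * 2) * asq ^+ 2 * sginv ^+ 3); last by ring.
by rewrite half2 mulr1.
Qed.

Lemma T_sginv : T sginv = - 4 * t * sginv ^+ 3.
Proof.
rewrite (der_sginv (dP _)) T_quart.
rewrite (_ : _ * _ = - 4 * (kst 2^-1 * 2) * t * sginv ^+ 3); last by ring.
by rewrite half2 mulr1.
Qed.

Lemma r_pd i f : r * pd i f = del i f + om i * rad f.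
Proof. by rewrite !del_def; ring. Qed.

Lemma tame_bounded f : tame f -> bounded_on_set K f.
Proof.
apply: gen_bounded => g [i||||| {}g sg].
- exact: om_bounded.
- exact: r_bounded.
- exact: tau_bounded.
- exact: sginv_bounded.
- exact: hh_bounded.
- exact: extends_bounded.
Qed.

Lemma smoothly_bounded f : smoothly f -> bounded_on_set K f.
Proof.
apply: gen_bounded => g [i||| {}g sg].
- exact: xi_bounded.
- exact: tau_bounded.
- exact: sginv_bounded.
- exact: extends_bounded.
Qed.

Lemma tame_asq : tame asq. Proof. by rewrite -r2; gen_tac. Qed.
Lemma tame_quart : tame quart.
Proof. by rewrite quart_def -r2; gen_tac. Qed.

Lemma tame_T f : tame f -> tame (T f).
Proof.
apply: gen_der => // g [i||||| {}g sg].
- by rewrite T_om; gen_tac.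
- by rewrite T_r; gen_tac.
- by rewrite T_tau; gen_tac.
- by rewrite T_sginv; gen_tac.
- rewrite der_hh// (derD (dP _)) T_quart (derX2 (dP _)) T_asq.
  by have := tame_asq; gen_tac.
- exact/tame_jet/extends_partial.
Qed.

(** [pd i] alone leaves the class, since the derivatives of [om] grow like 1 / |x|; the factor [r]
    compensates exactly this growth. *)
Lemma tame_rpd i f : tame f -> tame (r * pd i f).
Proof.
apply: (gen_der (derivation_scale _ (dP _))) => g [j||||| {}g sg].
- by rewrite r_pd del_om rad_om; gen_tac.
- by rewrite r_pd del_r rad_r; gen_tac.
- by rewrite r_pd del_tau rad_tau; gen_tac.
- by rewrite r_pd del_sginv rad_sginv; have := tame_asq; gen_tac.
- rewrite r_pd del_hh der_hh// (derD dR) rad_quart (derX2 dR) rad_asq.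
  by have := tame_asq; gen_tac.
- have := tame_jet (extends_partial (Some i) sg); gen_tac.
Qed.

Lemma rad_rpd f : rad f = \sum_i om i * (r * pd i f).
Proof.
rewrite !rad_def; apply: eq_bigr => i _; rewrite om_def.
by ring: (@r_rinv R n).
Qed.

Lemma tame_rad f : tame f -> tame (rad f).
Proof.
by move=> tf; rewrite rad_rpd; apply: gen_sum => i; have := tame_rpd i tf; gen_tac.
Qed.

Lemma tame_del i f : tame f -> tame (del i f).
Proof.
move=> tf; rewrite !del_def; have := tame_rpd i tf; have := tame_rad tf; gen_tac.
Qed.

Lemma smoothly_partial d f : smoothly f -> smoothly (partial d f).
Proof.
have sa : smoothly asq by rewrite asq_def; gen_tac.
have sda : smoothly (partial d asq).
  rewrite asq_def (der_sum (dP _)); apply: gen_sum => i.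
  by rewrite (derX2 (dP _)) partial_xi; gen_tac.
have sq : smoothly (partial d quart).
  rewrite quart_def (derD (dP _)) (derX2 (dP _)) (derM (dP _)) (der_nat (dP _)).
  by rewrite [partial d (t ^+ 2)](derX2 (dP _)) partial_tau; gen_tac.
apply: gen_der => // g [i||| {}g sg].
- by rewrite partial_xi; gen_tac.
- by rewrite partial_tau; gen_tac.
- by rewrite der_sginv//; gen_tac.
- exact/smoothly_jet/extends_partial.
Qed.

Lemma nullG_smoothly d f : smoothly f -> supported K f -> nullG (partial d f).
Proof.
move=> sf Kf; apply: (nullG_partial n2 closedK KN Kf).
exact/smoothly_bounded/smoothly_partial.
Qed.

Lemma nullG_T f : tame f -> supported K f -> nullG (T f).
Proof.
move=> sf Kf; apply: (nullG_partial n2 closedK KN Kf).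
exact/tame_bounded/tame_T.
Qed.

Lemma nullG_rpd i f : tame f -> supported K f -> nullG (r * pd i f + om i * f).
Proof.
move=> tf Kf; have -> : r * pd i f + om i * f = pd i (r * f).
  by rewrite (derM (dP _)) pd_r addrC.
apply: (nullG_partial n2 closedK KN); first exact: supp_inMr.
apply: tame_bounded; rewrite (derM (dP _)) pd_r.
by have := tame_rpd i tf; gen_tac.
Qed.

Lemma nullG_rad f : tame f -> supported K f -> nullG (rad f + n%:R * f).
Proof.
move=> tf Kf.
have -> : rad f + n%:R * f = \sum_i (r * pd i (om i * f) + om i * (om i * f)).
  have E i : r * pd i (om i * f) + om i * (om i * f) = om i * (r * pd i f) + f.
    have E := r_pd i (om i); rewrite del_om rad_om eqxx mulr1n in E.
    rewrite (derM (dP _)) mulrDr mulrA E; ring.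
  rewrite (eq_bigr _ (fun i _ => E i)) big_split/= -rad_rpd sumr_const card_ord.
  by rewrite mulr_natl.
apply: nullG_sum => i; apply: nullG_rpd; last exact: supp_inMr.
by gen_tac.
Qed.

(** The adjoint of [del i] is - [del i] + (n - 1) [om i]. The extra term is the mean curvature of
    the sphere of directions; it disappears on tangential fields ([div_del_tangential]). *)
Lemma nullG_del i f : tame f -> supported K f ->
  nullG (del i f - (n%:R - 1) * om i * f).
Proof.
move=> tf Kf.
have -> : del i f - (n%:R - 1) * om i * f =
    (r * pd i f + om i * f) + - (rad (om i * f) + n%:R * (om i * f)).
  by rewrite (derM dR) rad_om !del_def; ring.
apply: nullGD; first exact: nullG_rpd.
apply/nullGN/nullG_rad; last exact: supp_inMr.
by gen_tac.
Qed.

(** The divergence of the dilation field is the homogeneous dimension n + 2. *)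
Lemma nullG_dil f : tame f -> supported K f -> nullG (dil f + (n%:R + 2) * f).
Proof.
move=> tf Kf; have -> : dil f + (n%:R + 2) * f = (rad f + n%:R * f) + T (2 * t * f).
  rewrite !dil_def !(derM (dP _)) T_tau (der_nat (dP _)); ring.
apply: nullGD; first exact: nullG_rad.
apply: nullG_T; last exact: supp_inMr.
by gen_tac.
Qed.

(** The coefficient 2nt / |x|^2 is the divergence of [rot] relative to the measure |x|^2 rho^-6 dx
    dt. The factor [asq] of the weight cancels the [rinv ^+ 2] in [rot], which leaves the fields
    [rad] and [T] acting on tame functions. *)
Lemma nullG_rot f : tame f -> supported K f ->
  nullG (asq * sginv ^+ 3 * (rot f + n%:R * (2 * t * rinv ^+ 2) * f)).
Proof.
move=> tf Kf.
have -> : asq * sginv ^+ 3 * (rot f + n%:R * (2 * t * rinv ^+ 2) * f) =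
    (rad (2 * t * sginv ^+ 3 * f) + n%:R * (2 * t * sginv ^+ 3 * f)) -
    T (asq ^+ 2 * sginv ^+ 3 * f).
  rewrite !(derM dR) !(derM (dP _)) (der_nat dR).
  rewrite rad_tau T_asq rad_sginv T_sginv rot_def.
  have ra := @rinv_asq R n.
  by ring: ra.
apply: nullGD.
  apply: nullG_rad; last exact: supp_inMr.
  by gen_tac.
apply/nullGN/nullG_T; last exact: supp_inMr.
by have := tame_asq; gen_tac.
Qed.

End tame.

(** * The inequality on the gauge spheres *)

Section spherical_algebra.
Context {R : realType}.

(* In [spherical_ineq], [y1], [y2], [k], [kB] are the values of [rot u],
   [rot (rot u)], [lap u], [rot (lap u)], while [G0], [GH], [H0] are those of
   |del u|^2, del u . del (rot u), |del (rot u)|^2. The last three terms are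
   divergences, and [k ^+ 2 - (n - 1) * G0] is nonnegative up to a divergence by
   Bochner's formula. *)
Lemma spherical_identity (n a t y1 y2 k kB G0 GH H0 : R) : 0 < a -> 1 < n ->
  let q := a ^+ 2 + 4 * t ^+ 2 in
  let h := (q + a ^+ 2)^-1 in
  let z := (n + 1) / (n - 1) in
  let ct := 2 * t / a in
  let F := - 4 * (n + 1) * t * a * h * y1 ^+ 2 + 8 * z * q * h * k * y1
           - 8 * z * t * q * h / a * G0 in
  let BF := - 4 * (n + 1) * ((- a * a + t * (4 * t)) * h
              - t * a * h ^+ 2 * (8 * a * t)) * y1 ^+ 2
          - 8 * (n + 1) * t * a * h * y1 * y2
          + 8 * z * q * (- h ^+ 2 * (8 * a * t) * k * y1 + h * kB * y1 + h * k * y2)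
          - 8 * z * q * ((- a * h - t * h ^+ 2 * (8 * a * t)) / a
             - t * h * (4 * t) / a ^+ 2) * G0
          - 16 * z * t * q * h / a * GH in
  (- y2 - n * ct * y1 + k * q / a ^+ 2) ^+ 2
    - (n + 1) * (y1 ^+ 2 + G0 * q / a ^+ 2) =
  (y2 + (n * ct - 2 * (n + 1) * t * a * h) * y1
     + (2 * z * q * h - q / a ^+ 2) * k) ^+ 2
  + 4 * z * (n - 3) * t ^+ 2 * q * h ^+ 2 / ((n - 1) * a ^+ 2)
    * (2 * t * k - (n - 1) * a * y1) ^+ 2
  + 4 * z * q * h * (H0 - 2 * ct * GH + ct ^+ 2 * G0)
  + 4 * z * ((n - 3) * (1 - 4 * t ^+ 4 / q ^+ 2) + 8 * t ^+ 2 / q) * q ^+ 3 * h ^+ 2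
    / ((n - 1) * a ^+ 2) * (k ^+ 2 - (n - 1) * G0)
  - 2^-1 * (BF + n * ct * F)
  - 4 * z * q * h * (H0 - y1 * kB)
  + 8 * z * t * q * h / a * (GH - y1 * k).
Proof.
move=> a0 n1 q h z ct F BF; rewrite /BF /F /ct /z /h.
have q0 : q != 0.
  by apply: lt0r_neq0; rewrite /q ltr_pwDl ?exprn_gt0// mulr_ge0// sqr_ge0.
have qa0 : q + a ^+ 2 != 0.
  apply: lt0r_neq0; rewrite addr_gt0 ?exprn_gt0// /q ltr_pwDl ?exprn_gt0//.
  by rewrite mulr_ge0// sqr_ge0.
have a1 : a != 0 by rewrite gt_eqF.
have n1' : n - 1 != 0 by rewrite subr_eq0 gt_eqF.
rewrite /q in q0 qa0 *.
field.
by rewrite a1 n1' q0 qa0.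
Qed.

(** [spherical_identity] times the weight, with w = rho^-2 and H2 the contracted square of second
    derivatives. Bochner's formula enters through the decomposition of k^2 - (n - 1) G0 as (n - 1) /
    (n - 2) times k^2 - H2 - (n - 2) G0, a divergence, plus ((n - 1) H2 - k^2) / (n - 2),
    nonnegative by the trace inequality. The condition 3 <= n makes the coefficients with n - 3
    nonnegative. *)
Lemma spherical_bound (n a t w y1 y2 k kB G0 GH H0 H2 : R) :
  0 < a -> 3 <= n -> 0 < w -> w ^+ 2 * (a ^+ 2 + 4 * t ^+ 2) = 1 ->
  k ^+ 2 <= (n - 1) * H2 ->
  0 <= H0 - 2 * (2 * t / a) * GH + (2 * t / a) ^+ 2 * G0 ->
  let q := a ^+ 2 + 4 * t ^+ 2 in
  let h := (q + a ^+ 2)^-1 in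
  let z := (n + 1) / (n - 1) in
  let ct := 2 * t / a in
  let F := - 4 * (n + 1) * t * a * h * y1 ^+ 2 + 8 * z * q * h * k * y1
           - 8 * z * t * q * h / a * G0 in
  let BF := - 4 * (n + 1) * ((- a * a + t * (4 * t)) * h
              - t * a * h ^+ 2 * (8 * a * t)) * y1 ^+ 2
          - 8 * (n + 1) * t * a * h * y1 * y2
          + 8 * z * q * (- h ^+ 2 * (8 * a * t) * k * y1 + h * kB * y1 + h * k * y2)
          - 8 * z * q * ((- a * h - t * h ^+ 2 * (8 * a * t)) / a
             - t * h * (4 * t) / a ^+ 2) * G0
          - 16 * z * t * q * h / a * GH in
  let kap := w * (4 * z / (n - 1)) *
    ((n - 3) * (1 - 4 * t ^+ 4 * w ^+ 4) + 8 * t ^+ 2 * w ^+ 2) * q ^+ 2 * h ^+ 2 in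
  (- 2^-1 * (a * w ^+ 3 * (BF + n * ct * F))
  - 4 * z * q * h * w ^+ 3 * a * (H0 - y1 * kB)
  + 8 * z * t * q * h * w ^+ 3 * (GH - y1 * k)
  + (n - 1) / (n - 2) * (kap / a * (k ^+ 2 - H2 - (n - 2) * G0)) <=
  a * w ^+ 3 * ((- y2 - n * ct * y1 + k * q / a ^+ 2) ^+ 2
    - (n + 1) * (y1 ^+ 2 + G0 * q / a ^+ 2)) : Prop).
Proof.
move=> a0 n3 w0 wq kH S0 q h z ct F BF kap.
have n1 : 1 < n by lra.
rewrite (spherical_identity t y1 y2 k kB G0 GH H0 a0 n1); cbv zeta.
rewrite -/q -/h -/z -/ct -/F -/BF.
have q0 : 0 < q by rewrite /q ltr_pwDl ?exprn_gt0// mulr_ge0// sqr_ge0.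
have h0 : 0 < h by rewrite invr_gt0 addr_gt0// exprn_gt0.
have z0 : 0 < z by rewrite divr_gt0//; lra.
have w2 : w ^+ 2 = q^-1 by rewrite -[RHS]mul1r -wq mulfK// gt_eqF.
have w4 : w ^+ 4 = q ^- 2 by rewrite (exprM w 2 2) w2 exprVn.
set D := 4 * z * ((n - 3) * (1 - 4 * t ^+ 4 / q ^+ 2) + 8 * t ^+ 2 / q)
  * q ^+ 3 * h ^+ 2 / ((n - 1) * a ^+ 2).
have tq : 4 * t ^+ 4 / q ^+ 2 <= 1.
  rewrite ler_pdivrMr ?exprn_gt0// mul1r /q.
  have := sqr_ge0 (a ^+ 2); have := sqr_ge0 (t ^+ 2).
  have := mulr_ge0 (sqr_ge0 a) (sqr_ge0 t).
  move=> H1 H2' H3; rewrite -subr_ge0.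
  rewrite (_ : _ - _ = (a ^+ 2) ^+ 2 + 8 * (a ^+ 2 * t ^+ 2) + 12 * (t ^+ 2) ^+ 2).
    lra.
  ring.
have D1 : 0 <= (n - 3) * (1 - 4 * t ^+ 4 / q ^+ 2) + 8 * t ^+ 2 / q.
  have t0 : 0 <= 8 * t ^+ 2 / q by rewrite divr_ge0 ?(ltW q0)// mulr_ge0// sqr_ge0.
  by apply: addr_ge0 => //; apply: mulr_ge0; lra.
have D0 : 0 <= D.
  have z40 : 0 <= 4 * z by apply: mulr_ge0 => //; exact: ltW.
  apply: divr_ge0; last by apply: mulr_ge0; [lra|exact: sqr_ge0].
  apply: mulr_ge0; last exact: sqr_ge0.
  apply: mulr_ge0; last by rewrite exprn_ge0// ltW.
  exact: mulr_ge0.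
have kapE : kap / a = a * w ^+ 3 * D.
  rewrite /kap /D w4 w2.
  have -> : w ^+ 3 = w * q^-1 by rewrite -w2; ring.
  by field; rewrite !gt_eqF//; lra.
rewrite kapE -subr_ge0.
have E2 : 0 <= D * (k ^+ 2 - (n - 1) * G0)
    - (n - 1) / (n - 2) * (D * (k ^+ 2 - H2 - (n - 2) * G0)).
  rewrite (_ : _ - _ = D / (n - 2) * ((n - 1) * H2 - k ^+ 2)); last first.
    by field; rewrite gt_eqF//; lra.
  rewrite mulr_ge0 ?subr_ge0// divr_ge0//; lra.
rewrite [X in 0 <= X](_ : _ = a * w ^+ 3 * (
  (y2 + (n * ct - 2 * (n + 1) * t * a * h) * y1
     + (2 * z * q * h - q / a ^+ 2) * k) ^+ 2
  + 4 * z * (n - 3) * t ^+ 2 * q * h ^+ 2 / ((n - 1) * a ^+ 2)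
    * (2 * t * k - (n - 1) * a * y1) ^+ 2
  + 4 * z * q * h * (H0 - 2 * ct * GH + ct ^+ 2 * G0)
  + (D * (k ^+ 2 - (n - 1) * G0)
    - (n - 1) / (n - 2) * (D * (k ^+ 2 - H2 - (n - 2) * G0))))); last first.
  move: D {D0 kapE E2} BF F => D BF F.
  by field; rewrite !gt_eqF//; lra.
rewrite mulr_ge0//; first by rewrite mulr_ge0 ?exprn_ge0// ltW.
apply: addr_ge0; last exact: E2.
apply: addr_ge0; last first.
  apply: mulr_ge0; last exact: S0.
  apply: mulr_ge0; last exact: ltW.
  apply: mulr_ge0; last exact: ltW.
  by apply: mulr_ge0 => //; exact: ltW.
apply: addr_ge0; first exact: sqr_ge0.
apply: mulr_ge0; last exact: sqr_ge0.
apply: divr_ge0; last by apply: mulr_ge0; [lra|exact: sqr_ge0].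
apply: mulr_ge0; last exact: sqr_ge0.
apply: mulr_ge0; last exact: ltW.
apply: mulr_ge0; last exact: sqr_ge0.
apply: mulr_ge0; last by lra.
by apply: mulr_ge0 => //; exact: ltW.
Qed.
End spherical_algebra.

Section hessian.
Context {R : realType} {n : nat}.
Implicit Types (om g : 'I_n -> R) (H : 'I_n -> 'I_n -> R).

Lemma sum_delta_mul (F : 'I_n -> R) i : \sum_j (i == j)%:R * F j = F i.
Proof.
rewrite (bigD1 i)//= eqxx mul1r big1 ?addr0// => j ji.
by rewrite eq_sym (negbTE ji) mul0r.
Qed.

(* With [H i j] the derivative along [j] of the [i]-th component of the
   spherical gradient [g], the matrix [H i j + om i * g j] is the (symmetric,
   tangential) covariant Hessian; the claim is that its traceless part has
   nonnegative square. *)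
Lemma trace_sqr_le om g H : (1 < n)%N ->
  \sum_i om i ^+ 2 = 1 -> \sum_i om i * g i = 0 ->
  (forall i, \sum_j om j * H i j = 0) ->
  (forall j, \sum_i om i * H i j = - g j) ->
  (forall i j, H j i = H i j + (om i * g j - om j * g i)) ->
  (\sum_i H i i) ^+ 2 <= (n%:R - 1) * \sum_i \sum_j H i j * H j i.
Proof.
move=> n1 om2 og Hr Hl Hs; set tr := \sum_i H i i.
have n1' : 0 < n%:R - 1 :> R by rewrite subr_gt0 ltr1n.
(* [th] times the tangential projection (i == j) - om i * om j is the pure trace part of the
   Hessian, as the tangent space has dimension n - 1. *)
have [th thE] : exists th, th = tr / (n%:R - 1) by exists (tr / (n%:R - 1)).
have S0 : 0 <= \sum_i \sum_j
    (H i j + om i * g j - th * ((i == j)%:R - om i * om j)) ^+ 2.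
  by apply: sumr_ge0 => i _; apply: sumr_ge0 => j _; exact: sqr_ge0.
pose G := \sum_j g j ^+ 2.
pose HH := \sum_i \sum_j H i j ^+ 2.
have E1 : \sum_i \sum_j H i j * H j i = HH - G.
  have -> : \sum_i \sum_j H i j * H j i = HH + \sum_i \sum_j
      (om i * H i j * g j - g i * (om j * H i j)).
    rewrite -big_split; apply: eq_bigr => i _; rewrite -big_split.
    by apply: eq_bigr => j _; rewrite (Hs i j) /=; ring.
  congr (_ + _).
  under eq_bigr do rewrite sumrB -mulr_sumr Hr mulr0 subr0.
  rewrite exchange_big/= /G -sumrN; apply: eq_bigr => j _.
  by rewrite -mulr_suml Hl; ring.
have E2 : \sum_i \sum_j
    (H i j + om i * g j - th * ((i == j)%:R - om i * om j)) ^+ 2 =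
    HH - G - 2 * th * tr + th ^+ 2 * (n%:R - 1).
  have -> : \sum_i \sum_j
      (H i j + om i * g j - th * ((i == j)%:R - om i * om j)) ^+ 2 =
      HH + \sum_i (\sum_j om i ^+ 2 * g j ^+ 2
        + 2 * (\sum_j om i * H i j * g j)
        - 2 * th * (\sum_j (i == j)%:R * H i j)
        + 2 * th * om i * (\sum_j om j * H i j)
        - 2 * th * om i * (\sum_j (i == j)%:R * g j)
        + 2 * th * om i ^+ 2 * (\sum_j om j * g j)
        + th ^+ 2 * (\sum_j (i == j)%:R * (1 - 2 * om i * om j))
        + th ^+ 2 * om i ^+ 2 * (\sum_j om j ^+ 2)).
    rewrite -big_split; apply: eq_bigr => i _ /=.
    rewrite !mulr_sumr -!sumrN -!big_split; apply: eq_bigr => j _ /=.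
    case: eqP => _ /=; ring.
  have -> : \sum_i (\sum_j om i ^+ 2 * g j ^+ 2
        + 2 * (\sum_j om i * H i j * g j)
        - 2 * th * (\sum_j (i == j)%:R * H i j)
        + 2 * th * om i * (\sum_j om j * H i j)
        - 2 * th * om i * (\sum_j (i == j)%:R * g j)
        + 2 * th * om i ^+ 2 * (\sum_j om j * g j)
        + th ^+ 2 * (\sum_j (i == j)%:R * (1 - 2 * om i * om j))
        + th ^+ 2 * om i ^+ 2 * (\sum_j om j ^+ 2)) =
      \sum_i (om i ^+ 2 * G + 2 * (\sum_j om i * H i j * g j)
        - 2 * th * H i i - 2 * th * (om i * g i)
        + th ^+ 2 - th ^+ 2 * om i ^+ 2).
    apply: eq_bigr => i _; rewrite !sum_delta_mul Hr og om2 -mulr_sumr -/G.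
    by ring.
  rewrite !big_split/= !sumrN -!mulr_sumr -mulr_suml om2 og exchange_big/=.
  have -> : \sum_j \sum_i om i * H i j * g j = - G.
    rewrite /G -sumrN; apply: eq_bigr => j _.
    by rewrite -mulr_suml Hl; ring.
  by rewrite sumr_const card_ord -mulr_natl /tr; ring.
move: S0; rewrite E2 E1 thE => S0.
have -> : tr ^+ 2 = (n%:R - 1) * (HH - G) - (n%:R - 1) * (HH - G
    - 2 * (tr / (n%:R - 1)) * tr + (tr / (n%:R - 1)) ^+ 2 * (n%:R - 1)).
  by field; rewrite gt_eqF.
by rewrite gerBl mulr_ge0// ltW.
Qed.

End hessian.

Section spherical.
Context {R : realType} {n : nat}.
Local Notation offun := (@offun R n).
Local Notation pt := ('rV[R]_n * R)%type.
Local Notation t := (@tau R n).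
Local Notation r := (@r R n).
Local Notation rinv := (@rinv R n).
Local Notation om := (@om R n).
Local Notation sginv := (@sginv R n).
Local Notation hh := (@hh R n).
Local Notation asq := (@asq R n).
Local Notation quart := (@quart R n).
Local Notation pd i := (@partial R n (Some i)).
Local Notation T := (@partial R n None).
Local Notation rad := (@rad R n).
Local Notation del := (@del R n).
Local Notation dil := (@dil R n).
Local Notation rot := (@rot R n).
Implicit Types (f g u v : offun) (p : pt).

Variables (K : set pt) (N : R).
Hypotheses (n3 : (3 <= n)%N) (cptK : compact K) (KN : K `<=` in_box N)
  (K0 : ~ K (0, 0)).

Let n2 : (2 <= n)%N. Proof. exact: ltnW. Qed.
Let ddel i : derivation (del i). Proof. exact: derivation_del. Qed.
Let dB : derivation rot. Proof. exact: derivation_rot. Qed.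

Lemma supp_partial d f : supported K f -> supported K (partial d f).
Proof. exact: supported_partial (closedK cptK). Qed.
Lemma supp_rad f : supported K f -> supported K (rad f).
Proof.
move=> Kf; rewrite rad_def; apply: supp_in_sum => i.
by apply: supp_inMr; exact: supp_partial.
Qed.
Lemma supp_del i f : supported K f -> supported K (del i f).
Proof.
move=> Kf; rewrite del_def; apply: supp_inD; first exact/supp_inMr/supp_partial.
exact/supp_inN/supp_inMr/supp_rad.
Qed.
Lemma supp_rot f : supported K f -> supported K (rot f).
Proof.
move=> Kf; rewrite rot_def; apply: supp_inD; first exact/supp_inMr/supp_rad.
exact/supp_inN/supp_inMr/supp_partial.
Qed.
Lemma supp_dil f : supported K f -> supported K (dil f).
Proof.
move=> Kf; rewrite dil_def.
by apply: supp_inD; [exact: supp_rad|exact/supp_inMr/supp_partial].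
Qed.

Lemma nullG_div_del (V : 'I_n -> offun) :
  (forall i, tame (V i)) -> (forall i, supported K (V i)) ->
  nullG (\sum_i (del i (V i) - (n%:R - 1) * om i * V i)).
Proof.
move=> tV KV; apply: nullG_sum => i.
exact: (nullG_del n2 cptK KN K0).
Qed.

Section on_function.
Variables (u : offun).
Hypotheses (su : extends_smoothly u) (Ku : supported K u).

(* On functions that are smooth across the axis, [del i] and [lap] are r times,
   and [rot] is 1 / r times, one of the following bounded functions. *)
Definition del_reg i u : offun := pd i u - om i * \sum_j om j * pd j u.
Definition rot_reg u : offun := 2 * t * (\sum_j om j * pd j u) - r ^+ 3 * T u.
Definition lap u : offun := - \sum_i del i (del i u).
Definition lap_reg u : offun := - \sum_i del i (del_reg i u).

Lemma del_regE i : del i u = r * del_reg i u.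
Proof. by rewrite !del_def /del_reg sum_om_pd; ring: (@r_rinv R n). Qed.

Lemma rot_regE : rot u = rinv * rot_reg u.
Proof.
rewrite !rot_def /rot_reg sum_om_pd -r2.
by ring: (@r_rinv R n).
Qed.

Lemma r_rot_reg : r * rot u = rot_reg u.
Proof. by rewrite rot_regE mulrA r_rinv mul1r. Qed.

Lemma lap_regE : lap u = r * lap_reg u.
Proof.
rewrite /lap /lap_reg mulrN; congr (- _); rewrite mulr_sumr.
by apply: eq_bigr => i _; rewrite del_regE (derM (ddel i)) del_r; ring.
Qed.

Lemma tame_pd d : tame (partial d u). Proof. exact/tame_jet/extends_partial. Qed.
Lemma tame_del_reg i : tame (del_reg i u).
Proof. by have := tame_pd; rewrite /del_reg; gen_tac; exact: tame_pd. Qed.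
Lemma tame_rot_reg : tame (rot_reg u).
Proof. by rewrite /rot_reg; gen_tac; exact: tame_pd. Qed.
Lemma tame_lap_reg : tame (lap_reg u).
Proof. by rewrite /lap_reg; gen_tac; apply: tame_del; exact: tame_del_reg. Qed.

Lemma supp_del_reg i : supported K (del_reg i u).
Proof.
apply: supp_inD; first exact: supp_partial.
by apply/supp_inN/supp_inMr/supp_in_sum => j; exact/supp_inMr/supp_partial.
Qed.
Lemma supp_rot_reg : supported K (rot_reg u).
Proof. by rewrite -r_rot_reg; exact/supp_inMr/supp_rot. Qed.
Lemma supp_lap_reg : supported K (lap_reg u).
Proof.
by apply/supp_inN/supp_in_sum => i; exact/supp_del/supp_del_reg.
Qed.

Let z : offun := kst ((n%:R + 1) / (n%:R - 1)).
Let G0 : offun := \sum_i del i u ^+ 2.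
Let GH : offun := \sum_i del i u * del i (rot u).
Let H0 : offun := \sum_i del i (rot u) ^+ 2.

(* The divergences of [spherical_identity]; [null4] is Bochner's formula. *)
Definition field1 : offun :=
  - 4 * (n%:R + 1) * t * asq * hh * rot u ^+ 2 + 8 * z * quart * hh * lap u * rot u
  - 8 * z * t * quart * hh * rinv ^+ 2 * G0.

(** The singular factors compensate in each term: [asq] against two factors [rot u], the 1 / r in
    [rot u] against the r in [lap u], and [rinv ^+ 2] against |del u|^2. *)
Lemma field1_tame : tame field1 /\ supported K field1.
Proof.
have -> : field1 = - 4 * (n%:R + 1) * t * hh * rot_reg u ^+ 2
    + 8 * z * quart * hh * lap_reg u * rot_reg u
    - 8 * z * t * quart * hh * \sum_i del_reg i u ^+ 2.
  have -> : \sum_i del_reg i u ^+ 2 = rinv ^+ 2 * G0.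
    rewrite /G0 mulr_sumr; apply: eq_bigr => i _; rewrite del_regE.
    by ring: (@r_rinv R n).
  by rewrite /field1 lap_regE rot_regE -r2; ring: (@r_rinv R n).
have tq := @tame_quart R n; have t1 := tame_rot_reg; have t2 := tame_lap_reg.
have t3 i := tame_del_reg i.
split; first by gen_tac; exact: t3.
apply: supp_inD; last first.
  apply/supp_inN/supp_inMr/supp_in_sum => i.
  by rewrite expr2; apply: supp_inMr; exact: supp_del_reg.
apply: supp_inD; last exact/supp_inMr/supp_rot_reg.
by apply: supp_inMr; rewrite expr2; apply: supp_inMr; exact: supp_rot_reg.
Qed.

Definition null1 : offun :=
  asq * sginv ^+ 3 * (rot field1 + n%:R * (2 * t * rinv ^+ 2) * field1).

Lemma null1P : nullG null1.
Proof. by have [tf sf] := field1_tame; exact: (nullG_rot n2 cptK KN K0). Qed.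

Definition null2 : offun :=
  4 * z * quart * hh * sginv ^+ 3 * asq * (H0 - rot u * rot (lap u)).

Lemma rot_rinv : rot rinv = - 2 * t * rinv ^+ 3.
Proof.
rewrite der_rinv// rot_asq.
rewrite (_ : _ * _ = - 2 * (kst 2^-1 * 2) * t * rinv ^+ 3); last by ring.
by rewrite half2 mulr1.
Qed.

Lemma rot_lap : rot (lap u) = - \sum_i del i (del i (rot u)).
Proof.
rewrite /lap (derN dB) (der_sum dB); congr (- _); apply: eq_bigr => i _.
by rewrite !del_rot.
Qed.

Lemma sum_om_del_weight (w : offun) (v : offun) :
  \sum_i om i * (w * del i v) = 0.
Proof.
rewrite (eq_bigr (fun i => w * (om i * del i v))) => [|i _]; last by ring.
by rewrite -mulr_sumr sum_om_del mulr0.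
Qed.

Lemma div_del_tangential (V : 'I_n -> offun) : \sum_i om i * V i = 0 ->
  \sum_i (del i (V i) - (n%:R - 1) * om i * V i) = \sum_i del i (V i).
Proof.
move=> V0; rewrite sumrB.
rewrite [X in _ - X](eq_bigr (fun i => (n%:R - 1) * (om i * V i))); last first.
  by move=> i _; ring.
by rewrite -mulr_sumr V0 mulr0 subr0.
Qed.

(** Green's formula on the sphere of directions for [rot u]: the weight [w] depends on |x| and t
    only, hence is constant for [del i], and [rot] commutes with [lap]. *)
Lemma null2P : nullG null2.
Proof.
have [w wE] : exists w, w = 4 * z * quart * hh * sginv ^+ 3 by eexists.
pose V i := w * rot_reg u * del i (rot_reg u).
have tq := @tame_quart R n; have t1 := tame_rot_reg.
have tV i : tame (V i).
  by rewrite /V wE; have := tame_del i t1; gen_tac.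
have KV i : supported K (V i) by apply/supp_inMr/supp_del/supp_rot_reg.
have := nullG_div_del tV KV.
rewrite div_del_tangential; last exact: sum_om_del_weight.
suff -> : \sum_i del i (V i) = null2 by [].
have dw i : del i w = 0.
  rewrite wE !(derM (ddel i)) del_sginv del_hh del_quart (der_kst (ddel i)).
  by rewrite (der_nat (ddel i)); ring.
have E i : del i (V i) = w * asq *
    (del i (rot u) ^+ 2 + rot u * del i (del i (rot u))).
  have -> : V i = w * asq * (rot u * del i (rot u)).
    by rewrite /V -!r_rot_reg (derM (ddel i)) del_r -r2; ring.
  rewrite (derM (ddel i) (w * asq)) (derM (ddel i) w) dw del_asq.
  rewrite (derM (ddel i) (rot u)).
  move: (del i (rot u)) (del i (del i (rot u))) => X Y.
  by ring.
transitivity (w * asq * (H0 + rot u * \sum_i del i (del i (rot u)))).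
  rewrite mulr_sumr -big_split mulr_sumr; apply: eq_bigr => i _; exact: E.
by rewrite /null2 rot_lap wE; ring.
Qed.

Definition null3 : offun :=
  8 * z * t * quart * hh * sginv ^+ 3 * (GH - rot u * lap u).

Lemma null3P : nullG null3.
Proof.
have [w wE] : exists w, w = 8 * z * t * quart * hh * sginv ^+ 3 by eexists.
pose V i := w * rot_reg u * del_reg i u.
have tq := @tame_quart R n; have t1 := tame_rot_reg.
have tV i : tame (V i).
  by rewrite /V wE; have := tame_del_reg i; gen_tac.
have KV i : supported K (V i) by apply/supp_inMr/supp_del_reg.
have VE i : V i = w * rot u * del i u.
  by rewrite /V rot_regE del_regE; ring: (@r_rinv R n).
have := nullG_div_del tV KV.
rewrite div_del_tangential; last first.
  by rewrite (eq_bigr _ (fun i _ => congr1 (fun v => om i * v) (VE i)));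
    exact: sum_om_del_weight.
suff -> : \sum_i del i (V i) = null3 by [].
have dw i : del i w = 0.
  rewrite wE !(derM (ddel i)) del_sginv del_hh del_quart del_tau (der_kst (ddel i)).
  by rewrite (der_nat (ddel i)); ring.
have E i : del i (V i) = w * (del i u * del i (rot u) + rot u * del i (del i u)).
  rewrite VE (derM (ddel i) (w * rot u)) (derM (ddel i) w) dw.
  move: (del i (rot u)) (del i (del i u)) => X Y; move: (del i u) (rot u) => Z S.
  by ring.
transitivity (w * (GH + rot u * \sum_i del i (del i u))).
  rewrite mulr_sumr -big_split mulr_sumr; apply: eq_bigr => i _; exact: E.
by rewrite /null3 wE /lap; ring.
Qed.

Let nm3 : offun := kst (n%:R - 3).
(** [kap * rinv ^+ 2] is the weight times the coefficient of the Bochner term in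
    [spherical_identity]. Powers of [sginv] stand for the divisions by [quart], so that [kap] is
    visibly tame. *)
Let kap : offun := sginv * kst (4 * ((n%:R + 1) / (n%:R - 1)) / (n%:R - 1)) *
  (nm3 * (1 - 4 * t ^+ 4 * sginv ^+ 4) + 8 * t ^+ 2 * sginv ^+ 2) *
  quart ^+ 2 * hh ^+ 2.

Definition null4 : offun := kap * rinv ^+ 2 *
  (lap u ^+ 2 - \sum_i \sum_j del j (del i u) * del i (del j u)
   - (n%:R - 2) * G0).

Lemma tame_kap : tame kap.
Proof. by have tq := @tame_quart R n; rewrite /kap /nm3; gen_tac. Qed.

Lemma del_kap i : del i kap = 0.
Proof.
have d1 : del i (t ^+ 2) = 0 by rewrite (derX2 (ddel i)) del_tau mulr0.
have d2 : del i (t ^+ 4) = 0.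
  by rewrite (_ : t ^+ 4 = t ^+ 2 * t ^+ 2); [rewrite (derM (ddel i)) d1|]; ring.
have s1 : del i (sginv ^+ 2) = 0 by rewrite (derX2 (ddel i)) del_sginv mulr0.
have s2 : del i (sginv ^+ 4) = 0.
  by rewrite (_ : sginv ^+ 4 = sginv ^+ 2 * sginv ^+ 2);
    [rewrite (derM (ddel i)) s1|]; ring.
have h1 : del i (hh ^+ 2) = 0 by rewrite (derX2 (ddel i)) del_hh mulr0.
have q1 : del i (quart ^+ 2) = 0 by rewrite (derX2 (ddel i)) del_quart mulr0.
have k c : del i (kst c) = 0 by exact: der_kst.
have nn m : del i m%:R = 0 by exact: der_nat.
have one : del i 1 = 0 by exact: der1.
rewrite /kap; move: (t ^+ 2) (t ^+ 4) (sginv ^+ 2) (sginv ^+ 4) (hh ^+ 2) (quart ^+ 2)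
  d1 d2 s1 s2 h1 q1 => a b c d e f d1 d2 s1 s2 h1 q1.
rewrite !(derM (ddel i)) (derD (ddel i)) !(derM (ddel i)) (derD (ddel i)).
rewrite (derN (ddel i)) !(derM (ddel i)) d1 d2 s1 s2 h1 q1 !k !nn ?one del_sginv.
by ring.
Qed.

(** The derivative of the tangency relation [sum_om_del] along [del i]. *)
Lemma sum_om_del_del i : \sum_j om j * del i (del j u) = - del i u.
Proof.
have L (e f : 'I_n -> offun) :
    \sum_j (((i == j)%:R - om i * om j) * f j + om j * e j) =
    \sum_j om j * e j + (f i - om i * \sum_j om j * f j).
  transitivity (\sum_j (om j * e j + ((i == j)%:R * f j - om i * (om j * f j)))).
    by apply: eq_bigr => j _; ring.
  by rewrite big_split/= sumrB sum_delta -mulr_sumr.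
have E : \sum_j del i (om j * del j u) = 0.
  by rewrite -(der_sum (ddel i)) sum_om_del (der0 (ddel i)).
have E' : \sum_j del i (om j * del j u) =
    \sum_j (((i == j)%:R - om i * om j) * del j u + om j * del i (del j u)).
  by apply: eq_bigr => j _; rewrite (derM (ddel i) (om j)) del_om.
have := etrans (esym (L (fun j => del i (del j u)) (fun j => del j u)))
  (etrans (esym E') E).
move: (sum_om_del u) (\sum_j om j * del i (del j u)) => /= -> S.
by move/eqP; rewrite mulr0 subr0 addr_eq0 => /eqP.
Qed.

(** Difference of the divergences of - [lap u] times the gradient ([V1]) and of the Hessian applied
    to the gradient ([V2]). The terms with the gradient of [lap u] cancel. [V2] is not tangential,
    and its normal component gives (n - 1) |del u|^2; commuting derivatives gives - |del u|^2.
    Together they form the Ricci term n - 2 of the unit sphere in R^n. *)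
Lemma null4P : nullG null4.
Proof.
have tk := tame_kap.
pose V1 i := kap * del_reg i u * - lap_reg u.
pose V2 j := kap * \sum_i del_reg i u * del i (del_reg j u).
have tV1 i : tame (V1 i).
  by rewrite /V1; have := tame_del_reg i; have := tame_lap_reg; gen_tac.
have tV2 j : tame (V2 j).
  rewrite /V2; gen_tac; first exact: tame_del_reg.
  by apply: tame_del; exact: tame_del_reg.
have KV1 i : supported K (V1 i) by apply/supp_inMr/supp_inN/supp_lap_reg.
have KV2 j : supported K (V2 j).
  by apply/supp_inMr/supp_in_sum => i; exact/supp_inMr/supp_del/supp_del_reg.
have V1E i : V1 i = (kap * rinv ^+ 2) * - lap u * del i u.
  by rewrite /V1 lap_regE del_regE; ring: (@r_rinv R n).
have V2E j : V2 j = (kap * rinv ^+ 2) * \sum_i del i u * del i (del j u).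
  rewrite /V2 -[RHS]mulrA; congr (_ * _); rewrite mulr_sumr; apply: eq_bigr => i _.
  by rewrite !del_regE (derM (ddel i)) del_r; ring: (@r_rinv R n).
have dw i : del i (kap * rinv ^+ 2) = 0.
  by rewrite (derM (ddel i)) del_kap (derX2 (ddel i)) del_rinv; ring.
have N1 := nullG_div_del tV1 KV1.
have N2 := nullG_div_del tV2 KV2.
rewrite div_del_tangential in N1; last first.
  by rewrite (eq_bigr _ (fun i _ => congr1 (fun v => om i * v) (V1E i)));
    exact: sum_om_del_weight.
have omV2 : \sum_j om j * V2 j = - (kap * rinv ^+ 2 * G0).
  transitivity (\sum_j \sum_i (kap * rinv ^+ 2 * del i u) * (om j * del i (del j u))).
    apply: eq_bigr => j _; rewrite V2E mulrA mulr_sumr; apply: eq_bigr => i _.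
    by ring.
  rewrite exchange_big/= /G0 mulr_sumr -sumrN; apply: eq_bigr => i _.
  by rewrite -mulr_sumr sum_om_del_del; ring.
suff -> : null4 = \sum_i del i (V1 i) -
    \sum_j (del j (V2 j) - (n%:R - 1) * om j * V2 j).
  by apply: nullGD => //; exact: nullGN.
have -> : \sum_j (del j (V2 j) - (n%:R - 1) * om j * V2 j) =
    \sum_j del j (V2 j) + (n%:R - 1) * (kap * rinv ^+ 2 * G0).
  rewrite sumrB; congr (_ + _).
  rewrite (eq_bigr (fun j => (n%:R - 1) * (om j * V2 j))) => [|j _]; last by ring.
  by rewrite -mulr_sumr omV2; ring.
have E1 : \sum_i del i (V1 i) = kap * rinv ^+ 2 *
    (lap u ^+ 2 - \sum_i del i u * del i (lap u)).
  have -> : lap u ^+ 2 = \sum_i - lap u * del i (del i u).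
    by rewrite -mulr_sumr /lap; ring.
  rewrite -sumrB mulr_sumr; apply: eq_bigr => i _.
  by rewrite V1E (derM (ddel i)) (derM (ddel i)) dw (derN (ddel i)); ring.
have E2 : \sum_j del j (V2 j) = kap * rinv ^+ 2 *
    (\sum_i \sum_j del j (del i u) * del i (del j u)
     + \sum_i del i u * \sum_j del j (del i (del j u))).
  transitivity (\sum_j kap * rinv ^+ 2 * \sum_i
     (del j (del i u) * del i (del j u) + del i u * del j (del i (del j u)))).
    apply: eq_bigr => j _; rewrite V2E (derM (ddel j)) dw mul0r add0r.
    rewrite (der_sum (ddel j)); congr (_ * _); apply: eq_bigr => i _.
    by rewrite (derM (ddel j)).
  rewrite -mulr_sumr exchange_big/=; congr (_ * _).
  rewrite -big_split; apply: eq_bigr => i _ /=.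
  by rewrite big_split/= mulr_sumr.
have E3 : \sum_i del i u * \sum_j del j (del i (del j u)) =
    - (\sum_i del i u * del i (lap u)) - G0.
  transitivity (\sum_i (- (del i u * del i (lap u)) + om i * del i u * lap u
      - del i u ^+ 2)); last first.
    rewrite !big_split/= !sumrN -mulr_suml sum_om_del mul0r addr0.
    by [].
  apply: eq_bigr => i _.
  have -> : \sum_j del j (del i (del j u)) =
      \sum_j del i (del j (del j u)) - om i * (\sum_j del j (del j u))
      + \sum_j om j * del i (del j u).
    rewrite mulr_sumr -sumrB -big_split; apply: eq_bigr => j _ /=.
    have E := del_comm i j (del j u).
    have -> : del j (del i (del j u)) = del i (del j (del j u)) -
      (del i (del j (del j u)) - del j (del i (del j u))) by ring.
    by rewrite E; ring.
  by rewrite sum_om_del_del /lap (derN (ddel i)) (der_sum (ddel i)); ring.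
rewrite E1 E2 E3 /null4; ring.
Qed.

(* [ang] is the angular part of the Grushin operator (see [grushin_polar_form]) and
   [Gam] its carre du champ. *)
Definition ang u : offun :=
  - rot (rot u) - n%:R * (2 * t * rinv ^+ 2) * rot u
  + rinv ^+ 4 * quart * lap u.

Definition Gam u v : offun :=
  rot u * rot v + rinv ^+ 4 * quart * \sum_i del i u * del i v.

Lemma rot_hh : rot hh = - hh ^+ 2 * (8 * asq * t).
Proof.
rewrite (der_hh dB) (derD dB) (derX2 dB) rot_quart rot_asq; ring.
Qed.

(** Arranged as [BF] in [spherical_identity], with 1 / a read as [rinv ^+ 2], so that evaluation at
    a point yields its hypotheses and terms literally. *)
Lemma rot_field1 : rot field1 =
  - 4 * (n%:R + 1) * ((- asq * asq + t * (4 * t)) * hh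
      - t * asq * hh ^+ 2 * (8 * asq * t)) * rot u ^+ 2
  - 8 * (n%:R + 1) * t * asq * hh * rot u * rot (rot u)
  + 8 * z * quart * (- hh ^+ 2 * (8 * asq * t) * lap u * rot u
      + hh * rot (lap u) * rot u + hh * lap u * rot (rot u))
  - 8 * z * quart * ((- asq * hh - t * hh ^+ 2 * (8 * asq * t)) * rinv ^+ 2
      - t * hh * (4 * t) * rinv ^+ 4) * G0
  - 16 * z * t * quart * hh * rinv ^+ 2 * GH.
Proof.
have rG : rot G0 = 2 * GH.
  rewrite /G0 (der_sum dB) /GH mulr_sumr; apply: eq_bigr => i _.
  by rewrite (derX2 dB) del_rot mulrA.
have ru : rot (rot u ^+ 2) = 2 * rot u * rot (rot u) by rewrite (derX2 dB).
have rr : rot (rinv ^+ 2) = - 4 * t * rinv ^+ 4.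
  by rewrite (derX2 dB) rot_rinv; ring.
have zz : rot z = 0 by rewrite /z der_kst.
have nn : rot (n%:R + 1) = 0 by rewrite (derD dB) (der_nat dB) (der1 dB) addr0.
rewrite /field1; move: (rot u ^+ 2) ru (rinv ^+ 2) rr G0 GH rG z zz (n%:R + 1) nn.
move=> U ru W rr g0 gh rG Z zz M nn.
rewrite (derD dB) (derD dB) (derN dB) !(derM dB) (derN dB) !(der_nat dB).
rewrite zz nn ru rr rG rot_hh rot_quart rot_tau rot_asq.
by ring.
Qed.

(** After integration this is the spectral gap n + 1 of A. The form with [Z] avoids any claim on the
    integrability of the weighted square of [ang u], which may grow like |x|^-2 at the axis. *)
Lemma spherical_ineq : exists2 Z, nullG Z & forall p, p.1 != 0 ->
  Z p <= (asq * sginv ^+ 3 * (ang u ^+ 2 - (n%:R + 1) * Gam u u)) p.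
Proof.
exists (- kst 2^-1 * null1 - null2 + null3
    + kst ((n%:R - 1) / (n%:R - 2)) * null4).
  apply: nullGD; last exact/nullGZ/null4P.
  apply: nullGD; last exact: null3P.
  apply: nullGD; last exact/nullGN/null2P.
  by rewrite -kstN; exact/nullGZ/null1P.
move=> p p0.
have a0 := asq_gt0 p0; have w0 : 0 < sginv p by rewrite sginv_def invsqrt_gt0.
have qE : quart p = asq p ^+ 2 + 4 * t p ^+ 2 by rewrite quartE// tauE.
have evp (f g : offun) : f = g -> f p = g p by move=> ->.
have wq : sginv p ^+ 2 * (asq p ^+ 2 + 4 * t p ^+ 2) = 1.
  by have := evp _ _ (@sginv_quart R n); rewrite offunM offunX// offun1// qE.
have hE : hh p = (quart p + asq p ^+ 2)^-1.
  have := evp _ _ (@hhE R n); rewrite offunM offunD offunX// offun1//.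
  have qa0 : quart p + asq p ^+ 2 != 0.
    by rewrite gt_eqF// addr_gt0 ?quart_gt0// exprn_gt0.
  by move=> E; apply: (mulIf qa0); rewrite E mulVf.
have iE : rinv p ^+ 2 = (asq p)^-1.
  have := evp _ _ (@rinv_asq R n); rewrite offunM offunX// offun1// => E.
  by rewrite -[RHS]mul1r -E mulfK// gt_eqF.
have iE4 : rinv p ^+ 4 = (asq p) ^- 2 by rewrite (exprM _ 2 2) iE exprVn.
have nR3 : 3 <= n%:R :> R by rewrite (ler_nat R 3 n).
pose h i := del i (rot u) p; pose g i := del i u p.
have S0 : 0 <= H0 p - 2 * (2 * t p / asq p) * GH p + (2 * t p / asq p) ^+ 2 * G0 p.
  rewrite (_ : _ + _ = \sum_i (h i - 2 * t p / asq p * g i) ^+ 2).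
    by apply: sumr_ge0 => i _; exact: sqr_ge0.
  rewrite /H0 /GH /G0 !offun_sum !mulr_sumr -sumrN -!big_split.
  by apply: eq_bigr => i _ /=; rewrite !offunX// !offunM /h /g; ring.
have tr : lap u p ^+ 2 <= (n%:R - 1) *
    (\sum_i \sum_j del j (del i u) * del i (del j u) : offun) p.
  have -> : (\sum_i \sum_j del j (del i u) * del i (del j u) : offun) p =
      \sum_i \sum_j del j (del i u) p * del i (del j u) p.
    rewrite offun_sum; apply: eq_bigr => i _; rewrite offun_sum.
    by apply: eq_bigr => j _; rewrite offunM.
  have -> : lap u p ^+ 2 = (\sum_i del i (del i u) p) ^+ 2.
    by rewrite /lap offunN sqrrN offun_sum.
  have n1 : (1 < n)%N by exact: n2.
  apply: (@trace_sqr_le R n (fun i => om i p) g (fun i j => del j (del i u) p)).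
  - exact: n1.
  - have := evp _ _ (@sum_om2 R n); rewrite offun_sum offun1// => <-.
    by apply: eq_bigr => i _; rewrite offunX.
  - have := evp _ _ (sum_om_del u); rewrite offun_sum offun0 => E.
    by rewrite -[RHS]E; apply: eq_bigr => i _; rewrite offunM.
  - move=> i; have := evp _ _ (sum_om_del (del i u)); rewrite offun_sum offun0 => E.
    by rewrite -[RHS]E; apply: eq_bigr => j _; rewrite offunM.
  - move=> j; have := evp _ _ (sum_om_del_del j); rewrite offun_sum offunN => E.
    by rewrite -[RHS]E; apply: eq_bigr => i _; rewrite offunM.
  - move=> i j; have := evp _ _ (del_comm i j u).
    by rewrite !(offunD, offunN, offunM) /g => <-; ring.
have := spherical_bound (rot u p) (rot (rot u) p) (rot (lap u) p)
  a0 nR3 w0 wq tr S0.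
cbv zeta; rewrite -qE -hE => B.
have an0 : asq p != 0 by rewrite gt_eqF.
have n10 : n%:R - 1 != 0 :> R by lra.
have n20 : n%:R - 2 != 0 :> R by lra.
have Nk (k : nat) : (k%:R : offun) p = k%:R by exact: offun_nat.
have N1 : (1 : offun) p = 1 by exact: offun1.
have Kc c : kst c p = c by exact: kstE.
have X f k : (f ^+ k) p = f p ^+ k by exact: offunX.
have aD f f1 : (f + f1) p = f p + f1 p by exact: offunD.
have aN f : (- f) p = - f p by exact: offunN.
have aM f f1 : (f * f1) p = f p * f1 p by exact: offunM.
have ev := (aD, aN, X, Nk, Kc, aM, N1).
apply: (le_trans _ (le_trans B _)); rewrite le_eqVlt; apply/orP; left; apply/eqP.
  rewrite /null1 rot_field1 /field1 /null2 /null3 /null4 /kap /nm3 /z.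
  move: (\sum_i \sum_j del j (del i u) * del i (del j u)) => S.
  move: G0 GH H0 (lap u) (rot (rot u)) => g0 gh h0 L Y2.
  move: (rot L) (rot u) => Lr Y1.
  rewrite !ev iE iE4.
  move: (g0 p) (gh p) (h0 p) (L p) (Lr p) (Y1 p) (Y2 p) (S p).
  by move=> *; field; rewrite an0 n10 n20.
rewrite /ang /Gam.
have -> : \sum_i del i u * del i u = G0.
  by apply: eq_bigr => i _; rewrite expr2.
rewrite !ev iE iE4.
by field; rewrite an0.
Qed.

End on_function.
End spherical.

(** * Polar form of the Grushin operator *)

Ltac smoothly_tac := gen_tac; repeat (apply: smoothly_partial; gen_tac).

Section grushin_polar.
Context {R : realType} {n : nat}.
Local Notation offun := (@offun R n).
Local Notation pt := ('rV[R]_n * R)%type.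
Local Notation x := (@xi R n).
Local Notation t := (@tau R n).
Local Notation r := (@r R n).
Local Notation rinv := (@rinv R n).
Local Notation om := (@om R n).
Local Notation sginv := (@sginv R n).
Local Notation asq := (@asq R n).
Local Notation quart := (@quart R n).
Local Notation pd i := (@partial R n (Some i)).
Local Notation T := (@partial R n None).
Local Notation rad := (@rad R n).
Local Notation del := (@del R n).
Local Notation dil := (@dil R n).
Local Notation rot := (@rot R n).
Implicit Types (f g u v : offun) (p : pt).

Let dP d : derivation (@partial R n d). Proof. exact: derivation_partial. Qed.
Let dR : derivation rad. Proof. exact: derivation_rad. Qed.
Let ddel i : derivation (del i). Proof. exact: derivation_del. Qed.
Let dD : derivation dil. Proof. exact: derivation_dil. Qed.
Let dB : derivation rot. Proof. exact: derivation_rot. Qed.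

Definition grad_dot f g : offun := \sum_i pd i f * pd i g + asq * T f * T g.
Definition grushin u : offun := \sum_i pd i (pd i u) + asq * T (T u).
Definition weight : offun := asq * sginv ^+ 3.

Lemma pd_polar i f : pd i f = rinv * (del i f + om i * rad f).
Proof. by rewrite del_def; ring: (@r_rinv R n). Qed.

Lemma sum_pd_pd f g : \sum_i pd i f * pd i g =
  rinv ^+ 2 * (\sum_i del i f * del i g + rad f * rad g).
Proof.
rewrite (eq_bigr (fun i => rinv ^+ 2 * (del i f * del i g)
    + rinv ^+ 2 * rad g * (om i * del i f) + rinv ^+ 2 * rad f * (om i * del i g)
    + rinv ^+ 2 * rad f * rad g * om i ^+ 2)) => [|i _]; last first.
  by rewrite !pd_polar; ring.
rewrite !big_split/= -!mulr_sumr !sum_om_del sum_om2; ring.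
Qed.

(** The mixed products of [rad] and [T] in [dil] and in [rot] cancel, and the remaining squares
    share the factor [quart]; this is what singles out the coefficients of [rot]. *)
Lemma grad_dot_polar f g : grad_dot f g = asq * sginv ^+ 2 * (dil f * dil g + Gam f g).
Proof.
rewrite /grad_dot /Gam sum_pd_pd !dil_def !rot_def.
have ra := @rinv_asq R n; have sq := @sginv_quart R n.
move: (\sum_i _) (rad f) (rad g) (T f) (T g) => S a b c d.
transitivity (sginv ^+ 2 * quart * (rinv ^+ 2 * (S + a * b) + asq * c * d)).
  by rewrite sq mul1r.
by move: sq; rewrite quart_def => sq; ring: ra.
Qed.

Lemma grushin_polar_form u :
  grushin u = asq * sginv ^+ 2 * (dil (dil u) + n%:R * dil u - ang u).
Proof.
have ra := @rinv_asq R n; have sq := @sginv_quart R n.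
(* The Euclidean Laplacian in polar coordinates; [rad] is |x| times the radial derivative, whence n
   - 2 in place of n - 1. *)
have E : asq * \sum_i pd i (pd i u) =
    - lap u + (n%:R - 2) * rad u + rad (rad u).
  rewrite -r2 mulr_sumr.
  rewrite (eq_bigr (fun i => r * pd i (r * pd i u) - om i * (r * pd i u))); last first.
    by move=> i _; rewrite (derM (dP _)) pd_r; ring.
  rewrite sumrB -rad_rpd.
  rewrite (eq_bigr (fun i => del i (del i u) + rad u * 1 - rad u * om i ^+ 2
      + 2 * (om i * del i (rad u)) + rad (rad u) * om i ^+ 2)); last first.
    move=> i _; rewrite r_pd r_pd (derD (ddel i)) (derM (ddel i)) (derD dR).
    by rewrite (derM dR) rad_om del_om eqxx mulr1n -del_rad; ring.
  rewrite !big_split/= !sumrN -!mulr_sumr sum_om_del sum_om2 sumr_const card_ord.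
  by rewrite /lap; ring.
have E' : \sum_i pd i (pd i u) =
    rinv ^+ 2 * (- lap u + (n%:R - 2) * rad u + rad (rad u)).
  by rewrite -E mulrA ra mul1r.
rewrite /grushin E' {E E'} /ang (rot_def (rot u)) (dil_def (dil u)) rad_dil T_dil.
have -> : rad (rot u) = 2 * t * (rinv ^+ 2 * (rad (rad u) - 2 * rad u))
    - asq * (2 * T u + T (rad u)).
  rewrite rot_def (derD dR) (derN dR) !(derM dR) rad_rinv rad_asq rad_tau rad_T.
  by rewrite (der_nat dR); ring.
have -> : T (rot u) = 2 * (rinv ^+ 2 * rad u) + 2 * t * (rinv ^+ 2 * T (rad u))
    - asq * T (T u).
  rewrite rot_def (derD (dP _)) (derN (dP _)) !(derM (dP _)) T_rinv T_asq T_tau.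
  by rewrite (der_nat (dP _)); ring.
rewrite rot_def dil_def.
move: (lap u) (rad u) (rad (rad u)) (T u) (T (T u)) (T (rad u)) n%:R.
move=> l a aa c cc ca k.
transitivity (sginv ^+ 2 * quart *
    (rinv ^+ 2 * (- l + (k - 2) * a + aa) + asq * cc)).
  by rewrite sq mul1r.
move: sq; rewrite quart_def => sq; ring: ra.
Qed.

Lemma GamC f g : Gam f g = Gam g f.
Proof.
rewrite /Gam mulrC; congr (_ + _ * _).
by apply: eq_bigr => i _; rewrite mulrC.
Qed.

(** [dil] commutes with [rot] and [del i], and the coefficient [rinv ^+ 4 * quart] is homogeneous of
    degree 0. *)
Lemma dil_Gam f g : dil (Gam f g) = Gam (dil f) g + Gam f (dil g).
Proof.
have E : dil (rinv ^+ 4) = - 4 * rinv ^+ 4.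
  rewrite (_ : rinv ^+ 4 = rinv ^+ 2 * rinv ^+ 2); last by ring.
  by rewrite (derM dD) (derX2 dD) dil_rinv; ring.
rewrite /Gam (derD dD); move: (rinv ^+ 4) E => r4 E.
rewrite !(derM dD) !dil_rot dil_quart E (der_sum dD).
have -> : \sum_i dil (del i f * del i g) =
    \sum_i (del i (dil f) * del i g + del i f * del i (dil g)).
  by apply: eq_bigr => i _; rewrite (derM dD) !del_dil.
by rewrite big_split/=; ring.
Qed.

Lemma GamDl f1 f2 g : Gam (f1 + f2) g = Gam f1 g + Gam f2 g.
Proof.
rewrite /Gam (derD dB).
rewrite (eq_bigr (fun i => del i f1 * del i g + del i f2 * del i g)).
  by rewrite big_split/=; ring.
by move=> i _; rewrite (derD (ddel i)); ring.
Qed.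

Lemma GamZl c f g : Gam (kst c * f) g = kst c * Gam f g.
Proof.
rewrite /Gam (derM dB) (der_kst dB).
rewrite (eq_bigr (fun i => kst c * (del i f * del i g))).
  by rewrite -mulr_sumr; ring.
by move=> i _; rewrite (derM (ddel i)) (der_kst (ddel i)); ring.
Qed.

Lemma Gam_ge0 f p : p.1 != 0 -> 0 <= Gam f f p.
Proof.
move=> p0; have r40 : 0 <= (rinv ^+ 4) p.
  by rewrite offunX// (exprM _ 2 2) sqr_ge0.
rewrite /Gam offunD; move: (rinv ^+ 4) r40 => r4 r40.
rewrite !offunM offun_sum addr_ge0 -?expr2 ?sqr_ge0// mulr_ge0//.
  by rewrite mulr_ge0 ?(ltW (quart_gt0 p0)).
by apply: sumr_ge0 => i _; rewrite offunM -expr2 sqr_ge0.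
Qed.

Lemma weight_gt0 p : p.1 != 0 -> 0 < weight p.
Proof.
move=> p0; rewrite /weight offunM offunX// mulr_gt0 ?asq_gt0// exprn_gt0//.
by rewrite sginv_def invsqrt_gt0.
Qed.

Lemma dil_weight : dil weight = - 4 * weight.
Proof. by rewrite /weight (derM dD) (derX3 dD) dil_asq dil_sginv; ring. Qed.

Lemma smoothly_tame f : smoothly f -> tame f.
Proof.
rewrite /smoothly; elim=> {f} [g [i||| {}g sg]|c|f g _ tf _ tg|f g _ tf _ tg].
- have -> : x i = r * om i by rewrite om_def; ring: (@r_rinv R n).
  by apply: gen_mul; [exact: tame_r|exact: tame_om].
- exact: tame_tau.
- exact: tame_sginv.
- exact: tame_jet.
- exact: gen_kst.
- exact: gen_add.
- exact: gen_mul.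
Qed.

Lemma smoothly_asq : smoothly asq. Proof. by rewrite asq_def; smoothly_tac. Qed.
Lemma smoothly_dil f : smoothly f -> smoothly (dil f).
Proof. by rewrite dil_def rad_def; smoothly_tac. Qed.
Lemma smoothly_weight : smoothly weight.
Proof. by have sa := smoothly_asq; rewrite /weight; smoothly_tac. Qed.
Lemma smoothly_grad_dot f g : smoothly f -> smoothly g -> smoothly (grad_dot f g).
Proof. by have sa := smoothly_asq; rewrite /grad_dot; smoothly_tac. Qed.
Lemma weight_Gam f g : weight * Gam f g = sginv * grad_dot f g - weight * dil f * dil g.
Proof. by rewrite grad_dot_polar /weight; ring. Qed.

(** [rot] and [del i] are singular at the axis, but [weight_Gam] writes the product as a full
    gradient term minus its radial part, both free of 1 / |x|. *)
Lemma smoothly_weight_Gam f g : smoothly f -> smoothly g -> smoothly (weight * Gam f g).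
Proof.
move=> sf sg; rewrite weight_Gam; have := smoothly_grad_dot sf sg; have := smoothly_weight.
by have := smoothly_dil sf; have := smoothly_dil sg; smoothly_tac.
Qed.

Variables (K : set pt) (N : R).
Hypotheses (n3 : (3 <= n)%N) (cptK : compact K) (KN : K `<=` in_box N)
  (K0 : ~ K (0, 0)).
Let n2 : (2 <= n)%N. Proof. exact: ltnW. Qed.

Local Notation supp_partial := (supp_partial cptK).
Local Notation supp_dil := (supp_dil cptK).

(** This is b = (Q - 4) / 2, since Q = n + 2; hence [bexp + 2] is Q / 2. *)
Definition bexp : offun := kst ((n%:R - 2) / 2).

Lemma n_bexp : n%:R = 2 * bexp + 2 :> offun.
Proof.
have E : n%:R = 2 * ((n%:R - 2) / 2) + 2 :> R by field.
by rewrite /bexp -!kst_nat -kstM -kstD -E.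
Qed.

(** The divergence n + 2 of the dilations and the degree -4 of [weight] add up to n - 2 = 2b. *)
Lemma nullG_weight_dil f : smoothly (weight * f) -> supported K f ->
  nullG (weight * (dil f + 2 * bexp * f)).
Proof.
move=> sf Kf.
have -> : weight * (dil f + 2 * bexp * f) = dil (weight * f) + (n%:R + 2) * (weight * f).
  by rewrite (derM dD) dil_weight n_bexp; ring.
apply: (nullG_dil n2 cptK KN K0); first exact: smoothly_tame.
exact: supp_inMr.
Qed.

Lemma grad_dot_sginv g : grad_dot sginv g = - 2 * weight * dil g.
Proof.
rewrite grad_dot_polar /Gam rot_sginv dil_sginv big1 => [|i _]; last first.
  by rewrite del_sginv mul0r.
by rewrite /weight; ring.
Qed.

(** Obtained from the Grushin divergence of [sginv * f] times the gradient of [g], by polar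
    decomposition; its radial part is itself null by [nullG_weight_dil] for [f * dil g]. *)
Lemma nullG_Green f g : smoothly f -> smoothly g -> supported K g ->
  nullG (weight * (Gam f g - f * ang g)).
Proof.
move=> sf sg Kg; have sa := smoothly_asq; have sd := smoothly_dil sg.
have sW := smoothly_weight.
have -> : weight * (Gam f g - f * ang g) =
    \sum_i pd i (sginv * f * pd i g) + T (asq * sginv * f * T g)
    - weight * (dil (f * dil g) + 2 * bexp * (f * dil g)).
  have -> : \sum_i pd i (sginv * f * pd i g) + T (asq * sginv * f * T g) =
      sginv * grad_dot f g + f * grad_dot sginv g + sginv * f * grushin g.
    rewrite /grad_dot /grushin.
    rewrite (eq_bigr (fun i => sginv * (pd i f * pd i g)
        + f * (pd i sginv * pd i g) + sginv * f * (pd i (pd i g)))); last first.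
      by move=> i _; rewrite !(derM (dP _)); ring.
    rewrite !big_split/= -!mulr_sumr !(derM (dP _)) T_asq.
    by ring.
  rewrite grad_dot_sginv grushin_polar_form grad_dot_polar (derM dD) n_bexp /weight.
  by ring.
apply: nullGD; last first.
  apply/nullGN/nullG_weight_dil; first by smoothly_tac.
  exact/supp_inMr/supp_dil.
apply: nullGD; last first.
  apply: (nullG_smoothly n2 cptK KN K0); first by smoothly_tac.
  exact/supp_inMr/supp_partial.
apply: nullG_sum => i; apply: (nullG_smoothly n2 cptK KN K0); first by smoothly_tac.
exact/supp_inMr/supp_partial.
Qed.

Lemma supp_Gam f g : supported K g -> supported K (Gam f g).
Proof.
move=> Kg; apply: supp_inD; first exact/supp_inMr/(supp_rot cptK).
by apply/supp_inMr/supp_in_sum => i; exact/supp_inMr/(supp_del cptK).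
Qed.

Variables (u : offun).
Hypotheses (su : extends_smoothly u) (Ku : supported K u).

(** These five functions are the integrands of the theorem in polar form, as [op_term_of], [gradGE],
    [dil_term_of], [sq_term_of] and [tilt_term_of] show. *)
Definition op_term : offun := weight * (dil (dil u) + n%:R * dil u - ang u) ^+ 2.
Definition grad_term : offun := weight * (dil u ^+ 2 + Gam u u).
Definition dil_term : offun :=
  weight * ((dil (dil u) + bexp * dil u) ^+ 2 + Gam (dil u) (dil u)).
Definition sq_term : offun := weight * u ^+ 2.
Definition tilt_term : offun := weight * ((dil u + bexp * u) ^+ 2 + Gam u u).

Lemma hardy_rellich_off : exists2 Z, nullG Z & forall p, p.1 != 0 ->
  ((bexp + 2) ^+ 2 * grad_term + dil_term + Z) p <= op_term p.
Proof.
have sju : smoothly u by exact: smoothly_jet.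
have sv := smoothly_dil sju; have sw := smoothly_dil sv; have sW := smoothly_weight.
have Kv : supported K (dil u) by exact: supp_dil.
have [Z1 Z10 Z1P] := spherical_ineq n3 cptK KN K0 su Ku.
set v := dil u in sv sw Kv *.
(* Green's formula turns the cross term -2 (dil v + n v) ang u of the expanded square into Gam (dil
   v + n v, u). The next two functions remove [dil] from Gam (dil v, u) and Gam (v, u), the last one
   from v * dil v. *)
exists (Z1 + (2 * (weight * (Gam (dil v + n%:R * v) u - (dil v + n%:R * v) * ang u)))
    - 2 * (weight * (dil (Gam v u) + 2 * bexp * Gam v u))
    - (bexp + 2) * (weight * (dil (Gam u u) + 2 * bexp * Gam u u))
    + (bexp + 2) * (weight * (dil (v ^+ 2) + 2 * bexp * v ^+ 2))).
  have two : bexp + 2 = kst ((n%:R - 2) / 2 + 2) by rewrite kstD kst_nat.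
  rewrite two -(kst_nat 2).
  apply: nullGD; last first.
    apply/nullGZ; rewrite kst_nat; apply: nullG_weight_dil; first by smoothly_tac.
    by rewrite expr2; exact: supp_inMr.
  apply: nullGD; last first.
    apply/nullGN/nullGZ; rewrite kst_nat; apply: nullG_weight_dil.
      exact: smoothly_weight_Gam.
    exact: supp_Gam.
  apply: nullGD; last first.
    apply/nullGN/nullGZ; rewrite kst_nat; apply: nullG_weight_dil.
      exact: smoothly_weight_Gam.
    exact: supp_Gam.
  apply: nullGD => //; apply: nullGZ.
  by apply: nullG_Green => //; smoothly_tac.
move=> p p0; have := Z1P p p0; rewrite -/weight.
have NE : n%:R = kst n%:R :> offun by rewrite kst_nat.
have -> : op_term = (bexp + 2) ^+ 2 * grad_term + dil_term
    + (2 * (weight * (Gam (dil v + n%:R * v) u - (dil v + n%:R * v) * ang u)))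
    - 2 * (weight * (dil (Gam v u) + 2 * bexp * Gam v u))
    - (bexp + 2) * (weight * (dil (Gam u u) + 2 * bexp * Gam u u))
    + (bexp + 2) * (weight * (dil (v ^+ 2) + 2 * bexp * v ^+ 2))
    + (weight * (ang u ^+ 2 - (n%:R + 1) * Gam u u))
    + weight * ((n%:R - 3) * Gam u u + Gam (v + bexp * u) (v + bexp * u)).
  rewrite /op_term /grad_term /dil_term -/v !dil_Gam (derX2 dD) -/v.
  have -> : Gam (dil v + n%:R * v) u = Gam (dil v) u + n%:R * Gam v u.
    by rewrite NE GamDl GamZl.
  have -> : Gam (v + bexp * u) (v + bexp * u) =
      Gam v v + 2 * bexp * Gam v u + bexp ^+ 2 * Gam u u.
    have Dr h f g : Gam h (f + g) = Gam h f + Gam h g.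
      by rewrite GamC GamDl !(GamC h).
    have Zr h : Gam h (bexp * u) = bexp * Gam h u by rewrite GamC GamZl (GamC h).
    have Zl h : Gam (bexp * u) h = bexp * Gam u h by exact: GamZl.
    by rewrite GamDl Zl !Dr !Zr (GamC u v); ring.
  rewrite n_bexp (GamC u v).
  move: (Gam (dil v) u) (Gam v u) (Gam u u) (Gam v v) (ang u) (dil v) weight bexp (v : offun).
  by move=> *; ring.
(* Here n - 3 is the spectral gap n + 1 minus the 4 Gam (u, u) that has to be absorbed. *)
have P0 : 0 <= (weight * ((n%:R - 3) * Gam u u + Gam (v + bexp * u) (v + bexp * u))) p.
  rewrite offunM; apply: mulr_ge0; first exact/ltW/weight_gt0.
  rewrite offunD; apply: addr_ge0; last exact: Gam_ge0.
  rewrite offunM; apply: mulr_ge0; last exact: Gam_ge0.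
  by rewrite offunD offunN !offun_nat// subr_ge0 ler_nat.
move: P0; set Y := weight * (_ * _ + _); set Z3 := weight * (ang u ^+ 2 - _).
rewrite !offunD; move: (Y p) (Z3 p) => y z.
by move=> y0 zz; lra.
Qed.

(** With v = dil u, v^2 = (v + b u)^2 + b^2 u^2 - b (dil (u^2) + 2 b u^2), and [weight] times the
    last bracket is null. *)
Lemma rellich_off : exists2 Z, nullG Z & forall p, p.1 != 0 ->
  ((bexp + 2) ^+ 2 * bexp ^+ 2 * sq_term + (bexp + 2) ^+ 2 * tilt_term + dil_term + Z) p
  <= op_term p.
Proof.
have [Z Z0 ZP] := hardy_rellich_off.
have sju : smoothly u by exact: smoothly_jet.
have sW := smoothly_weight.
exists (Z - (bexp + 2) ^+ 2 * bexp * (weight * (dil (u ^+ 2) + 2 * bexp * u ^+ 2))).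
  apply: nullGD => //; apply: nullGN.
  have -> : (bexp + 2) ^+ 2 * bexp =
      kst (((n%:R - 2) / 2 + 2) ^+ 2 * ((n%:R - 2) / 2)).
    by rewrite !expr2 {1 2}/bexp -(kst_nat 2) -kstD -!kstM.
  apply: nullGZ; apply: nullG_weight_dil; first by smoothly_tac.
  by rewrite expr2; exact: supp_inMr.
move=> p /ZP; set a := (X in X p <= _ -> _); set b := (X in _ -> X p <= _).
rewrite (_ : a = b)//; apply: (congr1 (fun f : offun => (f : pt -> R))).
rewrite /grad_term /tilt_term /sq_term (derX2 dD).
by move: (Gam u u) (dil u) weight bexp dil_term => *; ring.
Qed.

End grushin_polar.

(** * From pointwise inequalities to integrals *)

Section integral_off_null.
Context d (X : measurableType d) (R : realType) (mu : {measure set X -> \bar R}).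
Implicit Types (f g : X -> \bar R).
Import HBNNSimple.
Local Open Scope ereal_scope.

(* No measurability is available: the integrands of the theorem are arbitrary on
   the axis, where their factors need not be differentiable. *)
Lemma ge0_le_integral_off_null (N : set X) f g : measurable N -> mu N = 0 ->
  (forall x, 0 <= f x) -> (forall x, 0 <= g x) ->
  (forall x, ~ N x -> f x <= g x) -> \int[mu]_x f x <= \int[mu]_x g x.
Proof.
move=> mN N0 f0 g0 fg; rewrite !ge0_integralTE//.
apply: ge_ereal_sup => _ [h hf <-].
have mC : measurable (~` N) by exact: measurableC.
(* Setting the simple function [h] to zero on [N] puts it below [g] everywhere and leaves its
   integral unchanged. *)
apply: ereal_sup_ubound; exists (proj_nnsfun h mC).
  move=> x; rewrite /= mindicE.
  have [Nx|Nx] := pselect (N x).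
    by rewrite memNset ?mulr0//; exact.
  by rewrite mem_set// mulr1 (le_trans (hf x))// fg.
have E (k : {nnsfun X >-> R}) : sintegral mu k = \int[mu]_x (k x)%:E.
  by rewrite integral_nnsfun// patch_setT.
rewrite !E; apply: ge0_ae_eq_integral => //.
- exact/measurable_EFinP.
- exact/measurable_EFinP.
- by move=> x _; rewrite lee_fin.
- by move=> x _; rewrite lee_fin.
exists N; split=> // x /= /not_implyP[_]; apply: contra_notP => Nx.
by rewrite mindicE mem_set// mulr1.
Qed.

End integral_off_null.

Section integralG_off_axis.
Context {R : realType} {n : nat}.
Local Notation offun := (@offun R n).
Local Notation pt := ('rV[R]_n * R)%type.
Local Notation mR := (measurableTypeR R).
Local Notation zt := (n.-tuple mR * mR)%type.
Local Notation nu := (lebesgue_tuple n \x @lebesgue_measure R)%E.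
Implicit Types (f g H Z : offun) (F G : pt -> R) (p : pt).
Hypothesis n0 : (0 < n)%N.

Lemma ge0_le_integralG F G : (forall p, 0 <= F p) -> (forall p, 0 <= G p) ->
  (forall p, p.1 != 0 -> F p <= G p) -> (integralG F <= integralG G)%E.
Proof.
(* The axis lies in the null hyperplane where the first coordinate vanishes. *)
move=> F0 G0 FG; pose i := Ordinal n0.
apply: (@ge0_le_integral_off_null _ _ R nu [set z : zt | tnth z.1 i = 0]).
- exact: measurable_hyperplane.
- exact: null_hyperplane.
- by move=> z; rewrite lee_fin.
- by move=> z; rewrite lee_fin.
move=> z zi; rewrite lee_fin; apply: FG; apply: contra_notN zi => /eqP E.
by move/rowP : E => /(_ i); rewrite !mxE.
Qed.

Lemma eq_integralG F G : (forall p, 0 <= F p) -> (forall p, 0 <= G p) ->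
  (forall p, p.1 != 0 -> F p = G p) -> integralG F = integralG G.
Proof.
move=> F0 G0 FG; apply/eqP; rewrite eq_le.
by apply/andP; split; apply: ge0_le_integralG => // p /FG ->.
Qed.

(** The integral of [H] may be infinite, in which case there is nothing to prove; otherwise [H],
    being nonnegative and measurable, is integrable and [Z] drops out by additivity. *)
Lemma le_integralG f H Z : integrableG f -> nullG Z ->
  (forall p, p.1 != 0 -> 0 <= H p) ->
  (forall p, p.1 != 0 -> (f + Z) p <= H p) -> (integralG f <= integralG H)%E.
Proof.
move=> If [IZ Z0] H0 fH.
have {}H0 p : 0 <= H p.
  by have [p0|/H0//] := eqVneq p.1 0; rewrite offun_axis.
have {}fH p : (f + Z) p <= H p.
  by have [p0|/fH//] := eqVneq p.1 0; rewrite !offun_axis.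
have [->|Hoo] := eqVneq (integralG H) +oo%E; first exact: leey.
have IH : integrableG H.
  apply/integrableP; split; first by apply/measurable_EFinP; exact: (measurable_offun H).
  rewrite (_ : (fun z => `|_|%E) = (fun z => (H (toPt z))%:E)); last first.
    by apply/funext => z /=; rewrite ger0_norm.
  by move: Hoo; rewrite -ltey.
have [IfZ E] := integralGD If IZ.
have -> : integralG f = integralG (f + Z) by rewrite E Z0 adde0.
by have := le_integral measurableT IfZ IH; apply => z _; rewrite lee_fin.
Qed.

End integralG_off_axis.

(** * Dictionary between the integrands of the statement and their polar form *)

Section grushin_bridge.
Context {R : realType} {n : nat}.
Local Notation offun := (@offun R n).
Local Notation pt := ('rV[R]_n * R)%type.
Local Notation sginv := (@sginv R n).
Local Notation asq := (@asq R n).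
Local Notation quart := (@quart R n).
Local Notation pd i := (@partial R n (Some i)).
Local Notation T := (@partial R n None).
Local Notation dil := (@dil R n).
Implicit Types (f g : offun) (F : pt -> R) (p : pt).

Let dD : derivation dil. Proof. exact: derivation_dil. Qed.

Lemma enorm_sqr p : p.1 != 0 -> enorm p.1 ^+ 2 = asq p.
Proof.
move=> p0; rewrite asqE// sqr_sqrtr//.
by apply: sumr_ge0 => i _; exact: sqr_ge0.
Qed.

Lemma enormG_sqr (v : pt) : enormG v ^+ 2 = \sum_i v.1 0 i ^+ 2 + v.2 ^+ 2.
Proof.
by rewrite sqr_sqrtr// addr_ge0 ?sqr_ge0// sumr_ge0// => i _; exact: sqr_ge0.
Qed.

Lemma rho_powR p (s : R) : p.1 != 0 -> rho p `^ s = quart p `^ (s / 4).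
Proof.
move=> p0; rewrite /rho -powRrM quartE// -enorm_sqr// -exprM.
by congr (_ `^ _); rewrite mulrC.
Qed.

Lemma rhoE p : p.1 != 0 -> rho p = quart p `^ 4^-1.
Proof. by move=> p0; rewrite -[LHS]powRr1 ?powR_ge0// rho_powR// mul1r. Qed.

Lemma rho_gt0 p : p.1 != 0 -> 0 < rho p.
Proof. by move=> p0; rewrite rhoE// powR_gt0// quart_gt0. Qed.

Lemma sginv_powR p : p.1 != 0 -> sginv p = quart p `^ (- 2^-1).
Proof.
move=> p0; rewrite powRN powR12_sqrt ?ltW ?quart_gt0//.
by rewrite sginv_def invsqrtE.
Qed.

Lemma rho_sqr p : p.1 != 0 -> rho p ^+ 2 = (sginv p)^-1.
Proof.
move=> p0; rewrite sginv_powR// powRN invrK -powR_mulrn ?ltW ?rho_gt0//.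
by rewrite rho_powR//; congr (_ `^ _); field.
Qed.

Lemma derive_eq F f d p : (forall q, q.1 != 0 -> F q = f q) -> p.1 != 0 ->
  'D_(dir d) F p = partial d f p.
Proof. by move=> Ff p0; rewrite (@partial_eq _ _ _ f F)// => q /Ff. Qed.

(** Real powers of [quart] stay outside the ring: the power factors out and leaves an [offun], in
    which c / quart is written with [sginv ^+ 2]. *)
Lemma derive_quart_powR F f (c : R) d p :
  (forall q, q.1 != 0 -> F q = f q * quart q `^ c) -> p.1 != 0 ->
  'D_(dir d) F p =
  quart p `^ c * (partial d f + kst c * f * sginv ^+ 2 * partial d quart) p.
Proof.
move=> Ff p0; have q0 := quart_gt0 p0.
have -> : 'D_(dir d) F p = 'D_(dir d) (fun q => f q * quart q `^ c) p.
  apply: (eq_derive_on open_off_axis); last exact/mem_set.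
  by move=> q /set_mem/Ff.
have D1 := offun_is_derive f d p0.
have D2 := is_derive_comp1 (offun_is_derive quart d p0) (is_derive1_powR c q0).
have [_ ->] := is_deriveM D1 D2.
have sq : (sginv ^+ 2) p = (quart p)^-1.
  have := congr1 (fun f : offun => f p) (@sginv_quart R n).
  rewrite offunM offun1// => E.
  by rewrite -[RHS]mul1r -E mulfK// gt_eqF.
move: (sginv ^+ 2) sq => s2 sq.
rewrite offunD !offunM kstE// sq powRB ?(gt_eqF q0) ?implybT//.
rewrite powRr1 ?ltW//=.
rewrite /GRing.scale/=; field.
by rewrite gt_eqF.
Qed.

(** [quart] is a function of rho alone, so the correction [g * partial d quart] changes only the
    radial part, through [dil quart] = 4 [quart]. *)
Lemma gradG_sqr F f g (k : R) p :
  (forall d, 'D_(dir d) F p = k * (partial d f + g * partial d quart) p) ->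
  p.1 != 0 -> enormG (gradG F p) ^+ 2 =
  k ^+ 2 * (asq * sginv ^+ 2 * ((dil f + 4 * quart * g) ^+ 2 + Gam f f)) p.
Proof.
move=> DF p0; rewrite enormG_sqr.
have -> : asq * sginv ^+ 2 * ((dil f + 4 * quart * g) ^+ 2 + Gam f f) =
    \sum_i (pd i f + g * pd i quart) ^+ 2 + asq * (T f + g * T quart) ^+ 2.
  have G0 h : Gam h quart = 0.
    rewrite /Gam rot_quart big1 => [|i _]; last by rewrite del_quart mulr0.
    by ring.
  transitivity (grad_dot f f + 2 * g * grad_dot f quart + g ^+ 2 * grad_dot quart quart).
    by rewrite !grad_dot_polar !G0 dil_quart; ring.
  have -> : \sum_i (pd i f + g * pd i quart) ^+ 2 = \sum_i (pd i f * pd i f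
      + 2 * g * (pd i f * pd i quart) + g ^+ 2 * (pd i quart * pd i quart)).
    by apply: eq_bigr => i _; ring.
  by rewrite /grad_dot !big_split/= -!mulr_sumr; ring.
rewrite offunD offunM offunX// offun_sum mulrDr mulr_sumr; congr (_ + _).
  apply: eq_bigr => i _; rewrite mxE offunX// -exprMn; congr (_ ^+ 2).
  exact: (DF (Some i)).
have -> : (gradG F p).2 = enorm p.1 * (k * (T f + g * T quart) p).
  by congr (_ * _); exact: (DF None).
by rewrite !exprMn enorm_sqr//; ring.
Qed.

Lemma gradG_quart_powR F f (c : R) p :
  (forall q, q.1 != 0 -> F q = f q * quart q `^ c) -> p.1 != 0 ->
  enormG (gradG F p) ^+ 2 = (quart p `^ c) ^+ 2 *
    (asq * sginv ^+ 2 * ((dil f + kst (4 * c) * f) ^+ 2 + Gam f f)) p.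
Proof.
move=> Ff p0; rewrite (@gradG_sqr F f (kst c * f * sginv ^+ 2) (quart p `^ c))//.
  congr (_ * _); congr ((_ : offun) _); congr (_ * ((_ + _) ^+ _ + _)).
  rewrite kstM kst_nat; ring: (@sginv_quart R n).
by move=> d; exact: derive_quart_powR.
Qed.

Lemma gradG_rho_sqr p : p.1 != 0 ->
  enormG (gradG rho p) ^+ 2 = (asq * sginv) p.
Proof.
move=> p0; rewrite (@gradG_quart_powR rho 1 4^-1)//; last first.
  by move=> q q0; rewrite offun1// mul1r rhoE.
rewrite -rhoE// rho_sqr// mulfV ?pnatr_eq0// kst1.
have -> : Gam (1 : offun) 1 = 0.
  rewrite /Gam (der1 (derivation_rot)) big1 => [|i _]; first by ring.
  by rewrite (der1 (derivation_del i)) mul0r.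
rewrite (der1 dD) add0r mulr1 expr1n addr0 mulr1 expr2 !offunM; field.
by rewrite gt_eqF// sginv_def invsqrt_gt0.
Qed.

Section test_function.
Variables (u : pt -> R) (U : offun).
Hypotheses (uU : forall p, p.1 != 0 -> u p = U p).

Lemma LG_grushin p : p.1 != 0 -> LG u p = grushin U p.
Proof.
move=> p0; have E d q : q.1 != 0 -> 'D_(dir d) u q = partial d U q.
  exact: derive_eq.
rewrite /LG /grushin enorm_sqr// offunD offunM offun_sum; congr (_ + _ * _).
  apply: eq_bigr => i _; apply: (@derive_eq _ _ (Some i)) => // q.
  exact: (E (Some i)).
by apply: (@derive_eq _ _ None) => // q; exact: (E None).
Qed.

Lemma drhoE p : p.1 != 0 -> drho u p = (rho p)^-1 * dil U p.
Proof.
move=> p0; rewrite /drho dil_def rad_def offunD !offunM offun_sum tauE//.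
rewrite offun_nat//; congr (_ * (_ + _ * _)); last exact: (@derive_eq _ _ None).
apply: eq_bigr => i _; rewrite offunM xiE//; congr (_ * _).
exact: (@derive_eq _ _ (Some i)).
Qed.

Lemma gradGE p : p.1 != 0 -> enormG (gradG u p) ^+ 2 / rho p ^+ 2 =
  grad_term U p.
Proof.
move=> p0; rewrite (@gradG_quart_powR u U 0)//; last first.
  by move=> q q0; rewrite powRr0 mulr1 uU.
rewrite powRr0 expr1n mul1r rho_sqr// invrK -offunM; congr ((_ : offun) _).
by rewrite mulr0 kst0 /grad_term /weight; ring.
Qed.

(** As rho = quart^(1/4), the exponent (Q - 4) / 8 is that of rho^((Q - 4) / 2). Its square times
    rho^(2 - Q) is quart^(-1/2) = [sginv], independently of Q. *)
Lemma weighted_gradG (Q : R) F f p : (forall q, q.1 != 0 ->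
    F q = f q * quart q `^ ((Q - 4) / 8)) -> p.1 != 0 ->
  rho p `^ (2 - Q) * enormG (gradG F p) ^+ 2 =
  (weight * ((dil f + kst ((Q - 4) / 2) * f) ^+ 2 + Gam f f)) p.
Proof.
move=> Ff p0; rewrite (gradG_quart_powR Ff p0) rho_powR// mulrA.
rewrite -powR_mulrn ?powR_ge0// -powRrM -powRD; last first.
  by rewrite (gt_eqF (quart_gt0 p0)) implybT.
have -> : (2 - Q) / 4 + (Q - 4) / 8 * 2%:R = - 2^-1 by field.
rewrite -sginv_powR// -offunM; congr ((_ : offun) _).
have -> : 4 * ((Q - 4) / 8) = (Q - 4) / 2 by field.
by rewrite /weight; ring.
Qed.

Lemma tilt_term_of (Q : R) p : p.1 != 0 ->
  rho p `^ (2 - Q)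
    * enormG (gradG (fun q => u q * rho q `^ ((Q - 4) / 2)) p) ^+ 2 =
  (weight * ((dil U + kst ((Q - 4) / 2) * U) ^+ 2 + Gam U U)) p.
Proof.
move=> p0; apply: weighted_gradG => // q q0; rewrite uU// rho_powR//.
by congr (_ * _ `^ _); field.
Qed.

(** The factor 1 / rho in [drho] lowers the exponent (Q - 2) / 2 to (Q - 4) / 2, so [dil U] is
    treated exactly as [U] in [tilt_term_of]. *)
Lemma dil_term_of (Q : R) p : p.1 != 0 ->
  rho p `^ (2 - Q)
    * enormG (gradG (fun q => drho u q * rho q `^ ((Q - 2) / 2)) p) ^+ 2 =
  (weight * ((dil (dil U) + kst ((Q - 4) / 2) * dil U) ^+ 2 + Gam (dil U) (dil U))) p.
Proof.
move=> p0; apply: weighted_gradG => // q q0; rewrite drhoE//.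
rewrite rho_powR// rhoE// mulrAC mulrC -powRN -powRD; last first.
  by rewrite (gt_eqF (quart_gt0 q0)) implybT.
by congr (_ * _ `^ _); field.
Qed.

Lemma sq_term_of p : p.1 != 0 ->
  `|u p| ^+ 2 * enormG (gradG rho p) ^+ 2 / rho p ^+ 4 = sq_term U p.
Proof.
move=> p0; rewrite gradG_rho_sqr// real_normK ?num_real// uU//.
rewrite (exprM _ 2 2) rho_sqr// exprVn invrK /sq_term /weight.
have X (h : offun) k : (h ^+ k) p = h p ^+ k by exact: offunX.
have aM (h1 h2 : offun) : (h1 * h2) p = h1 p * h2 p by exact: offunM.
by rewrite !(X, aM); ring.
Qed.

(** The squared factor |x|^2 rho^-4 of [grushin_polar_form], divided by |grad rho|^2 = |x|^2 rho^-2,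
    is [weight]. *)
Lemma op_term_of p : p.1 != 0 ->
  LG u p ^+ 2 / enormG (gradG rho p) ^+ 2 = op_term U p.
Proof.
move=> p0; rewrite gradG_rho_sqr// LG_grushin// grushin_polar_form /op_term /weight.
have a0 := asq_gt0 p0.
have s0 : 0 < sginv p by rewrite sginv_def invsqrt_gt0.
have X (h : offun) k : (h ^+ k) p = h p ^+ k by exact: offunX.
have aM (h1 h2 : offun) : (h1 * h2) p = h1 p * h2 p by exact: offunM.
move: (_ - _ : offun) => Y; rewrite !(X, aM).
by field; rewrite !gt_eqF.
Qed.

End test_function.
End grushin_bridge.

(** * Integrability of the right-hand sides and passage to integrals *)

Section conclusion.
Context {R : realType} {n : nat}.
Local Notation offun := (@offun R n).
Local Notation pt := ('rV[R]_n * R)%type.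
Local Notation dil := (@dil R n).
Implicit Types (f : offun) (p : pt).

Lemma compact_in_box (K : set pt) : compact K -> exists N, K `<=` in_box N.
Proof.
move=> cK.
have [C HC] : bounded_on_set K (fun p : pt => \sum_i p.1 0 i ^+ 2 + p.2 ^+ 2).
  apply: (bounded_continuous_at cK) => p _.
  apply: (@continuousD _ _ _ (fun p : pt => \sum_i p.1 0 i ^+ 2)).
    apply: continuous_sum_fun => i; apply: continuous_sqr.
    exact: continuous_xcoord.
  by apply: continuous_sqr; exact: continuous_tcoord.
(* Uses |a| <= 1 + a^2, which avoids a square root of [C]. *)
have le1 (a b : R) : 0 <= b -> a ^+ 2 + b <= C -> `|a| <= 1 + C.
  move=> b0 ab; rewrite ler_norml; apply/andP; split; nra.
have S0 (P : pred 'I_n) p : 0 <= \sum_(i | P i) p.1 0 i ^+ 2.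
  by apply: sumr_ge0 => i _; exact: sqr_ge0.
exists (1 + C) => p /HC pC; have {}pC := le_trans (ler_norm _) pC; split.
  move=> i; move: pC; rewrite (bigD1 i)//= -addrA; apply: le1.
  by rewrite addr_ge0 ?sqr_ge0.
by move: pC; rewrite addrC; apply: le1.
Qed.

Variables (K : set pt) (N : R).
Hypotheses (n3 : (3 <= n)%N) (cptK : compact K) (KN : K `<=` in_box N)
  (K0 : ~ K (0, 0)).

Lemma integrable_smoothly f : smoothly f -> supported K f -> integrableG f.
Proof.
move=> sf Kf; have [C fC] := smoothly_bounded cptK KN K0 sf.
have fC' p : `|f p| <= `|C|.
  have [Kp|nKp] := pselect (K p); first exact: le_trans (fC p Kp) (ler_norm _).
  by rewrite Kf// normr0.
have f0 p : ~ in_box N p -> f p = 0 by move=> pN; apply: Kf => /KN.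
exact: integrable_box (measurable_offun f) fC' f0.
Qed.

(** Common form of the gradient terms: c = 0 gives [grad_term], and c = (Q - 4) / 2 gives
    [tilt_term] and, at [dil u], [dil_term]. *)
Definition energy (c : R) f : offun :=
  weight * ((dil f + kst c * f) ^+ 2 + Gam f f).

Lemma energy_ge0 c f p : p.1 != 0 -> 0 <= energy c f p.
Proof.
move=> p0; rewrite offunM; apply: mulr_ge0; first exact/ltW/weight_gt0.
by rewrite offunD addr_ge0 ?Gam_ge0// offunX// sqr_ge0.
Qed.

Lemma energy_integrable c f : smoothly f -> supported K f ->
  integrableG (energy c f).
Proof.
move=> sf Kf; have sd := smoothly_dil sf; apply: integrable_smoothly.
  rewrite /energy mulrDr; apply: gen_add; last exact: smoothly_weight_Gam.
  apply: gen_mul; first exact: smoothly_weight.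
  by apply/gen_exp/gen_add => //; apply: gen_mul => //; exact: gen_kst.
apply: supp_inMr; apply: supp_inD; last exact: (supp_Gam cptK).
rewrite expr2; apply: supp_inMr; apply: supp_inD; last exact: supp_inMr.
exact: (supp_dil cptK).
Qed.

End conclusion.

Theorem corollary1p1 (R : realType) (n Q : nat)
    (hn : (2 <= n)%N) (hQn : Q = (n + 2)%N) (hQ : (5 <= Q)%N)
    (u : 'rV[R]_n * R -> R) (hu : test_function u) :
  (integralG (fun p => LG u p ^+ 2 / enormG (gradG rho p) ^+ 2)%R
   >= (Q%:R ^+ 2 / 4)%:E
        * integralG (fun p => enormG (gradG u p) ^+ 2 / rho p ^+ 2)%R
      + integralG (fun p => rho p `^ (2 - Q%:R)
          * enormG (gradG (fun q => drho u q * rho q `^ ((Q%:R - 2) / 2)) p)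
              ^+ 2)%R)%E
  /\
  (integralG (fun p => LG u p ^+ 2 / enormG (gradG rho p) ^+ 2)%R
   >= (Q%:R ^+ 2 * (Q%:R - 4) ^+ 2 / 16)%:E
        * integralG (fun p =>
            `|u p| ^+ 2 * enormG (gradG rho p) ^+ 2 / rho p ^+ 4)%R
      + (Q%:R ^+ 2 / 4)%:E
        * integralG (fun p => rho p `^ (2 - Q%:R)
            * enormG (gradG (fun q => u q * rho q `^ ((Q%:R - 4) / 2)) p) ^+ 2)%R
      + integralG (fun p => rho p `^ (2 - Q%:R)
          * enormG (gradG (fun q => drho u q * rho q `^ ((Q%:R - 2) / 2)) p)
              ^+ 2)%R)%E.
Proof.
have n3 : (3 <= n)%N by move: hQ; rewrite hQn addn2.
have n0 : (0 < n)%N by exact: leq_trans n3.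
have [su cK K0] := hu; have [N KN] := compact_in_box cK.
(* [U] agrees with [u] off the axis only; [eq_integralG] transfers the integrals, the axis being a
   null set. *)
pose U := restr (smooth_off_smooth su).
have uU p : p.1 != 0 -> u p = U p by move=> p0; rewrite restrE.
have sU : extends_smoothly U by exists u => // p /uU.
have KU : supported (supp u) U.
  move=> p pK; have [p0|p0] := eqVneq p.1 0; first exact: offun_axis.
  rewrite -uU//; apply: contra_notP pK => up.
  by apply: subset_closure; apply/eqP.
clearbody U; have sU' := smoothly_jet sU.
have Qb : ((Q%:R - 4) / 2 : R) = (n%:R - 2) / 2.
  by rewrite hQn natrD; congr (_ / _); ring.
have rho0 (q : 'rV[R]_n * R) : 0 <= rho q by exact: powR_ge0.
have off0 (f : @offun R n) : (forall p, p.1 != 0 -> 0 <= f p) -> forall p, 0 <= f p.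
  by move=> f0 p; have [p0|/f0//] := eqVneq p.1 0; rewrite offun_axis.
have Ilhs : integralG (fun p => LG u p ^+ 2 / enormG (gradG rho p) ^+ 2)%R =
    integralG (op_term U).
  apply: eq_integralG => // [p||p p0].
  - by rewrite divr_ge0 ?sqr_ge0.
  - apply: off0 => p p0; rewrite offunM; apply: mulr_ge0; first exact/ltW/weight_gt0.
    by rewrite offunX// sqr_ge0.
  - exact: op_term_of.
have Igrad : integralG (fun p => enormG (gradG u p) ^+ 2 / rho p ^+ 2)%R =
    integralG (energy 0 U).
  apply: eq_integralG => // [p||p p0].
  - by rewrite divr_ge0 ?sqr_ge0.
  - by apply: off0 => p; exact: energy_ge0.
  - by rewrite (gradGE uU p0) /energy kst0 mul0r addr0.
have Idil : integralG (fun p => rho p `^ (2 - Q%:R)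
      * enormG (gradG (fun q => drho u q * rho q `^ ((Q%:R - 2) / 2)) p) ^+ 2)%R =
    integralG (energy ((n%:R - 2) / 2) (@dil R n U)).
  apply: eq_integralG => // [p||p p0].
  - by rewrite mulr_ge0 ?powR_ge0 ?sqr_ge0.
  - by apply: off0 => p; exact: energy_ge0.
  - by rewrite (dil_term_of uU _ p0) Qb.
have Itilt : integralG (fun p => rho p `^ (2 - Q%:R)
      * enormG (gradG (fun q => u q * rho q `^ ((Q%:R - 4) / 2)) p) ^+ 2)%R =
    integralG (energy ((n%:R - 2) / 2) U).
  apply: eq_integralG => // [p||p p0].
  - by rewrite mulr_ge0 ?powR_ge0 ?sqr_ge0.
  - by apply: off0 => p; exact: energy_ge0.
  - by rewrite (tilt_term_of uU _ p0) Qb.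
have Isq : integralG (fun p =>
      `|u p| ^+ 2 * enormG (gradG rho p) ^+ 2 / rho p ^+ 4)%R =
    integralG (sq_term U).
  apply: eq_integralG => // [p||p p0].
  - apply: divr_ge0; last exact: exprn_ge0.
    by apply: mulr_ge0; exact: sqr_ge0.
  - apply: off0 => p p0; rewrite offunM; apply: mulr_ge0; first exact/ltW/weight_gt0.
    by rewrite offunX// sqr_ge0.
  - exact: sq_term_of.
have lhs0 (p : 'rV[R]_n * R) : p.1 != 0 -> 0 <= op_term U p.
  move=> p0; rewrite offunM; apply: mulr_ge0; first exact/ltW/weight_gt0.
  by rewrite offunX// sqr_ge0.
have Jgrad := energy_integrable cK KN K0 0 sU' KU.
have Jtilt := energy_integrable cK KN K0 ((n%:R - 2) / 2) sU' KU.
have Jdil := energy_integrable cK KN K0 ((n%:R - 2) / 2) (smoothly_dil sU')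
  (supp_dil cK KU).
have Jsq : integrableG (sq_term U).
  apply: (integrable_smoothly cK KN K0).
    by apply: gen_mul; [exact: smoothly_weight|exact: gen_exp].
  by apply: supp_inMr; rewrite expr2; exact: supp_inMr.
have two : (bexp + 2) ^+ 2 = kst (Q%:R ^+ 2 / 4) :> @offun R n.
  rewrite /bexp -(kst_nat 2) -kstD expr2 -kstM; congr kst.
  by rewrite hQn natrD; field.
split.
  rewrite [leRHS]Ilhs [X in (_ * X + _ <= _)%E]Igrad [X in (_ + X <= _)%E]Idil.
  have [J1 <-] := integralGZ (Q%:R ^+ 2 / 4) Jgrad.
  have [J2 <-] := integralGD J1 Jdil.
  have [Z Z0 ZP] := hardy_rellich_off n3 cK KN K0 sU KU.
  apply: (le_integralG J2 Z0 lhs0) => p /ZP.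
  by rewrite two /energy kst0 mul0r addr0.
rewrite [leRHS]Ilhs [X in (_ * X + _ + _ <= _)%E]Isq.
rewrite [X in (_ + _ * X + _ <= _)%E]Itilt [X in (_ + _ + X <= _)%E]Idil.
have [J1 <-] := integralGZ (Q%:R ^+ 2 * (Q%:R - 4) ^+ 2 / 16) Jsq.
have [J2 <-] := integralGZ (Q%:R ^+ 2 / 4) Jtilt.
have [J3 <-] := integralGD J1 J2.
have [J4 <-] := integralGD J3 Jdil.
have [Z Z0 ZP] := rellich_off n3 cK KN K0 sU KU.
apply: (le_integralG J4 Z0 lhs0) => p /ZP.
rewrite two /bexp !expr2 -!kstM.
have -> : Q%:R * Q%:R / 4 * ((n%:R - 2) / 2 * ((n%:R - 2) / 2)) =
    Q%:R * Q%:R * ((Q%:R - 4) * (Q%:R - 4)) / 16 :> R.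
  by rewrite -Qb; field.
by rewrite -!expr2.
Qed.
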